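(* Let the standing assumptions, the AGILS algorithm and the merit function $E_p(z,u)$ be as described in the context, with $\epsilon>0$, $\gamma\in(0,1/(\rho_{f_2}+\rho_{g_2}))$, and step sizes satisfying, for all $k$, $\alpha_k\in[\underline{\alpha},\,2/(L_{\psi_{x,k}}+c_\alpha)]$ and $\beta_k\in[\underline{\beta},\,2/(L_{\psi_{y,k}}+c_\beta)]$, where $L_{\psi_{x,k}}=L_{F_x}/p_k+L_{f_x}+L_{g_1}+\rho_{f_1}+\rho_{g_1}$, $L_{\psi_{y,k}}=L_{F_y}/p_k+L_{f_y}$, and $\underline{\alpha},\underline{\beta},c_\alpha,c_\beta$ are positive constants. Let $\{(x^k,y^k)\}$ and $\{p_k\}$ be generated by AGILS, with $s_k$ satisfying in addition $$\sum_{k=1}^\infty s_k<\infty\quad\text{and}\quad\sum_{k=1}^\infty k\,s_k^{p_s}<\infty\ \text{ for some } p_s<2.$$ Suppose that the sequence $\{(x^k,y^k)\}$ is bounded, and that for all sufficiently large $k$, $p_k=\bar p$ and the feasibility correction procedure is not applied (i.e., $\tilde y^k=y^k$). If $E_{\bar p}(z,u)$ is a KL function, then the sequence $\{(x^k,y^k)\}$ converges to a KKT point of $({\rm VP})_\gamma^{\tilde\epsilon}$ for some $\tilde\epsilon\le\epsilon$.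
   Context: **Problem and standing assumptions.** $X\subset\mathbb{R}^n$, $Y\subset\mathbb{R}^m$ are closed convex sets; $F,f,g:\mathbb{R}^n\times\mathbb{R}^m\to\mathbb{R}$; $\varphi:=f+g$. A function $h$ is $(\rho_1,\rho_2)$-weakly convex on $X\times Y$ (with $\rho_1,\rho_2\ge 0$) if $h(x,y)+\frac{\rho_1}{2}\|x\|^2+\frac{\rho_2}{2}\|y\|^2$ is convex on $X\times Y$. Assume: - $\underline F:=\inf_{X\times Y}F>-\infty$; $F$ is continuously differentiable and $\nabla_xF$, $\nabla_yF$ are $L_{F_x}$-, $L_{F_y}$-Lipschitz continuous on $X\times Y$. - For every $x\in X$, $f(x,\cdot)$ and $g(x,\cdot)$ are convex on $Y$. - $f$ is continuously differentiable on $X\times Y$ and $\nabla_xf$, $\nabla_yf$ are $L_{f_x}$-, $L_{f_y}$-Lipschitz on $X\times Y$. - $g$ is continuous on $X\times Y$, $\nabla_xg(x,y)$ exists there, $\nabla_xg(\cdot,y)$ is $L_{g_1}$-Lipschitz on $X$ for every $y\in Y$, and $\nabla_xg(x,\cdot)$ is $L_{g_2}$-Lipschitz on $Y$ for every $x\in X$. - $f$ is $(\rho_{f_1},\rho_{f_2})$-weakly convex and $g$ is $(\rho_{g_1},\rho_{g_2})$-weakly convex on $X\times Y$. - For every $y\in Y$ and all $x,x'\in X$: $\partial_yg(x',y)\subseteq\partial_yg(x,y)+L_{g_y}\|x-x'\|\mathbb{B}$, where $\mathbb{B}$ is the closed unit ball. For $\gamma>0$ let $v_\gamma(x,y):=\inf_{\theta\in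 Y}\{\varphi(x,\theta)+\frac{1}{2\gamma}\|\theta-y\|^2\}$, with unique minimizer $\theta^*_\gamma(x,y)$. For $\gamma\in(0,1/(\rho_{f_2}+\rho_{g_2}))$ (with $1/0=+\infty$), $v_\gamma$ is differentiable on $X\times\mathbb{R}^m$ with $\nabla v_\gamma(x,y)=\big(\nabla_xf(x,\theta^*_\gamma(x,y))+\nabla_xg(x,\theta^*_\gamma(x,y)),\,(y-\theta^*_\gamma(x,y))/\gamma\big)$. **Problem $({\rm VP})_\gamma^{\epsilon}$:** minimize $F(x,y)$ over $x\in X$, $y\in Y$ subject to $\varphi(x,y)-v_\gamma(x,y)\le\epsilon$. **KKT point.** A point $(\bar x,\bar y)\in X\times Y$ is a KKT (stationary) point of $({\rm VP})_\gamma^{\tilde\epsilon}$ if $\varphi(\bar x,\bar y)-v_\gamma(\bar x,\bar y)\le\tilde\epsilon$ and there is $\lambda\ge0$ with $0\in\nabla F(\bar x,\bar y)+\lambda(\nabla f(\bar x,\bar y)+\partial g(\bar x,\bar y)-\nabla v_\gamma(\bar x,\bar y))+\mathcal{N}_{X\times Y}(\bar x,\bar y)$ and $\lambda(\varphi(\bar x,\bar y)-v_\gamma(\bar x,\bar y)-\tilde\epsilon)=0$. Here $\partial$ is the limiting (Mordukhovich) subdifferential and $\mathcal{N}$ the normal cone. **Merit function.** With $z=(x,y)$, $u\in\mathbb{R}^n$, $\rho_{v_1}:=\rho_{f_1}+\rho_{g_1}+c_\alpha/4$ and $\tilde v_\gamma(x,y):=v_\gamma(x,y)+\frac{\rho_{v_1}}2\|x\|^2$,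 let $$E_p(z,u):=G_p(z)-\langle u,x\rangle+H(u,y),$$ $$G_p(z):=\tfrac1p(F(z)-\underline F)+\varphi(z)+\tfrac{\rho_{v_1}}2\|x\|^2,\qquad H(u,y):=\sup_{x\in X}\{\langle u,x\rangle-\tilde v_\gamma(x,y)\},$$ for $z\in X\times Y$, and $E_p(z,u):=+\infty$ for $z\notin X\times Y$. **KL function.** For $\zeta\in(0,+\infty]$, $\Phi_\zeta$ is the set of concave continuous $\phi:[0,\zeta)\to[0,+\infty)$ with $\phi(0)=0$, $\phi$ being $C^1$ on $(0,\zeta)$ and $\phi'>0$ on $(0,\zeta)$. A proper lower semicontinuous $h:\mathbb{R}^d\to(-\infty,+\infty]$ has the KL property at $\bar x\in\operatorname{dom}\partial h:=\{x:\partial h(x)\ne\emptyset\}$ if there are $\zeta\in(0,+\infty]$, a neighborhood $\mathcal{U}$ of $\bar x$ and $\phi\in\Phi_\zeta$ such that $\phi'(h(x)-h(\bar x))\,\mathrm{dist}(0,\partial h(x))\ge1$ for all $x\in\mathcal{U}$ with $h(\bar x)<h(x)<h(\bar x)+\zeta$. $h$ is a KL function if this holds at every point of $\operatorname{dom}\partial h$. **Algorithm AGILS.** Notation: $\tilde g(x,y):=g(x,y)+\delta_Y(y)$ ($\delta_Y$ the indicator function), $\operatorname{Prox}_h(y):=\arg\min_\theta\{h(\theta)+\frac12\|\theta-y\|^2\}$, and for fixed $\eta>0$, $$\mathcal{G}(\theta,x,y):=\big\|\theta-\operatorname{Prox}_{\eta\tilde g(x,\cdot)}\big(\theta-\eta(\nabla_yf(x,\theta)+(\theta-y)/\gamma)\big)\big\|.$$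 Parameters: $\epsilon>0$, $\gamma>0$, step sizes $\alpha_k,\beta_k>0$, $p_0>0$, $\varrho_p>0$, $c_p>0$, $c_y>0$, $c_{\tilde y}>0$, $s_k\ge0$ with $\sum_k s_k^2<\infty$, $\tau_k:=\tau_0/(k+1)^{p_\tau}$ with $\tau_0>0$, $p_\tau>0$. Initial points $x^0\in X$, $y^0,\tilde y^0,\tilde\theta^0\in Y$; $\theta^0:=\tilde\theta^0$, $(x^{-1},y^{-1},\theta^{-1}):=(x^0,y^0,\tilde\theta^0)$. For $k=0,1,2,\dots$ (infinitely many iterations): 1. $d_y^k:=\frac1{p_k}\nabla_yF(x^k,\tilde y^k)+\nabla_yf(x^k,\tilde y^k)-(\tilde y^k-\tilde\theta^k)/\gamma$ and $y^{k+1}:=\operatorname{Prox}_{\beta_k\tilde g(x^k,\cdot)}(\tilde y^k-\beta_kd_y^k)$. 2. Find $\theta^{k+1/2}\in Y$ with $\mathcal{G}(\theta^{k+1/2},x^k,y^{k+1})\le\max\{s_k,\tau_k\mathcal{G}(\theta^{k-1},x^{k-1},y^{k-1})\}$. 3. $d_x^k:=\frac1{p_k}\nabla_xF(x^k,y^{k+1})+\nabla_x\varphi(x^k,y^{k+1})-\nabla_xf(x^k,\theta^{k+1/2})-\nabla_xg(x^k,\theta^{k+1/2})$ and $x^{k+1}:=\operatorname{Proj}_X(x^k-\alpha_kd_x^k)$. 4. Find $\theta^{k+1}\in Y$ with $\mathcal{G}(\theta^{k+1},x^{k+1},y^{k+1})\le\max\{s_{k+1},\tau_{k+1}\mathcal{G}(\theta^k,x^k,y^k)\}$.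 5. $\Delta_{k+1}:=\|(x^{k+1},y^{k+1})-(x^k,\tilde y^k)\|$, $t^{k+1}:=\max\{\varphi(x^{k+1},y^{k+1})-\varphi(x^{k+1},\theta^{k+1})-\frac1{2\gamma}\|\theta^{k+1}-y^{k+1}\|^2-\epsilon,\,0\}$. 6. Case 1: if $\Delta_{k+1}\ge c_p\min\{1/p_k,t^{k+1}\}$, set $p_{k+1}:=p_k$, $\tilde y^{k+1}:=y^{k+1}$, $\tilde\theta^{k+1}:=\theta^{k+1}$. Case 2: if $\Delta_{k+1}<c_p\min\{1/p_k,t^{k+1}\}$ and $\|y^{k+1}-\theta^{k+1}\|\le c_y\gamma/p_k$, set $p_{k+1}:=p_k+\varrho_p$, $\tilde y^{k+1}:=y^{k+1}$, $\tilde\theta^{k+1}:=\theta^{k+1}$. Case 3: if $\Delta_{k+1}<c_p\min\{1/p_k,t^{k+1}\}$ and $\|y^{k+1}-\theta^{k+1}\|>c_y\gamma/p_k$, apply the feasibility correction procedure. **Feasibility correction procedure** (at iteration $k$): find a candidate $\tilde y^{k+1}\in Y$ with $\|\tilde y^{k+1}-\operatorname{Prox}_{\tilde g(x^{k+1},\cdot)}(\tilde y^{k+1}-\nabla_yf(x^{k+1},\tilde y^{k+1}))\|\le\frac{c_{\tilde y}}{p_k}\Delta_{k+1}$; find $\hat\theta^{k+1}\in Y$ with $\mathcal{G}(\hat\theta^{k+1},x^{k+1},\tilde y^{k+1})\le\max\{s_{k+1},\tau_{k+1}\mathcal{G}(\theta^k,x^k,y^k)\}$; set $\tilde\theta^{k+1}:=\operatorname{Prox}_{\eta\tilde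 g(x^{k+1},\cdot)}\big(\hat\theta^{k+1}-\eta(\nabla_yf(x^{k+1},\hat\theta^{k+1})+(\hat\theta^{k+1}-\tilde y^{k+1})/\gamma)\big)$. If $$\tfrac1{p_k}F(x^{k+1},\tilde y^{k+1})+\varphi(x^{k+1},\tilde y^{k+1})-\varphi(x^{k+1},\tilde\theta^{k+1})-\tfrac1{2\gamma}\|\tilde\theta^{k+1}-\tilde y^{k+1}\|^2\le\tfrac1{p_k}F(x^{k+1},y^{k+1})+\varphi(x^{k+1},y^{k+1})-\varphi(x^{k+1},\theta^{k+1})-\tfrac1{2\gamma}\|\theta^{k+1}-y^{k+1}\|^2,$$ accept the candidate pair $(\tilde y^{k+1},\tilde\theta^{k+1})$ and set $p_{k+1}:=p_k$; otherwise reset $\tilde y^{k+1}:=y^{k+1}$, $\tilde\theta^{k+1}:=\theta^{k+1}$ and set $p_{k+1}:=p_k+\varrho_p$.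
   Formalization: As g is constrained only on X×Y, ∂g and ∂_y g are the limiting subdifferentials of g+δ_{X×Y} and g(x,·)+δ_Y (read with values of g outside X×Y the claim fails, e.g. g=-√|y|, Y={0}); ∇v_γ is taken relative to X×R^m. *)

(* Defs.v *)
From HB Require Import structures.
From mathcomp Require Import all_boot all_order all_algebra.
From mathcomp Require Import all_classical all_reals all_analysis.

Set Implicit Arguments.
Unset Strict Implicit.
Unset Printing Implicit Defensive.

Import Order.TTheory GRing.Theory Num.Theory.
Import numFieldNormedType.Exports.

Local Open Scope classical_set_scope.
Local Open Scope ring_scope.

(* R^d is 'rV[R]_d.  The library norm of 'rV[R]_d is the sup norm: it is used
   only through its topology, and every norm of the paper is [enorm].
   R^n x R^m is 'rV[R]_(n + m), with (x, y) encoded as [row_mx x y]. *)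

Section Euclidean.
Context {R : realType}.

Definition dot {d} (u v : 'rV[R]_d) : R := \sum_(i < d) u 0 i * v 0 i.

Definition enorm {d} (u : 'rV[R]_d) : R := Num.sqrt (dot u u).

Definition grad {d} (h : 'rV[R]_d -> R) (z : 'rV[R]_d) : 'rV[R]_d :=
  \row_(j < d) 'D_(delta_mx 0 j) h z.

Definition joint {n m} {T : Type} (h : 'rV[R]_n -> 'rV[R]_m -> T) :
    'rV[R]_(n + m) -> T :=
  fun z => h (lsubmx z) (rsubmx z).

Definition gradx {n m} (h : 'rV[R]_n -> 'rV[R]_m -> R) x y : 'rV[R]_n :=
  grad (h^~ y) x.

Definition grady {n m} (h : 'rV[R]_n -> 'rV[R]_m -> R) x y : 'rV[R]_m :=
  grad (h x) y.

Definition prodset {n m} (X : set 'rV[R]_n) (Y : set 'rV[R]_m) :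
    set 'rV[R]_(n + m) :=
  [set z | X (lsubmx z) /\ Y (rsubmx z)].

Definition C1_on {d} (S : set 'rV[R]_d) (h : 'rV[R]_d -> R) : Prop :=
  (forall z, S z -> differentiable h z) /\ {within S, continuous (grad h)}.

Definition lipschitz_on {d e} (L : R) (S : set 'rV[R]_d)
    (G : 'rV[R]_d -> 'rV[R]_e) : Prop :=
  0 <= L /\
  forall z z', S z -> S z' -> enorm (G z - G z') <= L * enorm (z - z').

Definition is_convex_on {d} (S : set 'rV[R]_d) (h : 'rV[R]_d -> R) : Prop :=
  @convex_function R 'rV[R]_d S h.

Definition weakly_convex_on {n m} (rho1 rho2 : R) (X : set 'rV[R]_n)
    (Y : set 'rV[R]_m) (h : 'rV[R]_n -> 'rV[R]_m -> R) : Prop :=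
  [/\ 0 <= rho1, 0 <= rho2 &
      is_convex_on (prodset X Y) (joint (fun x y =>
        h x y + rho1 / 2 * enorm x ^+ 2 + rho2 / 2 * enorm y ^+ 2))].

(* w is a gradient at z of h regarded as a function on S.  If S is convex and
   w, w' are two such gradients at z in S, then w - w' and w' - w are both
   normal to S at z; so the choice of w is immaterial in a stationarity
   condition with the normal cone at z of S or of a subset of S.  If h is
   Frechet differentiable at z in the whole space, grad h z is such a w. *)
Definition is_grad_within {d} (S : set 'rV[R]_d) (h : 'rV[R]_d -> R)
    (z w : 'rV[R]_d) : Prop :=
  forall e : R, 0 < e -> \forall z' \near z, S z' ->
    `|h z' - h z - dot w (z' - z)| <= e * enorm (z' - z).

(* h + delta_S *)
Definition restr {d} (S : set 'rV[R]_d) (h : 'rV[R]_d -> R)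
    (z : 'rV[R]_d) : \bar R :=
  if `[< S z >] then (h z)%:E else +oo%E.

(* Regular (Frechet) subdifferential:
   liminf_(z' -> z) (h z' - h z - <v, z' - z>) / |z' - z| >= 0. *)
Definition regular_subdiff {d} (h : 'rV[R]_d -> \bar R) (z : 'rV[R]_d) :
    set 'rV[R]_d :=
  [set v | h z \is a fin_num /\
    forall e : R, 0 < e -> \forall z' \near z,
      (h z + (dot v (z' - z) - e * enorm (z' - z))%:E <= h z')%E].

(* Limiting (Mordukhovich) subdifferential. *)
Definition subdiff {d} (h : 'rV[R]_d -> \bar R) (z : 'rV[R]_d) :
    set 'rV[R]_d :=
  [set v | h z \is a fin_num /\
    exists zs vs : nat -> 'rV[R]_d,
      [/\ zs @ \oo --> z, h (zs k) @[k --> \oo] --> h z,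
          forall k, regular_subdiff h (zs k) (vs k) & vs @ \oo --> v]].

(* Normal cone of a convex set. *)
Definition normal_cone {d} (S : set 'rV[R]_d) (z : 'rV[R]_d) : set 'rV[R]_d :=
  [set v | S z /\ forall z', S z' -> dot v (z' - z) <= 0].

(* dist(0, A), with dist(0, set0) = +oo. *)
Definition dist0 {d} (A : set 'rV[R]_d) : \bar R :=
  ereal_inf [set (enorm v)%:E | v in A].

Definition Phi (zeta : \bar R) : set (R -> R) :=
  [set phi : R -> R |
    let I := [set t : R | 0 <= t /\ (t%:E < zeta)%E] in
    let I0 := [set t : R | 0 < t /\ (t%:E < zeta)%E] in
    [/\ @convex_function R R^o I (fun t => - phi t),
        {within I, continuous phi},
        phi 0 = 0 /\ (forall t, I t -> 0 <= phi t),
        (forall t, I0 t -> derivable phi t 1) /\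
          {within I0, continuous (derive1 phi)} &
        forall t, I0 t -> 0 < derive1 phi t]].

Definition KL_property {d} (h : 'rV[R]_d -> \bar R) (z : 'rV[R]_d) : Prop :=
  exists zeta : \bar R, (0 < zeta)%E /\
  exists phi : R -> R, Phi zeta phi /\
  exists U, nbhs z U /\
    forall z', U z' -> (h z < h z')%E -> (h z' < h z + zeta)%E ->
      (1 <= (derive1 phi (fine (h z' - h z)%E))%:E * dist0 (subdiff h z'))%E.

Definition KL_function {d} (h : 'rV[R]_d -> \bar R) : Prop :=
  [/\ forall z, (-oo < h z)%E, exists z, (h z < +oo)%E,
      lower_semicontinuous h &
      forall z, subdiff h z !=set0 -> KL_property h z].

Definition prox {d} (h : 'rV[R]_d -> \bar R) (y : 'rV[R]_d) : 'rV[R]_d :=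
  xget 0 [set th | forall th',
    (h th + (2^-1 * enorm (th - y) ^+ 2)%:E <=
     h th' + (2^-1 * enorm (th' - y) ^+ 2)%:E)%E].

Definition proj {d} (S : set 'rV[R]_d) (y : 'rV[R]_d) : 'rV[R]_d :=
  xget 0 [set p | S p /\ forall q, S q -> enorm (p - y) <= enorm (q - y)].

End Euclidean.

Record problem (R : realType) (n m : nat) := Problem {
  dX : set 'rV[R]_n;
  dY : set 'rV[R]_m;
  dF : 'rV[R]_n -> 'rV[R]_m -> R;
  df : 'rV[R]_n -> 'rV[R]_m -> R;
  dg : 'rV[R]_n -> 'rV[R]_m -> R }.

Record moduli (R : realType) := Moduli {
  LFx : R; LFy : R; Lfx : R; Lfy : R; Lg1 : R; Lg2 : R; Lgy : R;
  rhof1 : R; rhof2 : R; rhog1 : R; rhog2 : R }.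

Section Problem.
Context {R : realType} {n m : nat}.
Variable D : problem R n m.

Let X := dX D.
Let Y := dY D.
Let F := dF D.
Let f := df D.
Let g := dg D.

Definition dXY : set 'rV[R]_(n + m) := prodset X Y.

Definition vphi (x : 'rV[R]_n) (y : 'rV[R]_m) : R := f x y + g x y.

(* g~(x, .) = g(x, .) + delta_Y *)
Definition gt (x : 'rV[R]_n) : 'rV[R]_m -> \bar R := restr Y (g x).

(* All assumptions on g, apart from the existence of grad_x g, concern its
   values on X x Y only, and say nothing about g outside X x Y.  Accordingly
   g has the effective domain X x Y when its (limiting) subdifferentials are
   taken: partial_y g(x, .) is that of g(x, .) + delta_Y, and partial g is that
   of g + delta_(X x Y). *)
Definition subdiff_y_g (x : 'rV[R]_n) (y : 'rV[R]_m) : set 'rV[R]_m :=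
  subdiff (gt x) y.

Definition subdiff_g (x : 'rV[R]_n) (y : 'rV[R]_m) : set 'rV[R]_(n + m) :=
  subdiff (restr dXY (joint g)) (row_mx x y).

Record standing (c : moduli R) : Prop := Standing {
  closed_X : closed X;
  closed_Y : closed Y;
  convex_X : @convex_set R 'rV[R]_n X;
  convex_Y : @convex_set R 'rV[R]_m Y;
  F_lbound : has_lbound (joint F @` dXY);
  F_C1 : C1_on dXY (joint F);
  gradx_F_lip : lipschitz_on (LFx c) dXY (joint (gradx F));
  grady_F_lip : lipschitz_on (LFy c) dXY (joint (grady F));
  f_convex : forall x, X x -> is_convex_on Y (f x);
  g_convex : forall x, X x -> is_convex_on Y (g x);
  f_C1 : C1_on dXY (joint f);
  gradx_f_lip : lipschitz_on (Lfx c) dXY (joint (gradx f));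
  grady_f_lip : lipschitz_on (Lfy c) dXY (joint (grady f));
  g_cont : {within dXY, continuous (joint g)};
  g_diffx : forall x y, X x -> Y y -> differentiable (g^~ y) x;
  gradx_g_lipx : forall y, Y y -> lipschitz_on (Lg1 c) X ((gradx g)^~ y);
  gradx_g_lipy : forall x, X x -> lipschitz_on (Lg2 c) Y (gradx g x);
  f_wconvex : weakly_convex_on (rhof1 c) (rhof2 c) X Y f;
  g_wconvex : weakly_convex_on (rhog1 c) (rhog2 c) X Y g;
  Lgy_ge0 : 0 <= Lgy c;
  subdiff_y_g_lip : forall y, Y y -> forall x x', X x -> X x' ->
    subdiff_y_g x' y `<=`
      [set xi + (Lgy c * enorm (x - x')) *: b |
         xi in subdiff_y_g x y & b in [set b | enorm b <= 1]] }.

Definition Finf : R := inf (joint F @` dXY).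

(* For x in X the infimum is attained, since phi(x, .) is convex and
   continuous on the closed set Y. *)
Definition envelope (gamma : R) (x : 'rV[R]_n) (y : 'rV[R]_m) : R :=
  inf [set vphi x th + (2 * gamma)^-1 * enorm (th - y) ^+ 2 | th in Y].

(* (x, y) is a KKT point of (VP)_gamma^eps.  The gradient w of v_gamma is
   taken relative to X x R^m because the assumptions do not control v_gamma
   for x outside X. *)
Definition KKT_point (gamma eps : R) (x : 'rV[R]_n) (y : 'rV[R]_m) : Prop :=
  let z := row_mx x y in
  [/\ X x, Y y, vphi x y - envelope gamma x y <= eps &
    exists2 lambda : R, 0 <= lambda &
      (exists xi w nu,
        [/\ subdiff_g x y xi,
            is_grad_within (prodset X [set: 'rV[R]_m])
              (joint (envelope gamma)) z w,
            normal_cone dXY z nu &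
            0 = grad (joint F) z
                + lambda *: (grad (joint f) z + xi - w) + nu]) /\
      lambda * (vphi x y - envelope gamma x y - eps) = 0].

Section Merit.
Variables (c : moduli R) (gamma c_alpha p : R).

Definition rhov1 : R := rhof1 c + rhog1 c + c_alpha / 4.

Definition vt (x : 'rV[R]_n) (y : 'rV[R]_m) : R :=
  envelope gamma x y + rhov1 / 2 * enorm x ^+ 2.

Definition Gp (x : 'rV[R]_n) (y : 'rV[R]_m) : R :=
  p^-1 * (F x y - Finf) + vphi x y + rhov1 / 2 * enorm x ^+ 2.

Definition Huy (u : 'rV[R]_n) (y : 'rV[R]_m) : \bar R :=
  ereal_sup [set (dot u x - vt x y)%:E | x in X].

(* E_p(z, u), at the vector row_mx z u *)
Definition merit (zu : 'rV[R]_(n + m + n)) : \bar R :=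
  let z := lsubmx zu in let u := rsubmx zu in
  let x := lsubmx z in let y := rsubmx z in
  if `[< dXY z >] then ((Gp x y - dot u x)%:E + Huy u y)%E else +oo%E.

End Merit.
End Problem.

Record params (R : realType) := Params {
  eps : R; gamma : R; eta : R;
  p0 : R; varrho_p : R; c_p : R; c_y : R; c_yt : R;
  tau0 : R; p_tau : R;
  sk : nat -> R; alphak : nat -> R; betak : nat -> R }.

Record params_ok (R : realType) (P : params R) : Prop := ParamsOk {
  eps_gt0 : 0 < eps P;
  gamma_gt0 : 0 < gamma P;
  eta_gt0 : 0 < eta P;
  p0_gt0 : 0 < p0 P;
  varrho_p_gt0 : 0 < varrho_p P;
  c_p_gt0 : 0 < c_p P;
  c_y_gt0 : 0 < c_y P;
  c_yt_gt0 : 0 < c_yt P;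
  tau0_gt0 : 0 < tau0 P;
  p_tau_gt0 : 0 < p_tau P;
  alphak_gt0 : forall k, 0 < alphak P k;
  betak_gt0 : forall k, 0 < betak P k;
  sk_ge0 : forall k, 0 <= sk P k;
  sk_sqr_summable : (\sum_(0 <= k <oo) (sk P k ^+ 2)%:E < +oo)%E }.

(* The sequences produced by AGILS: x^k, y^k, y~^k, theta~^k, theta^k,
   theta^(k+1/2) and p_k. *)
Record trace (R : realType) (n m : nat) := Trace {
  xk : nat -> 'rV[R]_n;
  yk : nat -> 'rV[R]_m;
  ytk : nat -> 'rV[R]_m;
  thtk : nat -> 'rV[R]_m;
  thk : nat -> 'rV[R]_m;
  thhk : nat -> 'rV[R]_m;
  pk : nat -> R }.

Section Algorithm.
Context {R : realType} {n m : nat}.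
Variables (D : problem R n m) (P : params R) (T : trace R n m).

Let X := dX D.
Let Y := dY D.
Let F := dF D.
Let f := df D.
Let g := dg D.
Let x := xk T.
Let y := yk T.
Let yt := ytk T.
Let tht := thtk T.
Let th := thk T.
Let thh := thhk T.
Let p := pk T.

Definition tauk (k : nat) : R := tau0 P / (k.+1%:R `^ p_tau P).

Definition prox_g (t : R) (a : 'rV[R]_n) : 'rV[R]_m -> 'rV[R]_m :=
  prox (fun b => (t%:E * gt D a b)%E).

Definition prox_step (t : 'rV[R]_m) (a : 'rV[R]_n) (b : 'rV[R]_m) : 'rV[R]_m :=
  prox_g (eta P) a
    (t - eta P *: (grady f a t + (gamma P)^-1 *: (t - b))).

Definition resid (t : 'rV[R]_m) (a : 'rV[R]_n) (b : 'rV[R]_m) : R :=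
  enorm (t - prox_step t a b).

Definition dyk (k : nat) : 'rV[R]_m :=
  (p k)^-1 *: grady F (x k) (yt k) + grady f (x k) (yt k)
  - (gamma P)^-1 *: (yt k - tht k).

Definition dxk (k : nat) : 'rV[R]_n :=
  (p k)^-1 *: gradx F (x k) (y k.+1) + gradx (vphi D) (x k) (y k.+1)
  - gradx f (x k) (thh k) - gradx g (x k) (thh k).

Definition Deltak (k : nat) : R :=
  enorm (row_mx (x k.+1) (y k.+1) - row_mx (x k) (yt k)).

Definition gap (a : 'rV[R]_n) (b t : 'rV[R]_m) : R :=
  vphi D a b - vphi D a t - (2 * gamma P)^-1 * enorm (t - b) ^+ 2.

Definition tk (k : nat) : R :=
  Num.max (gap (x k.+1) (y k.+1) (th k.+1) - eps P) 0.

(* Tolerance for the computation of theta^(k+1) and of theta^^(k+1). *)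
Definition tolk (k : nat) : R :=
  Num.max (sk P k.+1) (tauk k.+1 * resid (th k) (x k) (y k)).

Definition correction (k : nat) : Prop :=
  exists yc thc : 'rV[R]_m,
    [/\ Y yc,
        enorm (yc - prox_g 1 (x k.+1) (yc - grady f (x k.+1) yc))
          <= c_yt P / p k * Deltak k,
        Y thc,
        resid thc (x k.+1) yc <= tolk k &
        let thc' := prox_step thc (x k.+1) yc in
        if (p k)^-1 * F (x k.+1) yc + gap (x k.+1) yc thc'
           <= (p k)^-1 * F (x k.+1) (y k.+1)
              + gap (x k.+1) (y k.+1) (th k.+1)
        then [/\ yt k.+1 = yc, tht k.+1 = thc' & p k.+1 = p k]
        else [/\ yt k.+1 = y k.+1, tht k.+1 = th k.+1 &
                 p k.+1 = p k + varrho_p P]].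

Definition update (k : nat) : Prop :=
  if c_p P * Num.min (p k)^-1 (tk k) <= Deltak k then
    [/\ p k.+1 = p k, yt k.+1 = y k.+1 & tht k.+1 = th k.+1]
  else if enorm (y k.+1 - th k.+1) <= c_y P * gamma P / p k then
    [/\ p k.+1 = p k + varrho_p P, yt k.+1 = y k.+1 & tht k.+1 = th k.+1]
  else correction k.

(* The index k.-1 is 0 at k = 0, in agreement with
   (x^-1, y^-1, theta^-1) := (x^0, y^0, theta~^0) and theta^0 := theta~^0. *)
Record AGILS : Prop := Agils {
  x_init : X (x 0%N);
  y_init : Y (y 0%N);
  yt_init : Y (yt 0%N);
  tht_init : Y (tht 0%N);
  th_init : th 0%N = tht 0%N;
  p_init : p 0%N = p0 P;
  y_step : forall k,
    y k.+1 = prox_g (betak P k) (x k) (yt k - betak P k *: dyk k);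
  thh_step : forall k, Y (thh k) /\
    resid (thh k) (x k) (y k.+1)
      <= Num.max (sk P k) (tauk k * resid (th k.-1) (x k.-1) (y k.-1));
  x_step : forall k, x k.+1 = proj X (x k - alphak P k *: dxk k);
  th_step : forall k, Y (th k.+1) /\
    resid (th k.+1) (x k.+1) (y k.+1) <= tolk k;
  update_step : forall k, update k }.

End Algorithm.

Section StepSizes.
Context {R : realType} {n m : nat}.
Variables (c : moduli R) (T : trace R n m).

Definition Lpsix (k : nat) : R :=
  LFx c / pk T k + Lfx c + Lg1 c + rhof1 c + rhog1 c.

Definition Lpsiy (k : nat) : R := LFy c / pk T k + Lfy c.

End StepSizes.

(* Main.v *)
(* For k large, V := F / p + phi - v_gamma decreases along the iterates by a
   multiple of |z_(k+1) - z_k|^2, up to e_k^2, where e_k bounds the errors of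
   the inexact lower-level solutions.  Taking u_k as the x-gradient of the
   convexified envelope at z_k makes E_p(z_k, u_k) equal to V(z_k) - inf F / p,
   and E_p then has a subgradient at (z_(k+1), u_(k+1)) of norm at most a
   multiple of |z_(k+1) - z_k| + e_k, because the lower-level solution is
   Lipschitz continuous in (x, y).

   V is not monotone, so the KL inequality is only used at the indices where
   V(z_k) - V* > 2 t_k, with t_k := (k+1)^-(1+eta), and the desingularizing
   function psi is applied to max(V(z_k) - V*, t_k).  The summability of
   k s_k^(p_s) with p_s < 2 gives an eta > 0 such that the sum of e_k^2 / t_k is
   finite, so the increments of psi due to the errors are summable.  At the
   other indices the tail sums of |z_(j+1) - z_j|^2 are O(t_k), and
   Cauchy-Schwarz on dyadic blocks bounds the sum of the corresponding steps.
   Hence the iterates have finite length. *)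

Require Import Defs.
From mathcomp Require Import all_boot all_order all_algebra.
From mathcomp Require Import all_classical all_reals all_analysis.
From mathcomp Require Import ring lra.

Set Implicit Arguments.
Unset Strict Implicit.
Unset Printing Implicit Defensive.

Import Order.TTheory GRing.Theory Num.Theory.
Import numFieldNormedType.Exports.

Local Open Scope classical_set_scope.
Local Open Scope ring_scope.

(** * Euclidean geometry *)

(** The threshold t_k cures both: concavity gives psi'(s) s <= psi(s), hence psi'(b) <= 1/t_k for b
    >= t_k once psi(b) <= 1. The factor 2 in V(z_k) - V* > 2 t_k makes the maximum drop by a
    multiple of |z_(k+1) - z_k|^2, up to e_k^2, even when the next value falls below the threshold.

    The gradient of v_gamma relative to X x R^m is derived from a quadratic upper bound (test the
    infimum with the old minimizer) and a quadratic lower bound (joint weak convexity of phi, where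
    gamma rho < 1 absorbs the curvature in theta). The lower bound also shows that the supremum H(u,
    y) is attained at x for the chosen u.

    The limit is a KKT point with multiplier lambda = p and with its own gap as tolerance, so
    complementarity is trivial; that this gap is at most epsilon is read off from the update
    rule. *)

Section Euclid.
Context {R : realType}.
Implicit Types d : nat.

Lemma dotC d (u v : 'rV[R]_d) : dot u v = dot v u.
Proof. by apply: eq_bigr => i _; rewrite mulrC. Qed.

Lemma dotDl d (u v w : 'rV[R]_d) : dot (u + v) w = dot u w + dot v w.
Proof. by rewrite -big_split; apply: eq_bigr => i _; rewrite mxE mulrDl. Qed.

Lemma dotZl d a (u v : 'rV[R]_d) : dot (a *: u) v = a * dot u v.
Proof. by rewrite /dot mulr_sumr; apply: eq_bigr => i _; rewrite mxE mulrA. Qed.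

Lemma dotNl d (u v : 'rV[R]_d) : dot (- u) v = - dot u v.
Proof. by rewrite -scaleN1r dotZl mulN1r. Qed.

Lemma dotBl d (u v w : 'rV[R]_d) : dot (u - v) w = dot u w - dot v w.
Proof. by rewrite dotDl dotNl. Qed.

Lemma dotDr d (u v w : 'rV[R]_d) : dot w (u + v) = dot w u + dot w v.
Proof. by rewrite dotC dotDl !(dotC w). Qed.

Lemma dotZr d a (u v : 'rV[R]_d) : dot u (a *: v) = a * dot u v.
Proof. by rewrite dotC dotZl dotC. Qed.

Lemma dotNr d (u v : 'rV[R]_d) : dot u (- v) = - dot u v.
Proof. by rewrite dotC dotNl dotC. Qed.

Lemma dotBr d (u v w : 'rV[R]_d) : dot w (u - v) = dot w u - dot w v.
Proof. by rewrite dotDr dotNr. Qed.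

Lemma dot0l d (u : 'rV[R]_d) : dot 0 u = 0.
Proof. by rewrite -(scale0r 0) dotZl mul0r. Qed.

Lemma dot0r d (u : 'rV[R]_d) : dot u 0 = 0.
Proof. by rewrite dotC dot0l. Qed.

Definition dotE := (dotDl, dotDr, dotBl, dotBr, dotNl, dotNr, dotZl, dotZr).

Lemma dot_ge0 d (u : 'rV[R]_d) : 0 <= dot u u.
Proof. by apply: sumr_ge0 => i _; rewrite -expr2 sqr_ge0. Qed.

Lemma enorm_ge0 d (u : 'rV[R]_d) : 0 <= enorm u.
Proof. exact: sqrtr_ge0. Qed.

Lemma enorm_sqr d (u : 'rV[R]_d) : enorm u ^+ 2 = dot u u.
Proof. by rewrite sqr_sqrtr// dot_ge0. Qed.

Lemma enorm_sqrD d (u v : 'rV[R]_d) :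
  enorm (u + v) ^+ 2 = enorm u ^+ 2 + 2 * dot u v + enorm v ^+ 2.
Proof. rewrite !enorm_sqr !dotE (dotC v u); ring. Qed.

Lemma enorm_sqrB d (u v : 'rV[R]_d) :
  enorm (u - v) ^+ 2 = enorm u ^+ 2 - 2 * dot u v + enorm v ^+ 2.
Proof. rewrite !enorm_sqr !dotE (dotC v u); ring. Qed.

Lemma enorm0 d : enorm (0 : 'rV[R]_d) = 0.
Proof. by rewrite /enorm dot0l sqrtr0. Qed.

Lemma enormZ d a (u : 'rV[R]_d) : enorm (a *: u) = `|a| * enorm u.
Proof.
by rewrite /enorm dotZl dotZr mulrA -expr2 sqrtrM ?sqr_ge0// sqrtr_sqr.
Qed.

Lemma enormN d (u : 'rV[R]_d) : enorm (- u) = enorm u.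
Proof. by rewrite -scaleN1r enormZ normrN1 mul1r. Qed.

Lemma enorm_distC d (u v : 'rV[R]_d) : enorm (u - v) = enorm (v - u).
Proof. by rewrite -enormN opprB. Qed.

Lemma norm_le_enorm d (u : 'rV[R]_d) : `|u| <= enorm u.
Proof.
rewrite {1}/Num.norm/= mx_normrE; apply/bigmax_leP; split; first exact: enorm_ge0.
move=> [i j] _ /=; rewrite ord1 -sqrtr_sqr ler_sqrt ?dot_ge0//.
rewrite /dot (bigD1 j)//= expr2 lerDl sumr_ge0// => k _.
by rewrite -expr2 sqr_ge0.
Qed.

Lemma enorm_eq0 d (u : 'rV[R]_d) : enorm u = 0 -> u = 0.
Proof.
by move=> u0; apply/eqP; rewrite -normr_le0 -u0 norm_le_enorm.
Qed.

(** Cauchy-Schwarz: the squared norm of |v| u - |u| v is nonnegative and equals 2 |u| |v| (|u| |v| -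
    <u, v>). *)
Lemma dot_le d (u v : 'rV[R]_d) : dot u v <= enorm u * enorm v.
Proof.
have [v0|v0] := eqVneq (enorm v) 0; first by rewrite (enorm_eq0 v0) dot0r enorm0 mulr0.
have [u0|u0] := eqVneq (enorm u) 0; first by rewrite (enorm_eq0 u0) dot0l enorm0 mul0r.
have vp : 0 < enorm v by rewrite lt_neqAle eq_sym v0 enorm_ge0.
have up : 0 < enorm u by rewrite lt_neqAle eq_sym u0 enorm_ge0.
have := dot_ge0 (enorm v *: u - enorm u *: v).
rewrite !dotE -!enorm_sqr (dotC v u) => h.
have : 0 <= 2 * (enorm u * enorm v) * (enorm u * enorm v - dot u v).
  by apply: le_trans h _; rewrite le_eqVlt; apply/orP; left; apply/eqP; ring.
by rewrite pmulr_rge0 ?subr_ge0// !mulr_gt0.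
Qed.

Lemma normr_dot_le d (u v : 'rV[R]_d) : `|dot u v| <= enorm u * enorm v.
Proof. by rewrite ler_norml dot_le andbT lerNl -dotNl -[enorm u]enormN dot_le. Qed.

Lemma dot_geN d (u v : 'rV[R]_d) : - (enorm u * enorm v) <= dot u v.
Proof. by have := normr_dot_le u v; rewrite ler_norml => /andP[]. Qed.

Lemma enormD d (u v : 'rV[R]_d) : enorm (u + v) <= enorm u + enorm v.
Proof.
rewrite -(ler_pXn2r (n := 2)) ?nnegrE ?addr_ge0 ?enorm_ge0//.
rewrite enorm_sqrD sqrrD lerD2r lerD2l -mulr_natl; have := dot_le u v; nra.
Qed.

Lemma enormB d (u v : 'rV[R]_d) : enorm (u - v) <= enorm u + enorm v.
Proof. by rewrite -[enorm v]enormN enormD. Qed.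

Lemma enorm_triangle d (w u v : 'rV[R]_d) :
  enorm (u - v) <= enorm (u - w) + enorm (w - v).
Proof. by rewrite -[u - v](subrKA w) enormD. Qed.

Lemma coord_le_norm d (u : 'rV[R]_d) i : `|u 0 i| <= `|u|.
Proof.
rewrite [leRHS]/Num.norm/= mx_normrE.
by apply/bigmax_geP; right; exists (0, i).
Qed.

Lemma enorm_le_norm d (u : 'rV[R]_d) : enorm u <= d%:R * `|u|.
Proof.
rewrite -(ler_pXn2r (n := 2)) ?nnegrE ?mulr_ge0 ?enorm_ge0//.
rewrite enorm_sqr.
apply: (@le_trans _ _ (\sum_(i < d) `|u| ^+ 2)).
  apply: ler_sum => i _; rewrite -expr2 -real_normK ?num_real//.
  by rewrite ler_pXn2r ?nnegrE// coord_le_norm.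
rewrite sumr_const card_ord -[leLHS]mulr_natl exprMn ler_wpM2r ?sqr_ge0//.
by rewrite -natrX ler_nat; case: (d) => // k; rewrite expnS expn1 leq_pmulr.
Qed.

Lemma near_enorm d (z : 'rV[R]_d) (e : R) :
  0 < e -> \forall z' \near z, enorm (z' - z) < e.
Proof.
(* The factor is [d.+1] rather than [d], so that the quotient also makes sense for [d = 0]. *)
move=> e0; have d0 : 0 < (d.+1)%:R :> R by rewrite ltr0n.
have : 0 < e / d.+1%:R by rewrite divr_gt0.
move=> /(nbhsx_ballx z); apply: filterS => z'.
rewrite -ball_normE/= distrC ltr_pdivlMr// => h.
apply: le_lt_trans (enorm_le_norm _) _; apply: le_lt_trans h.
by rewrite mulrC ler_wpM2l// ler_nat.
Qed.

Lemma near_enormP d (z : 'rV[R]_d) (U : set 'rV[R]_d) :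
  nbhs z U -> exists2 r : R, 0 < r & forall z', enorm (z' - z) < r -> U z'.
Proof.
move=> /nbhs_ballP[r /= r0 rU]; exists r => // z' zz'; apply: rU.
rewrite -ball_normE/= distrC; exact: le_lt_trans (norm_le_enorm _) zz'.
Qed.

(** The bridge between the sup-norm topology of the library and the Euclidean norm in which all
    later estimates are made. *)
Lemma cvg_enormP d (u : nat -> 'rV[R]_d) (z : 'rV[R]_d) :
  u @ \oo --> z <-> (fun k => enorm (u k - z)) @ \oo --> (0 : R).
Proof.
split=> h.
  apply/cvgrPdist_lt => e e0; near=> k; rewrite sub0r normrN ger0_norm ?enorm_ge0//.
  near: k; exact: (h _ (near_enorm z e0)).
apply/cvgrPdist_lt => e e0; near=> k; rewrite distrC.
apply: le_lt_trans (norm_le_enorm _) _.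
have := enorm_ge0 (u k - z) => hk; rewrite -(ger0_norm hk) -normrN -sub0r.
by near: k; move/cvgrPdist_lt : h; exact.
Unshelve. all: by end_near. Qed.

Lemma cvg_dot d (u v : nat -> 'rV[R]_d) (a b : 'rV[R]_d) :
  u @ \oo --> a -> v @ \oo --> b ->
  (fun k => dot (u k) (v k)) @ \oo --> dot a b.
Proof.
move=> ua vb; rewrite /dot.
apply: (@cvg_big _ _ +%R 0 xpredT) => [|i _]; first exact: add_continuous.
apply: cvgM.
  exact: (cvg_comp _ _ ua (@coord_continuous _ _ _ _ _ a)).
exact: (cvg_comp _ _ vb (@coord_continuous _ _ _ _ _ b)).
Qed.

Lemma cvg_sqr_enorm d (u : nat -> 'rV[R]_d) (a : 'rV[R]_d) :
  u @ \oo --> a -> (fun k => enorm (u k) ^+ 2) @ \oo --> enorm a ^+ 2.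
Proof.
move=> ua; rewrite enorm_sqr; under eq_fun do rewrite enorm_sqr.
exact: cvg_dot.
Qed.

Lemma dot_row_mx n m (x x' : 'rV[R]_n) (y y' : 'rV[R]_m) :
  dot (row_mx x y) (row_mx x' y') = dot x x' + dot y y'.
Proof.
rewrite /dot big_split_ord/=; congr (_ + _); apply: eq_bigr => i _.
  by rewrite !row_mxEl.
by rewrite !row_mxEr.
Qed.

Lemma enorm_row_mx n m (x : 'rV[R]_n) (y : 'rV[R]_m) :
  enorm (row_mx x y) ^+ 2 = enorm x ^+ 2 + enorm y ^+ 2.
Proof. by rewrite !enorm_sqr dot_row_mx. Qed.

Lemma row_mxB n m (x x' : 'rV[R]_n) (y y' : 'rV[R]_m) :
  row_mx x y - row_mx x' y' = row_mx (x - x') (y - y').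
Proof. by rewrite opp_row_mx add_row_mx. Qed.

Lemma ler_enorm d e (u : 'rV[R]_d) (v : 'rV[R]_e) :
  enorm u ^+ 2 <= enorm v ^+ 2 -> enorm u <= enorm v.
Proof. by rewrite ler_pXn2r ?nnegrE ?enorm_ge0. Qed.

Lemma enorm_row_mxl n m (x : 'rV[R]_n) (y : 'rV[R]_m) :
  enorm x <= enorm (row_mx x y).
Proof. by apply: ler_enorm; rewrite enorm_row_mx lerDl sqr_ge0. Qed.

Lemma enorm_row_mxr n m (x : 'rV[R]_n) (y : 'rV[R]_m) :
  enorm y <= enorm (row_mx x y).
Proof. by apply: ler_enorm; rewrite enorm_row_mx lerDr sqr_ge0. Qed.

Lemma enorm_row_mx_le n m (x : 'rV[R]_n) (y : 'rV[R]_m) :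
  enorm (row_mx x y) <= enorm x + enorm y.
Proof.
rewrite -(ler_pXn2r (n := 2)) ?nnegrE ?addr_ge0 ?enorm_ge0//.
rewrite enorm_row_mx sqrrD; have := enorm_ge0 x; have := enorm_ge0 y; nra.
Qed.

Lemma enorm_row_mx0 n m (x : 'rV[R]_n) :
  enorm (row_mx x (0 : 'rV[R]_m)) = enorm x.
Proof.
by rewrite /enorm dot_row_mx dot0l addr0.
Qed.

Lemma enorm_row_0mx n m (y : 'rV[R]_m) :
  enorm (row_mx (0 : 'rV[R]_n) y) = enorm y.
Proof. by rewrite /enorm dot_row_mx dot0l add0r. Qed.

Lemma cvg_row_mx n m (x : nat -> 'rV[R]_n) (y : nat -> 'rV[R]_m)
    (a : 'rV[R]_n) (b : 'rV[R]_m) :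
  x @ \oo --> a -> y @ \oo --> b ->
  (fun k => row_mx (x k) (y k)) @ \oo --> row_mx a b.
Proof.
move=> /cvg_enormP xa /cvg_enormP yb; apply/cvg_enormP.
have h : (fun k => enorm (x k - a) + enorm (y k - b)) @ \oo --> (0 : R).
  by rewrite -(addr0 0); apply: cvgD.
apply: (squeeze_cvgr _ (cvg_cst 0) h); near=> k.
by rewrite enorm_ge0 row_mxB enorm_row_mx_le.
Unshelve. all: by end_near. Qed.

Lemma cvg_lsubmx n m (z : nat -> 'rV[R]_(n + m)) (a : 'rV[R]_(n + m)) :
  z @ \oo --> a -> (fun k => lsubmx (z k)) @ \oo --> lsubmx a.
Proof.
move=> /cvg_enormP za; apply/cvg_enormP.
apply: (squeeze_cvgr _ (cvg_cst 0) za); near=> k.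
rewrite enorm_ge0/= -linearB/= -{2}[z k - a]hsubmxK; exact: enorm_row_mxl.
Unshelve. all: by end_near. Qed.

Lemma cvg_rsubmx n m (z : nat -> 'rV[R]_(n + m)) (a : 'rV[R]_(n + m)) :
  z @ \oo --> a -> (fun k => rsubmx (z k)) @ \oo --> rsubmx a.
Proof.
move=> /cvg_enormP za; apply/cvg_enormP.
apply: (squeeze_cvgr _ (cvg_cst 0) za); near=> k.
rewrite enorm_ge0/= -linearB/= -{2}[z k - a]hsubmxK; exact: enorm_row_mxr.
Unshelve. all: by end_near. Qed.

End Euclid.

(** Used to let a segment shrink: once a first-order inequality is divided by the step length [t],
    its remainder has the form [t * c]. *)
Lemma ler_vanishing (R : realFieldType) (a b c : R) :
  (forall t : R, 0 < t -> t <= 1 -> a <= b + t * c) -> a <= b.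
Proof.
move=> h; have [c0|c0] := leP c 0.
  by have := h 1 ltr01 (lexx _); rewrite mul1r; lra.
apply/ler_addgt0Pr => e e0.
have m0 : 0 < Num.min 1 (e / c) by rewrite lt_min ltr01 divr_gt0.
apply: le_trans (h _ m0 _) _; first by rewrite ge_min lexx.
by rewrite lerD2l -ler_pdivlMr// ge_min lexx orbT.
Qed.

(** * Convexity and first-order expansions along segments *)

Section Convexity.
Context {R : realType} {d : nat}.
Implicit Types (S : set 'rV[R]_d) (h : 'rV[R]_d -> R).

Lemma convex_set_seg S (x y : 'rV[R]_d) (t : R) :
  @convex_set R 'rV[R]_d S -> S x -> S y -> 0 <= t -> t <= 1 ->
  S (x + t *: (y - x)).
Proof.
move=> cS Sx Sy t0 t1.
have := cS y x (Itv01 t0 t1); rewrite !inE => /(_ Sy Sx).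
rewrite /conv/=; congr S; rewrite /= /unstable.onem scalerBl scale1r scalerBr.
by rewrite addrCA.
Qed.

Lemma convex_on_seg S h (x y : 'rV[R]_d) (t : R) :
  is_convex_on S h -> S x -> S y -> 0 <= t -> t <= 1 ->
  h (x + t *: (y - x)) <= h x + t * (h y - h x).
Proof.
move=> ch Sx Sy t0 t1.
have := ch (Itv01 t0 t1) y x; rewrite !inE => /(_ Sy Sx).
rewrite convRE/= /unstable.onem => H; apply: le_trans (_ : _ <= t * h y + (1 - t)
  * h x) _.
  move: H; rewrite /conv/= /unstable.onem; congr (h _ <= _).
  by rewrite scalerBl scale1r scalerBr addrCA.
by rewrite le_eqVlt; apply/orP; left; apply/eqP; ring.
Qed.

End Convexity.

Section Gradient.
Context {R : realType} {d : nat}.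
Implicit Types (h : 'rV[R]_d -> R) (z v : 'rV[R]_d).

Lemma derive_dot_grad h z v :
  differentiable h z -> 'D_v h z = dot (grad h z) v.
Proof.
move=> dh; rewrite deriveE// {1}[v]row_sum_delta linear_sum /dot.
apply: eq_bigr => j _; rewrite linearZ/= /grad mxE deriveE// mulrC.
by [].
Qed.

Lemma is_derive_line h z v (t : R) : differentiable h (z + t *: v) ->
  is_derive t 1 (fun s => h (z + s *: v)) (dot (grad h (z + t *: v)) v).
Proof.
move=> dh; rewrite -derive_dot_grad//.
have E : (fun s : R => s^-1 *: ((fun s => h (z + s *: v)) (s *: 1 + t) - h (z + t
  *: v))) =
         (fun s : R => s^-1 *: ((h \o shift (z + t *: v)) (s *: v) - h (z + t *: v))).
  apply/funext => s /=; congr (_ *: (h _ - _)).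
  by rewrite [_ *: 1]mulr1 scalerDl addrCA.
split.
- by rewrite /derivable /= E; exact: diff_derivable.
- by rewrite /derive /= E.
Qed.

(** The mean value theorem on [0, 1] for h(z + t v) - (<grad h z, v> t + L t^2 / 2), whose
    derivative is nonpositive. Here [L] already contains the factor |v|^2, so that directional
    bounds other than Lipschitz ones fit as well. *)
Lemma ub_quad (h : 'rV[R]_d -> R) z z' (L : R) :
  (forall t : R, 0 <= t -> t <= 1 -> differentiable h (z + t *: (z' - z))) ->
  (forall t : R, 0 <= t -> t <= 1 ->
    dot (grad h (z + t *: (z' - z)) - grad h z) (z' - z) <= L * t) ->
  h z' <= h z + dot (grad h z) (z' - z) + L / 2.
Proof.
move=> dh lh; set v := z' - z in dh lh *.
pose c := dot (grad h z) v.
pose psi := fun t : R => h (z + t *: v) - (c * t + L / 2 * t ^+ 2).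
pose dpsi := fun t : R => dot (grad h (z + t *: v)) v - (c + L * t).
have der (t : R) : 0 <= t -> t <= 1 -> is_derive t 1 psi (dpsi t).
  move=> t0 t1; have := is_derive_line (dh t t0 t1) => H.
  rewrite /psi /dpsi; apply: is_deriveB.
  apply: is_derive_eq.
  by rewrite /GRing.scale/=; field.
have cpsi : {within `[0, 1], continuous psi}.
  apply: derivable_within_continuous; move=> u; rewrite in_itv/= => /andP[u0 u1].
  by case: (der u u0 u1).
have [t|t] := @MVT R psi dpsi 0 1 ltr01 _ cpsi.
  by rewrite in_itv/= => /andP[t0 t1]; apply: der; apply: ltW.
rewrite in_itv/= => /andP[t0 t1]; rewrite /psi /dpsi scale1r scale0r addr0.
have := lh _ (ltW t0) (ltW t1); rewrite dotBl -/c (_ : z + v = z'); last first.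
  by rewrite /v addrC subrK.
move=> H; rewrite expr0n expr1n/=; lra.
Qed.

Lemma gradN h z : differentiable h z -> grad (- h) z = - grad h z.
Proof.
by move=> dh; apply/rowP => j; rewrite !mxE deriveN//; exact: diff_derivable.
Qed.

Lemma lb_quad (h : 'rV[R]_d -> R) z z' (L : R) :
  (forall t : R, 0 <= t -> t <= 1 -> differentiable h (z + t *: (z' - z))) ->
  (forall t : R, 0 <= t -> t <= 1 ->
    - (L * t) <= dot (grad h (z + t *: (z' - z)) - grad h z) (z' - z)) ->
  h z + dot (grad h z) (z' - z) - L / 2 <= h z'.
Proof.
move=> dh lh.
have dz : differentiable h z by have := dh 0 (lexx _) ler01; rewrite scale0r addr0.
suff : (- h) z' <= (- h) z + dot (grad (- h) z) (z' - z) + L / 2.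
  by rewrite gradN// dotNl fctE; lra.
apply: ub_quad => t t0 t1; first exact/differentiableN/dh.
rewrite !gradN//; last exact: dh.
by rewrite opprK addrC -opprB dotNl lerNl; exact: lh.
Qed.

End Gradient.

Lemma quad_bound (R : realType) d (h : 'rV[R]_d -> R) z z' (L : R) :
  (forall t : R, 0 <= t -> t <= 1 ->
    differentiable h (z + t *: (z' - z)) /\
    `|dot (grad h (z + t *: (z' - z)) - grad h z) (z' - z)| <= L * t) ->
  `|h z' - h z - dot (grad h z) (z' - z)| <= L / 2.
Proof.
move=> H; have U : h z' <= h z + dot (grad h z) (z' - z) + L / 2.
  apply: ub_quad => t t0 t1; have [//] := H t t0 t1.
  by rewrite ler_norml => _ /andP[].
have V : h z + dot (grad h z) (z' - z) - L / 2 <= h z'.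
  apply: lb_quad => t t0 t1; have [//] := H t t0 t1.
  by rewrite ler_norml => _ /andP[].
by rewrite ler_norml; lra.
Qed.

Section Sequences.
Context {R : realType}.

Lemma within_continuous_cvg d (S : set 'rV[R]_d) (h : 'rV[R]_d -> R)
    (u : nat -> 'rV[R]_d) (a : 'rV[R]_d) :
  {within S, continuous h} -> (forall k, S (u k)) -> S a ->
  u @ \oo --> a -> (fun k => h (u k)) @ \oo --> h a.
Proof.
move=> /subspace_continuousP/(_ a) ch Su Sa ua.
apply: (cvg_comp u h _ (ch Sa)) => U /= nU.
have A : \forall k \near \oo, S (u k) -> U (u k) by exact: (ua _ nU).
suff : \forall k \near \oo, U (u k) by [].
by apply: filterS A => k; apply; exact: Su.
Qed.

Lemma lipschitz_on_cvg d e (L : R) (S : set 'rV[R]_d)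
    (G : 'rV[R]_d -> 'rV[R]_e) (u : nat -> 'rV[R]_d) (a : 'rV[R]_d) :
  Defs.lipschitz_on L S G -> (forall k, S (u k)) -> S a ->
  u @ \oo --> a -> (fun k => G (u k)) @ \oo --> G a.
Proof.
move=> [L0 lG] Su Sa /cvg_enormP ua; apply/cvg_enormP.
have h : (fun k => L * enorm (u k - a)) @ \oo --> (0 : R).
  by rewrite -(mulr0 L); apply: cvgMr.
apply: (squeeze_cvgr _ (cvg_cst 0) h); near=> k.
by rewrite enorm_ge0 lG.
Unshelve. all: by end_near. Qed.

End Sequences.

(** A quadratic error in the lower bound along the segment disappears: convexity bounds h(z + t (z'
    - z)) from above by the chord, and the comparison is divided by t -> 0. *)
Lemma convex_ge_tangent (R : realType) d (S : set 'rV[R]_d)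
    (h : 'rV[R]_d -> R) (z z' : 'rV[R]_d) (c M : R) :
  is_convex_on S h -> S z -> S z' ->
  (forall t : R, 0 < t -> t <= 1 ->
    h z + t * c - t ^+ 2 * M <= h (z + t *: (z' - z))) ->
  h z + c <= h z'.
Proof.
move=> ch Sz Sz' H; rewrite -lerBrDl; apply: (@ler_vanishing _ _ _ M) => t t0 t1.
have H1 := le_trans (H _ t0 t1) (convex_on_seg ch Sz Sz' (ltW t0) t1).
rewrite -(ler_pM2l t0); lra.
Qed.

(** * Partial gradients of functions on a product *)

Section Partial.
Context {R : realType} {n m : nat}.
Implicit Types h : 'rV[R]_n -> 'rV[R]_m -> R.

Lemma joint_row {T : Type} (h : 'rV[R]_n -> 'rV[R]_m -> T) x y :
  joint h (row_mx x y) = h x y.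
Proof. by rewrite /joint row_mxKl row_mxKr. Qed.

Lemma prodset_row (X : set 'rV[R]_n) (Y : set 'rV[R]_m) x y :
  prodset X Y (row_mx x y) <-> X x /\ Y y.
Proof. by rewrite /prodset/= row_mxKl row_mxKr. Qed.

Lemma grad_joint h x y :
  grad (joint h) (row_mx x y) = row_mx (gradx h x y) (grady h x y).
Proof.
have E v w : (fun t : R => t^-1 *: ((joint h \o shift (row_mx x y))
      (t *: row_mx v w) - joint h (row_mx x y))) =
    (fun t => t^-1 *: (h (t *: v + x) (t *: w + y) - h x y)).
  by apply/funext => t /=; rewrite scale_row_mx add_row_mx !joint_row.
have Ex v : 'D_(row_mx v 0) (joint h) (row_mx x y) = 'D_v (h^~ y) x.
  by rewrite /derive E; under eq_fun do rewrite scaler0 add0r.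
have Ey v : 'D_(row_mx 0 v) (joint h) (row_mx x y) = 'D_v (h x) y.
  by rewrite /derive E; under eq_fun do rewrite scaler0 add0r.
apply/rowP => j; case: (split_ordP j) => i ->.
  by rewrite row_mxEl !mxE -Ex delta_mx_lshift.
by rewrite row_mxEr !mxE -Ey delta_mx_rshift.
Qed.

Section Smooth.
Variables (X : set 'rV[R]_n) (Y : set 'rV[R]_m).
Variables (h : 'rV[R]_n -> 'rV[R]_m -> R) (Lx Ly : R).
Hypothesis cX : @convex_set R 'rV[R]_n X.
Hypothesis cY : @convex_set R 'rV[R]_m Y.
Hypothesis dh : forall z, prodset X Y z -> differentiable (joint h) z.
Hypothesis lx : Defs.lipschitz_on Lx (prodset X Y) (joint (gradx h)).
Hypothesis ly : Defs.lipschitz_on Ly (prodset X Y) (joint (grady h)).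

Lemma gradx_lip x y x' y' : X x -> Y y -> X x' -> Y y' ->
  enorm (gradx h x y - gradx h x' y') <= Lx * enorm (row_mx (x - x') (y - y')).
Proof.
move=> Xx Yy Xx' Yy'; have := lx.2 (row_mx x y) (row_mx x' y').
by rewrite !joint_row row_mxB; apply; apply/prodset_row.
Qed.

Lemma grady_lip x y x' y' : X x -> Y y -> X x' -> Y y' ->
  enorm (grady h x y - grady h x' y') <= Ly * enorm (row_mx (x - x') (y - y')).
Proof.
move=> Xx Yy Xx' Yy'; have := ly.2 (row_mx x y) (row_mx x' y').
by rewrite !joint_row row_mxB; apply; apply/prodset_row.
Qed.

Lemma smooth_bound x y x' y' (L : R) : X x -> Y y -> X x' -> Y y' ->
  (forall t : R, 0 <= t -> t <= 1 ->
    let x'' := x + t *: (x' - x) in let y'' := y + t *: (y' - y) in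
    X x'' -> Y y'' ->
    `|dot (gradx h x'' y'' - gradx h x y) (x' - x) +
      dot (grady h x'' y'' - grady h x y) (y' - y)| <= L * t) ->
  `|h x' y' - h x y - (dot (gradx h x y) (x' - x) + dot (grady h x y) (y' - y))|
    <= L / 2.
Proof.
move=> Xx Yy Xx' Yy' H.
have := @quad_bound _ _ (joint h) (row_mx x y) (row_mx x' y') L.
rewrite !joint_row grad_joint row_mxB dot_row_mx; apply=> t t0 t1.
have Xt := convex_set_seg cX Xx Xx' t0 t1.
have Yt := convex_set_seg cY Yy Yy' t0 t1.
rewrite scale_row_mx add_row_mx; split; first by apply: dh; apply/prodset_row.
by rewrite grad_joint row_mxB dot_row_mx; exact: H.
Qed.

Lemma smooth_y x y y' : X x -> Y y -> Y y' ->
  `|h x y' - h x y - dot (grady h x y) (y' - y)|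
    <= Ly * enorm (y' - y) ^+ 2 / 2.
Proof.
move=> Xx Yy Yy'.
have := @smooth_bound x y x y' (Ly * enorm (y' - y) ^+ 2) Xx Yy Xx Yy'.
rewrite subrr !dot0r add0r; apply=> t t0 t1 /= X1 Y1.
rewrite dot0r add0r; apply: le_trans (normr_dot_le _ _) _.
have := grady_lip X1 Y1 Xx Yy.
rewrite scaler0 addr0 subrr (addrC y) addrK enorm_row_0mx enormZ ger0_norm//.
have := enorm_ge0 (y' - y) => p; move: (enorm (grady _ _ _ - _)) => q q'.
have := ler_wpM2r p q'; nra.
Qed.

Lemma smooth_x x x' y : X x -> X x' -> Y y ->
  `|h x' y - h x y - dot (gradx h x y) (x' - x)|
    <= Lx * enorm (x' - x) ^+ 2 / 2.
Proof.
move=> Xx Xx' Yy.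
have := @smooth_bound x y x' y (Lx * enorm (x' - x) ^+ 2) Xx Yy Xx' Yy.
rewrite subrr !dot0r addr0; apply=> t t0 t1 /= X1 Y1.
rewrite dot0r addr0; apply: le_trans (normr_dot_le _ _) _.
have := gradx_lip X1 Y1 Xx Yy.
rewrite scaler0 addr0 subrr (addrC x) addrK enorm_row_mx0 enormZ ger0_norm//.
have := enorm_ge0 (x' - x) => p; move: (enorm (gradx _ _ _ - _)) => q q'.
have := ler_wpM2r p q'; nra.
Qed.

(** The sum [Lx + Ly] appears because each block of the gradient is bounded by its own Lipschitz
    constant times the full norm of the displacement. *)
Lemma smooth_xy x y x' y' : X x -> Y y -> X x' -> Y y' ->
  `|h x' y' - h x y - (dot (gradx h x y) (x' - x) + dot (grady h x y) (y' - y))|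
    <= (Lx + Ly) * (enorm (x' - x) ^+ 2 + enorm (y' - y) ^+ 2) / 2.
Proof.
move=> Xx Yy Xx' Yy'; apply: smooth_bound => // t t0 t1 /= X1 Y1.
rewrite -enorm_row_mx; apply: le_trans (ler_normD _ _) _.
rewrite mulrDl mulrDl; apply: lerD.
  apply: le_trans (normr_dot_le _ _) _.
  have := gradx_lip X1 Y1 Xx Yy.
  rewrite !(addrC _ (t *: _)) !addrK -scale_row_mx enormZ ger0_norm// => H.
  apply: le_trans (ler_pM _ _ H (enorm_row_mxl _ (y' - y))) _; rewrite ?enorm_ge0//.
  by rewrite le_eqVlt; apply/orP; left; apply/eqP; ring.
apply: le_trans (normr_dot_le _ _) _.
have := grady_lip X1 Y1 Xx Yy.
rewrite !(addrC _ (t *: _)) !addrK -scale_row_mx enormZ ger0_norm// => H.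
apply: le_trans (ler_pM _ _ H (enorm_row_mxr (x' - x) _)) _; rewrite ?enorm_ge0//.
by rewrite le_eqVlt; apply/orP; left; apply/eqP; ring.
Qed.

Lemma grady_subgrad x y y' : is_convex_on Y (h x) -> X x -> Y y -> Y y' ->
  h x y + dot (grady h x y) (y' - y) <= h x y'.
Proof.
move=> ch Xx Yy Yy'.
apply: (@convex_ge_tangent _ _ Y _ _ _ _ (Ly * enorm (y' - y) ^+ 2 / 2) ch) => //.
move=> t t0 t1.
have Yt := convex_set_seg cY Yy Yy' (ltW t0) t1.
have := smooth_y Xx Yy Yt; rewrite (addrC y) addrK ler_norml => /andP[+ _].
rewrite dotZr enormZ exprMn real_normK ?num_real//; lra.
Qed.

End Smooth.
End Partial.

(** * Convex analysis *)

(** Subgradient of h + delta_S in the sense of convex analysis. For convex data it agrees with the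
    regular and the limiting subgradients of [restr S h] ([regular_subgrad], [subgrad_regular],
    [subdiff_subgrad]), and it is the form used in all estimates. *)
Definition convex_subgrad {R : realType} {d} (S : set 'rV[R]_d)
    (h : 'rV[R]_d -> R) (y xi : 'rV[R]_d) : Prop :=
  S y /\ forall th, S th -> h y + dot xi (th - y) <= h th.

Section ConvexAnalysis.
Context {R : realType} {d : nat}.
Implicit Types (S : set 'rV[R]_d) (h : 'rV[R]_d -> R).

Lemma continuous_enormB (y : 'rV[R]_d) :
  continuous (fun th : 'rV[R]_d => enorm (th - y)).
Proof.
move=> a; apply/(@cvgrPdist_lt _ _ _ (nbhs (a : 'rV[R]_d)) (nbhs_filter (a :
  'rV[R]_d))) => e e0.
near=> b; have ab : enorm (b - a) < e by near: b; exact: near_enorm.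
apply: le_lt_trans ab.
have h1 := enorm_triangle a b y; have h2 := enorm_triangle b a y.
rewrite (enorm_distC a b) in h2.
by rewrite ler_norml; lra.
Unshelve. all: by end_near. Qed.

Lemma compact_inter_ball S (y : 'rV[R]_d) (r : R) : closed S ->
  compact (S `&` [set th | enorm (th - y) <= r]).
Proof.
move=> cS; apply: bounded_closed_compact.
  exists (r + `|y|); split; first by rewrite num_real.
  move=> M rM th [_ /= thr]; rewrite -[th](subrK y).
  apply: le_trans (ler_normD _ _) _; apply: le_trans (ltW rM).
  by rewrite lerD2r; apply: le_trans (norm_le_enorm _) thr.
apply: closedI => //.
have := @preimage_closed 'rV[R]_d R (fun th => enorm (th - y)) [set x | x <= r].
apply; last exact: closed_le.
by move=> th _; exact: continuous_enormB.
Qed.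

(** Convexity allows at most linear decrease of h away from [y0], and the quadratic term dominates
    it. So a minimizer over a large enough ball, which exists by compactness, is global. *)
Lemma argmin_exists S h (b y0 : 'rV[R]_d) (c : R) :
  closed S -> @convex_set R 'rV[R]_d S -> is_convex_on S h ->
  {within S, continuous h} -> S y0 -> 0 < c ->
  exists2 y, S y & forall th, S th ->
    h y + c * enorm (y - b) ^+ 2 <= h th + c * enorm (th - b) ^+ 2.
Proof.
move=> clS cS ch hS Sy0 c0.
have minball (f : 'rV[R]_d -> R) (r : R) : 0 <= r -> {within S, continuous f} ->
    exists2 y, S y & forall th, S th -> enorm (th - y0) <= r -> f y <= f th.
  move=> r0 cf.
  have [||y yK Hy] := @compact_EVT_min _ _ f _ _ (@compact_inter_ball S y0 r clS).
  - by exists y0; split => //=; rewrite subrr enorm0.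
  - by apply: continuous_subspaceW cf; exact: subIsetl.
  exists y; first by move: yK; rewrite inE => -[].
  by move=> th Sth th_r; apply: Hy; rewrite inE.
have [ym Sym Hym] := minball h 1 ler01 hS.
set A := h y0 - h ym.
have A0 : 0 <= A by rewrite subr_ge0; apply: Hym => //; rewrite subrr enorm0.
(* If th is at distance r > 1 from [y0], the point of the segment at distance 1 has value at least h
   ym; convexity along the segment turns this into a bound at th. *)
have lin th : S th -> h y0 - A * enorm (th - y0) - A <= h th.
  move=> Sth; have r0 := enorm_ge0 (th - y0); have [r1|r1] := leP (enorm (th - y0)) 1.
    have := Hym _ Sth r1; rewrite /A => h1; have : 0 <= A * enorm (th - y0) by
      rewrite mulr_ge0.
    by rewrite /A; lra.
  set r := enorm _ in r0 r1 *; have rp : 0 < r by lra.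
  have t0 : 0 <= r^-1 by rewrite invr_ge0.
  have t1 : r^-1 <= 1 by rewrite invf_le1// ltW.
  have := convex_on_seg ch Sy0 Sth t0 t1.
  have St := convex_set_seg cS Sy0 Sth t0 t1.
  have : h ym <= h (y0 + r^-1 *: (th - y0)).
    apply: Hym => //; rewrite (addrC y0) addrK enormZ ger0_norm// mulVf//.
    by rewrite gt_eqF.
  move=> h1 h2; have h3 := le_trans h1 h2.
  have : r * h ym <= r * h y0 + (h th - h y0).
    have := ler_wpM2l r0 h3; rewrite mulrDr mulrA divff ?gt_eqF// mul1r; lra.
  by rewrite /A (mulrC _ r) mulrBr; move: A0; rewrite /A; lra.
set B := enorm (y0 - b); have B0 : 0 <= B by exact: enorm_ge0.
(* Chosen so that c s^2 >= (c + 2 c B + 2 A) s for s >= r; then c (s - B)^2 - A s - A >= c B^2, so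
   points outside the ball cannot beat [y0]. *)
pose r := 1 + (2 * c * B + 2 * A) / c.
have cr : c * r = c + 2 * c * B + 2 * A.
  by rewrite /r mulrDr mulr1 mulrCA divff ?gt_eqF// mulr1 addrA.
have r1 : 1 <= r.
  rewrite lerDl; apply: divr_ge0; last exact: ltW.
  by rewrite addr_ge0// !mulr_ge0// ltW.
pose q := fun th => h th + c * enorm (th - b) ^+ 2.
have cq : {within S, continuous q}.
  apply/subspace_continuousP => th Sth; apply: cvgD.
    by move/subspace_continuousP : hS; exact.
  apply: cvgMr; rewrite expr2; under eq_fun do rewrite expr2.
  by apply: cvgM; apply: cvg_within_filter; exact: continuous_enormB.
have [y Sy Hy] := minball q r (le_trans ler01 r1) cq.
exists y => // th Sth; have [thr|thr] := leP (enorm (th - y0)) r; first exact: Hy.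
apply: (@le_trans _ _ (q y0)); first by apply: Hy; rewrite // subrr enorm0; lra.
rewrite /q -/B.
have tr : enorm (th - y0) - B <= enorm (th - b).
  by have := enorm_triangle b th y0; rewrite (enorm_distC b) -/B; lra.
have := lin _ Sth; set s := enorm (th - y0) in thr tr *; set w := enorm (th - b) in tr *.
move=> h1; have rB : 2 * B <= r.
  by rewrite -(ler_pM2l c0) cr; lra.
have w0 : 0 <= w by exact: enorm_ge0.
have : (s - B) ^+ 2 <= w ^+ 2 by rewrite ler_pXn2r ?nnegrE//; lra.
move=> /(ler_wpM2l (ltW c0)) h2.
have : c * B ^+ 2 <= c * (s - B) ^+ 2 - A * s - A; last by lra.
have : (c + 2 * c * B + 2 * A) * s <= c * s * s.
  by rewrite -cr; apply: ler_wpM2r; [lra|apply: ler_wpM2l; lra].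
have : A <= A * s by rewrite ler_peMr//; lra.
have : 0 <= c * s by rewrite mulr_ge0; lra.
nra.
Qed.

(** First-order optimality for a sum in which [s] need only have a quadratic upper model with slope
    [v] at the minimizer: compare the minimum with points of a shrinking segment. *)
Lemma minimizer_subgrad S h (s : 'rV[R]_d -> R) (y v : 'rV[R]_d) (M : R) :
  @convex_set R 'rV[R]_d S -> is_convex_on S h -> S y ->
  (forall th, S th -> s th <= s y + dot v (th - y) + M * enorm (th - y) ^+ 2) ->
  (forall th, S th -> h y + s y <= h th + s th) ->
  convex_subgrad S h y (- v).
Proof.
move=> cS ch Sy Hs Hm; split=> // th Sth; rewrite dotNl -lerBrDl.
apply: (@ler_vanishing _ _ _ (M * enorm (th - y) ^+ 2)) => t t0 t1.
have St := convex_set_seg cS Sy Sth (ltW t0) t1.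
have := Hs _ St; have := Hm _ St.
rewrite (addrC y) addrK dotZr enormZ exprMn real_normK ?num_real// addrC.
have := convex_on_seg ch Sy Sth (ltW t0) t1; rewrite (addrC y) => h1 h2 h3.
by rewrite -(ler_pM2l t0); lra.
Qed.

Lemma subgrad_monotone S h (y y' xi xi' : 'rV[R]_d) :
  convex_subgrad S h y xi -> convex_subgrad S h y' xi' ->
  0 <= dot (xi - xi') (y - y').
Proof.
move=> [Sy H] [Sy' H']; have := H _ Sy'; have := H' _ Sy.
by rewrite -[y' - y]opprB dotNr dotBl; lra.
Qed.

(** [prox] is a choice by [xget], so a minimizer must be exhibited before anything is known about
    its value. The chosen point lies in [S] because the objective is +oo elsewhere, and the
    subgradient is its optimality condition. *)
Lemma prox_restr_spec S h (y0 y : 'rV[R]_d) (t : R) :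
  closed S -> @convex_set R 'rV[R]_d S -> is_convex_on S h ->
  {within S, continuous h} -> S y0 -> 0 < t ->
  let p := prox (fun b => (t%:E * restr S h b)%E) y in
  convex_subgrad S h p (t^-1 *: (y - p)).
Proof.
move=> clS cS ch hS Sy0 t0; rewrite /prox; set P := (X in xget _ X).
have [p Sp Hp] : exists2 p, S p & forall th, S th ->
    h p + (2 * t)^-1 * enorm (p - y) ^+ 2 <= h th + (2 * t)^-1 * enorm (th - y) ^+ 2.
  by apply: (argmin_exists y clS cS ch hS Sy0); rewrite invr_gt0 mulr_gt0.
have scale th : S th -> t * (h th + (2 * t)^-1 * enorm (th - y) ^+ 2) =
    t * h th + 2^-1 * enorm (th - y) ^+ 2.
  by move=> _; field; rewrite gt_eqF.
have : P p.
  move=> th; rewrite /restr asboolT//; case: asboolP => [Sth|nSth]; last first.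
    by rewrite gt0_muley ?lte_fin// addye// leey.
  by rewrite -!EFinM -!EFinD lee_fin -!scale// ler_pM2l// Hp.
move=> /(xgetI 0); set q := xget _ _ => Pq /=.
have Sq : S q.
  apply: contrapT => nSq; have := Pq p; rewrite /restr asboolF// asboolT//.
  by rewrite gt0_muley ?lte_fin// addye// -EFinM -EFinD leye_eq.
suff : convex_subgrad S h q (- (t^-1 *: (q - y))) by rewrite -scalerN opprB.
apply: (@minimizer_subgrad S h (fun th => (2 * t)^-1 * enorm (th - y) ^+ 2) _ _
  (2 * t)^-1) => //.
  move=> th Sth; rewrite le_eqVlt; apply/orP; left; apply/eqP.
  rewrite -(subrKA q th (- y)) (addrC (th - q)) [enorm (q - y + _) ^+ 2]enorm_sqrD !dotZl.
  by field; rewrite gt_eqF.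
move=> th Sth; rewrite -(ler_pM2l t0) !scale//.
by have := Pq th; rewrite /restr !asboolT// -!EFinM -!EFinD lee_fin.
Qed.

Lemma proj_spec S (y0 y : 'rV[R]_d) :
  closed S -> @convex_set R 'rV[R]_d S -> S y0 ->
  S (Defs.proj S y) /\ forall q, S q -> dot (y - Defs.proj S y) (q - Defs.proj S y) <= 0.
Proof.
move=> clS cS Sy0; rewrite /Defs.proj; set P := (X in xget _ X).
have c0 : is_convex_on S (fun=> 0 : R).
  by move=> t a b _ _; rewrite convRE !mulr0 addr0.
have [|p Sp Hp] := @argmin_exists S (fun=> 0) y y0 1 clS cS c0 _ Sy0 ltr01.
  by apply: continuous_subspaceT => x; exact: cst_continuous.
have : P p by split=> // q Sq; apply: ler_enorm; have := Hp _ Sq; lra.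
move=> /(xgetI 0); set p' := xget _ _ => -[Sp' Hp'].
split=> // q Sq.
have [_ /(_ q Sq)] : convex_subgrad S (fun=> 0) p' (- (2 *: (p' - y))).
  apply: (@minimizer_subgrad S _ (fun th => enorm (th - y) ^+ 2) _ _ 1) => //.
    move=> th Sth; rewrite -(subrKA p' th (- y)) (addrC (th - p')) [enorm (p' - y
      + _) ^+ 2]enorm_sqrD mul1r.
    by rewrite dotZl.
  by move=> th Sth; rewrite !add0r ler_pXn2r ?nnegrE ?enorm_ge0// Hp'.
by rewrite dotNl dotZl -[p' - y]opprB dotNl; lra.
Qed.

(** The local inequality, applied at a point of the segment close to y, becomes global by
    convexity. *)
Lemma regular_subgrad S h (y xi : 'rV[R]_d) :
  @convex_set R 'rV[R]_d S -> is_convex_on S h ->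
  regular_subdiff (restr S h) y xi -> convex_subgrad S h y xi.
Proof.
move=> cS ch [fy H].
have Sy : S y by apply: contrapT => nSy; move: fy; rewrite /restr asboolF.
split=> // th Sth; rewrite -lerBrDl.
apply/ler_addgt0Pr => e e0.
have [r0|r0] := eqVneq (enorm (th - y)) 0.
  have -> : th = y by apply/subr0_eq/enorm_eq0.
  by rewrite !subrr dot0r add0r ltW.
have rp : 0 < enorm (th - y) by rewrite lt_neqAle eq_sym r0 enorm_ge0.
(* The slack is divided by |th - y|, so that at y + t (th - y) the error is exactly e t and survives
   the division by t as e. *)
have [r rr near] := near_enormP (H (e / enorm (th - y)) (divr_gt0 e0 rp)).
pose t := Num.min 1 (r / (2 * enorm (th - y))).
have t0 : 0 < t by rewrite lt_min ltr01 divr_gt0// mulr_gt0.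
have t1 : t <= 1 by rewrite ge_min lexx.
have St := convex_set_seg cS Sy Sth (ltW t0) t1.
have := near (y + t *: (th - y)); rewrite (addrC y) addrK enormZ (ger0_norm (ltW t0)).
have tr : t * enorm (th - y) < r.
  apply: (@le_lt_trans _ _ (r / 2)); last lra.
  rewrite -ler_pdivlMr// ge_min; apply/orP; right.
  by rewrite invfM mulrA.
move=> /(_ tr); rewrite (addrC (t *: _)) /restr !asboolT// -EFinD lee_fin.
have := convex_on_seg ch Sy Sth (ltW t0) t1.
rewrite dotZr (_ : e / _ * (t * _) = e * t); last by field; rewrite gt_eqF.
by move=> h1 h2; rewrite -(ler_pM2l t0); lra.
Qed.

Lemma subgrad_regular S h (y xi : 'rV[R]_d) :
  convex_subgrad S h y xi -> regular_subdiff (restr S h) y xi.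
Proof.
move=> [Sy H]; split; first by rewrite /restr asboolT.
move=> e e0; near=> th; rewrite /restr asboolT//.
case: asboolP => [Sth|_]; last by rewrite leey.
rewrite -EFinD lee_fin; have := H _ Sth; have := enorm_ge0 (th - y); nra.
Unshelve. all: by end_near. Qed.

Lemma regular_subdiff_subdiff (h : 'rV[R]_d -> \bar R) y :
  regular_subdiff h y `<=` subdiff h y.
Proof.
move=> xi rxi; split; first by case: rxi.
exists (fun=> y), (fun=> xi); split; [exact: cvg_cst|exact: cvg_cst|by []|exact: cvg_cst].
Qed.

Lemma subgrad_closed S h (ys xis : nat -> 'rV[R]_d) (y xi : 'rV[R]_d) :
  (forall k, convex_subgrad S h (ys k) (xis k)) -> S y ->
  ys @ \oo --> y -> xis @ \oo --> xi ->
  (fun k => h (ys k)) @ \oo --> h y -> convex_subgrad S h y xi.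
Proof.
move=> H Sy cy cxi ch; split=> // th Sth.
have L : (fun k => h (ys k) + dot (xis k) (th - ys k)) @ \oo --> h y + dot xi (th - y).
  by apply: cvgD => //; apply: cvg_dot => //; apply: cvgB => //; exact: cvg_cst.
apply: (cvgr_to_le L); near=> k.
by have [_] := H k; exact.
Unshelve. all: by end_near. Qed.

(** Regular subgradients satisfy a global inequality, which passes to the limit because the
    definition of [subdiff] includes convergence of the values. *)
Lemma subdiff_subgrad S h (y xi : 'rV[R]_d) :
  @convex_set R 'rV[R]_d S -> is_convex_on S h ->
  subdiff (restr S h) y xi -> convex_subgrad S h y xi.
Proof.
move=> cS ch [fy [zs [vs [czs chz Hreg cvs]]]].
have Sy : S y by apply: contrapT => nSy; move: fy; rewrite /restr asboolF.
have sub k := regular_subgrad cS ch (Hreg k).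
apply: (subgrad_closed sub Sy czs cvs).
move: chz; rewrite /restr (asboolT Sy) => /fine_cvgP[_].
apply: cvg_trans; apply: near_eq_cvg; near=> k => /=.
by rewrite asboolT//; case: (sub k).
Unshelve. all: by end_near. Qed.

End ConvexAnalysis.

(** * The Moreau envelope *)

Section Envelope.
Context {R : realType} {n m : nat}.
Variables (D : problem R n m) (c : moduli R) (gamma : R).
Hypothesis hD : standing D c.
Hypothesis Y_ne : dY D !=set0.
Hypothesis gamma0 : 0 < gamma.
Hypothesis gamma_rho : gamma * (rhof2 c + rhog2 c) < 1.

Local Notation X := (dX D).
Local Notation Y := (dY D).
Local Notation F := (dF D).
Local Notation f := (df D).
Local Notation g := (dg D).
Local Notation phi := (vphi D).
Local Notation env := (envelope D gamma).

Let clY := closed_Y hD.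
Let cX := convex_X hD.
Let cY := convex_Y hD.
Let df z Sz := (f_C1 hD).1 z Sz.
Let dF z Sz := (F_C1 hD).1 z Sz.

Lemma within_continuous_joint (h : 'rV[R]_n -> 'rV[R]_m -> R) x :
  {within prodset X Y, continuous (joint h)} -> X x ->
  {within Y, continuous (h x)}.
Proof.
move=> /subspace_continuousP hc Xx; apply/subspace_continuousP => y Yy.
have /hc H : prodset X Y (row_mx x y) by apply/prodset_row.
move=> U nU0; have {nU0}nU : nbhs (joint h (row_mx x y)) U by rewrite joint_row.
have {}nU := H _ nU.
have /near_enormP[r r0 Hr] : nbhs (row_mx x y) [set z | prodset X Y z -> U (joint h z)].
  by exact: nU.
suff : \forall y' \near y, Y y' -> U (h x y') by [].
near=> y' => Yy'; rewrite -(joint_row h); apply: Hr; last exact/prodset_row.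
rewrite row_mxB subrr enorm_row_0mx; near: y'; exact: near_enorm.
Unshelve. all: by end_near. Qed.

Lemma C1_within_continuous d (S : set 'rV[R]_d) (h : 'rV[R]_d -> R) :
  (forall z, S z -> differentiable h z) -> {within S, continuous h}.
Proof.
move=> dh; apply/subspace_continuousP => z Sz; apply: cvg_within_filter.
exact: differentiable_continuous (dh z Sz).
Qed.

Lemma f_cont : {within prodset X Y, continuous (joint f)}.
Proof. exact: C1_within_continuous df. Qed.

Lemma F_cont : {within prodset X Y, continuous (joint F)}.
Proof. exact: C1_within_continuous dF. Qed.

Lemma phi_cont : {within prodset X Y, continuous (joint phi)}.
Proof.
apply/subspace_continuousP => z Sz; apply: cvgD.
  by move/subspace_continuousP : f_cont; exact.
by move/subspace_continuousP : (g_cont hD); exact.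
Qed.

Lemma phi_convex x : X x -> is_convex_on Y (phi x).
Proof.
move=> Xx t y y' Yy Yy'; rewrite /vphi.
have := f_convex hD Xx t Yy Yy'; have := g_convex hD Xx t Yy Yy'.
by rewrite !convRE; lra.
Qed.

Definition theta_star (x : 'rV[R]_n) (y : 'rV[R]_m) : 'rV[R]_m :=
  xget 0 [set th | Y th /\ forall th', Y th' ->
    phi x th + (2 * gamma)^-1 * enorm (th - y) ^+ 2 <=
    phi x th' + (2 * gamma)^-1 * enorm (th' - y) ^+ 2].

Lemma g2gt0 : 0 < (2 * gamma)^-1.
Proof. by rewrite invr_gt0 mulr_gt0. Qed.

Lemma theta_starP x y : X x -> Y (theta_star x y) /\
  forall th', Y th' ->
    phi x (theta_star x y) + (2 * gamma)^-1 * enorm (theta_star x y - y) ^+ 2 <=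
    phi x th' + (2 * gamma)^-1 * enorm (th' - y) ^+ 2.
Proof.
move=> Xx; have [y0 Yy0] := Y_ne.
have [th Yth Hth] := argmin_exists y clY cY (phi_convex Xx)
  (within_continuous_joint phi_cont Xx) Yy0 g2gt0.
rewrite /theta_star; set P := (X in xget _ X).
have : P th by split.
by move=> /(xgetI 0).
Qed.

Lemma theta_starY x y : X x -> Y (theta_star x y).
Proof. by move=> /(theta_starP y)[]. Qed.

Lemma envelope_has_inf x y : X x ->
  has_inf [set phi x th + (2 * gamma)^-1 * enorm (th - y) ^+ 2 | th in Y].
Proof.
move=> Xx; have [Yt Ht] := theta_starP y Xx; split.
  by exists (phi x (theta_star x y) + (2 * gamma)^-1 * enorm (theta_star x y - y)
    ^+ 2); exists (theta_star x y).
by eexists => _ [th Yth <-]; exact: Ht.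
Qed.

Lemma envelope_le x y th : X x -> Y th ->
  env x y <= phi x th + (2 * gamma)^-1 * enorm (th - y) ^+ 2.
Proof.
by move=> Xx Yth; apply: ge_inf; [have [] := envelope_has_inf y Xx|exists th].
Qed.

Lemma envelopeE x y : X x ->
  env x y = phi x (theta_star x y) +
            (2 * gamma)^-1 * enorm (theta_star x y - y) ^+ 2.
Proof.
move=> Xx; have [Yt Ht] := theta_starP y Xx.
apply/eqP; rewrite eq_le envelope_le//=; apply: lb_le_inf.
  by have [] := envelope_has_inf y Xx.
by move=> _ [th Yth <-]; exact: Ht.
Qed.

Lemma envelope_le_phi x y : X x -> Y y -> env x y <= phi x y.
Proof.
move=> Xx Yy; apply: le_trans (envelope_le y Xx Yy) _.
by rewrite subrr enorm0 expr0n mulr0 addr0.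
Qed.

(** The optimality condition of the lower-level problem, with g as the nonsmooth part and f plus the
    proximal term as the part with a quadratic upper model. *)
Lemma theta_star_subgrad x y : X x ->
  convex_subgrad Y (g x) (theta_star x y)
    (- (grady f x (theta_star x y) + gamma^-1 *: (theta_star x y - y))).
Proof.
move=> Xx; have [Yt Ht] := theta_starP y Xx.
apply: (@minimizer_subgrad _ _ Y _
  (fun th => f x th + (2 * gamma)^-1 * enorm (th - y) ^+ 2) _ _
  (Lfy c / 2 + (2 * gamma)^-1)) => //.
- exact: g_convex hD _ Xx.
- move=> th Yth.
  have := smooth_y cX cY df (grady_f_lip hD) Xx Yt Yth; rewrite ler_norml => /andP[_].
  set t := theta_star x y; rewrite -(subrKA t th (- y)) (addrC (th - t)).
  rewrite [enorm (t - y + _) ^+ 2]enorm_sqrD.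
  rewrite [dot (grady _ _ _ + _) _]dotDl dotZl.
  rewrite (_ : gamma^-1 = (2 * gamma)^-1 * 2); last by field; rewrite gt_eqF.
  lra.
- by move=> th /Ht; rewrite /vphi; lra.
Qed.

Lemma f_subgrad x y y' : X x -> Y y -> Y y' ->
  f x y + dot (grady f x y) (y' - y) <= f x y'.
Proof.
move=> Xx; exact: (grady_subgrad cX cY df (grady_f_lip hD) (f_convex hD Xx) Xx).
Qed.

Lemma grady_f_monotone x y y' : X x -> Y y -> Y y' ->
  0 <= dot (grady f x y - grady f x y') (y - y').
Proof.
move=> Xx Yy Yy'; have := f_subgrad Xx Yy Yy'; have := f_subgrad Xx Yy' Yy.
by rewrite -[y' - y]opprB dotNr dotBl; lra.
Qed.

Lemma grady_f_lipy x y y' : X x -> Y y -> Y y' ->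
  enorm (grady f x y - grady f x y') <= Lfy c * enorm (y - y').
Proof.
move=> Xx Yy Yy'; have := grady_lip (grady_f_lip hD) Xx Yy Xx Yy'.
by rewrite subrr enorm_row_0mx.
Qed.

Lemma grady_f_lipx x x' y : X x -> X x' -> Y y ->
  enorm (grady f x y - grady f x' y) <= Lfy c * enorm (x - x').
Proof.
move=> Xx Xx' Yy; have := grady_lip (grady_f_lip hD) Xx Yy Xx' Yy.
by rewrite subrr enorm_row_mx0.
Qed.

(** Here p is the prox-gradient step from t, so |t - p| is the residual. The optimality conditions
    of p and of the exact solution differ by a perturbation of size O(|t - p|), and the proximal
    term makes the lower-level problem strongly monotone with modulus 1/gamma. *)
Lemma theta_star_error x y t p (eta : R) : X x -> Y t -> 0 < eta ->
  convex_subgrad Y (g x) p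
    (eta^-1 *: (t - eta *: (grady f x t + gamma^-1 *: (t - y)) - p)) ->
  enorm (p - theta_star x y) <=
    gamma * (eta^-1 + Lfy c + gamma^-1) * enorm (t - p).
Proof.
move=> Xx Yt eta0 Sp; have Yp := Sp.1; set th := theta_star x y.
have Yth : Y th by exact: theta_starY.
have := subgrad_monotone Sp (theta_star_subgrad y Xx); rewrite -/th.
(* The term in p - th carries the strong monotonicity; [D2] is monotone, and the others, including
   the Lipschitz difference [D1], are of order |t - p|. *)
have -> : eta^-1 *: (t - eta *: (grady f x t + gamma^-1 *: (t - y)) - p) -
   - (grady f x th + gamma^-1 *: (th - y)) =
   eta^-1 *: (t - p) - gamma^-1 *: (t - p) - gamma^-1 *: (p - th)
   - (grady f x t - grady f x p) - (grady f x p - grady f x th).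
  have -> : t - eta *: (grady f x t + gamma^-1 *: (t - y)) - p =
     (t - p) - eta *: (grady f x t + gamma^-1 *: (t - y)) by rewrite addrAC.
  rewrite scalerBr scalerA mulVf ?gt_eqF// scale1r opprK.
  apply/rowP => i; rewrite !mxE; ring.
set D1 := grady f x t - _; set D2 := grady f x p - _.
set u := t - p; set v := p - th.
rewrite 4!dotBl !dotZl -enorm_sqr.
have h1 := grady_f_monotone Xx Yp Yth.
have h2 := dot_geN D1 v.
have h3 : enorm D1 <= Lfy c * enorm u by exact: grady_f_lipy.
have h4 := dot_le u v; have h5 := dot_geN u v.
have ei : 0 < eta^-1 by rewrite invr_gt0.
have gi : 0 < gamma^-1 by rewrite invr_gt0.
have := enorm_ge0 u; have := enorm_ge0 v.
rewrite -/D2 -/v in h1.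
clearbody D1 D2 u v.
move: (enorm v) (enorm u) (dot u v) (enorm D1) (dot D1 v) (dot D2 v) h1 h2 h3 h4
  h5 => a b s d1 s1 s2 h1 h2 h3 h4 h5 a0 b0 h.
have h6 := ler_wpM2l (ltW ei) h4; have h7 := ler_wpM2l (ltW gi) h5.
have h8 := ler_wpM2r a0 h3.
have H : gamma^-1 * a ^+ 2 <= (eta^-1 + Lfy c + gamma^-1) * b * a by lra.
have [a1|a1] := leP a 0.
  apply: le_trans a1 _; have L0 := (grady_f_lip hD).1.
  by rewrite !mulr_ge0 ?addr_ge0// ltW.
rewrite -mulrA -ler_pdivrMl// -(ler_pM2r a1); apply: le_trans H.
by rewrite expr2 mulrA.
Qed.

(** The assumption on partial_y g, stated for limiting subdifferentials, in terms of convex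
    subgradients. *)
Lemma subgrad_transfer x x' y xi : X x -> X x' ->
  convex_subgrad Y (g x) y xi ->
  exists2 xi', convex_subgrad Y (g x') y xi' &
    enorm (xi - xi') <= Lgy c * enorm (x - x').
Proof.
move=> Xx Xx' H; have Yy := H.1.
have : subdiff_y_g D x y xi.
  exact/regular_subdiff_subdiff/subgrad_regular.
move=> /(subdiff_y_g_lip hD Yy Xx' Xx) /= [xi' Hxi' [b b1 <-]].
exists xi'; first exact: (subdiff_subgrad cY (g_convex hD Xx') Hxi').
rewrite (addrC xi') addrK enormZ ger0_norm ?mulr_ge0 ?(Lgy_ge0 hD) ?enorm_ge0//.
rewrite (enorm_distC x) ler_piMr// mulr_ge0 ?(Lgy_ge0 hD) ?enorm_ge0//.
Qed.

(** Carry the subgradient at the solution for (x, y) over to g(x', .), at the cost [Lgy], and use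
    the strong monotonicity of the problem at x'. In y the map is nonexpansive, as a proximal
    map. *)
Lemma theta_star_lip x x' y y' : X x -> X x' ->
  enorm (theta_star x y - theta_star x' y') <=
    gamma * (Lfy c + Lgy c) * enorm (x - x') + enorm (y - y').
Proof.
move=> Xx Xx'; set a := theta_star x y; set b := theta_star x' y'.
have Ya : Y a by exact: theta_starY.
have Yb : Y b by exact: theta_starY.
have [xi Hxi lxi] := subgrad_transfer Xx Xx' (theta_star_subgrad y Xx).
have := subgrad_monotone Hxi (theta_star_subgrad y' Xx').
rewrite -/a -/b in lxi *.
have E (A A' B z a' b' : 'rV[R]_m) : z - - (B + gamma^-1 *: (b' - y')) =
  - (- (A + gamma^-1 *: (a' - y)) - z) - (A - A')
  - (A' - B) - gamma^-1 *: (a' - b') + gamma^-1 *: (y - y').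
  by apply/rowP => i; rewrite !mxE; ring.
rewrite (E (grady f x a) (grady f x' a) _ _ a).
set w := _ - xi in lxi *.
move: (grady_f_monotone Xx' Ya Yb) (dot_geN (grady f x a - grady f x' a) (a - b)).
set D1 := grady f x a - _; set D2 := grady f x' a - _.
move=> h1 h3; move: h1 h3 (dot_geN w (a - b)) (dot_le (y - y') (a - b)).
set ab := a - b; set dy := y - y' => h1 h3 h2 h4.
rewrite dotDl 3!dotBl dotNl !dotZl -enorm_sqr => h.
have h5 := grady_f_lipx Xx Xx' Ya.
rewrite -/D1 in h5.
have := enorm_ge0 ab; have := enorm_ge0 dy; have := enorm_ge0 (x - x').
have gi : 0 < gamma^-1 by rewrite invr_gt0.
clearbody D1 D2 w ab dy; clear E Ya Yb Hxi; clearbody a b.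
move: (enorm ab) (enorm dy) (enorm (x - x')) (enorm w) (enorm D1) (dot w ab)
  (dot D1 ab) (dot D2 ab) (dot dy ab) h h1 h2 h3 h4 h5 lxi.
move=> s u v ew e1 dw d1 d2 dd h h1 h2 h3 h4 h5 lxi v0 u0 s0.
have h6 := ler_wpM2l (ltW gi) h4.
have h7 := ler_wpM2r s0 h5.
have h8 := ler_wpM2r s0 lxi.
have H : gamma^-1 * s ^+ 2 <= ((Lfy c + Lgy c) * v + gamma^-1 * u) * s by lra.
have [s1|s1] := leP s 0.
  apply: le_trans s1 _; have L0 := (grady_f_lip hD).1.
  have := Lgy_ge0 hD => G0.
  by rewrite addr_ge0// !mulr_ge0// ?addr_ge0// ltW.
rewrite -(ler_pM2r s1) -(ler_pM2l gi) -expr2; apply: le_trans H _.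
rewrite le_eqVlt; apply/orP; left; apply/eqP; field; rewrite gt_eqF//.
Qed.

(** The x-gradient of phi at points of X x Y ([gradx_phi]), as the sum to which the Lipschitz bounds
    of f and g apply separately. *)
Definition gphix (x : 'rV[R]_n) (y : 'rV[R]_m) : 'rV[R]_n :=
  gradx f x y + gradx g x y.

Lemma gradx_phi x y : X x -> Y y -> gradx phi x y = gphix x y.
Proof.
move=> Xx Yy; apply/rowP => j; rewrite !mxE.
have E : (fun t : R => t^-1 *: ((f^~ y \o shift x) (t *: delta_mx 0 j) - f x y)) =
  (fun t : R => t^-1 *: ((joint f \o shift (row_mx x y))
     (t *: row_mx (delta_mx 0 j) 0) - joint f (row_mx x y))).
  by apply/funext => t /=; rewrite scale_row_mx add_row_mx !joint_row scaler0 add0r.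
have Df : derivable (f^~ y) x (delta_mx 0 j).
  rewrite /derivable E; apply: diff_derivable; apply: df.
  exact/prodset_row.
have Dg : derivable (g^~ y) x (delta_mx 0 j).
  by apply: diff_derivable; exact: (g_diffx hD).
by rewrite -deriveD.
Qed.

Lemma g_smooth_x x x' y : X x -> X x' -> Y y ->
  `|g x' y - g x y - dot (gradx g x y) (x' - x)|
    <= Lg1 c * enorm (x' - x) ^+ 2 / 2.
Proof.
move=> Xx Xx' Yy; apply: (@quad_bound _ _ (g^~ y)) => t t0 t1.
have Xt := convex_set_seg cX Xx Xx' t0 t1.
split; first exact: (g_diffx hD).
apply: le_trans (normr_dot_le _ _) _.
have := (gradx_g_lipx hD Yy).2 _ _ Xt Xx.
rewrite (addrC x) addrK enormZ (ger0_norm t0) (addrC _ x).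
rewrite -/(gradx g _ y) -/(gradx g x y).
have := enorm_ge0 (x' - x) => p; move: (enorm (gradx _ _ _ - _)) => q q'.
have := ler_wpM2r p q'; nra.
Qed.

Lemma gphix_lip_y x y y' : X x -> Y y -> Y y' ->
  enorm (gphix x y - gphix x y') <= (Lfx c + Lg2 c) * enorm (y - y').
Proof.
move=> Xx Yy Yy'; rewrite /gphix opprD addrACA; apply: le_trans (enormD _ _) _.
rewrite mulrDl; apply: lerD; last exact: (gradx_g_lipy hD Xx).2.
have := gradx_lip (gradx_f_lip hD) Xx Yy Xx Yy'.
by rewrite subrr enorm_row_0mx.
Qed.

Lemma gphix_lip_x x x' y : X x -> X x' -> Y y ->
  enorm (gphix x y - gphix x' y) <= (Lfx c + Lg1 c) * enorm (x - x').
Proof.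
move=> Xx Xx' Yy; rewrite /gphix opprD addrACA; apply: le_trans (enormD _ _) _.
rewrite mulrDl; apply: lerD; last exact: (gradx_g_lipx hD Yy).2.
have := gradx_lip (gradx_f_lip hD) Xx Yy Xx' Yy.
by rewrite subrr enorm_row_mx0.
Qed.

Lemma phi_smooth_x x x' y : X x -> X x' -> Y y ->
  `|phi x' y - phi x y - dot (gphix x y) (x' - x)|
    <= (Lfx c + Lg1 c) * enorm (x' - x) ^+ 2 / 2.
Proof.
move=> Xx Xx' Yy; have := g_smooth_x Xx Xx' Yy.
have := smooth_x cX cY df (gradx_f_lip hD) Xx Xx' Yy.
by rewrite /vphi /gphix dotDl !ler_norml => /andP[? ?] /andP[? ?]; apply/andP; split; lra.
Qed.

Lemma enorm_sqr_seg d (x v : 'rV[R]_d) (t : R) :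
  enorm (x + t *: v) ^+ 2 =
  (1 - t) * enorm x ^+ 2 + t * enorm (x + v) ^+ 2 - t * (1 - t) * enorm v ^+ 2.
Proof. by rewrite !enorm_sqrD dotZr enormZ exprMn real_normK ?num_real//; ring. Qed.

Lemma phi_weak_convex x x' y y' (t : R) : X x -> X x' -> Y y -> Y y' ->
  0 <= t -> t <= 1 ->
  phi (x + t *: (x' - x)) (y + t *: (y' - y)) <=
    phi x y + t * (phi x' y' - phi x y) +
    t * (1 - t) * ((rhof1 c + rhog1 c) / 2 * enorm (x' - x) ^+ 2 +
                   (rhof2 c + rhog2 c) / 2 * enorm (y' - y) ^+ 2).
Proof.
move=> Xx Xx' Yy Yy' t0 t1; rewrite /vphi.
have [_ _ cf] := f_wconvex hD; have [_ _ cg] := g_wconvex hD.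
have Sz : prodset X Y (row_mx x y) by apply/prodset_row.
have Sz' : prodset X Y (row_mx x' y') by apply/prodset_row.
have := convex_on_seg cf Sz Sz' t0 t1; have := convex_on_seg cg Sz Sz' t0 t1.
rewrite row_mxB scale_row_mx add_row_mx !joint_row.
rewrite !(enorm_sqr_seg _ (_ - _)) !(addrC _ (_ - _)) !subrK.
lra.
Qed.

(* Compare the joint weak convexity of phi along the segment from
   (x, theta_star) to (x', th') with the minimality of theta_star and the
   differentiability in x, and let the segment shrink. *)
Lemma phi_subgrad_theta_star x x' y th' : X x -> X x' -> Y th' ->
  phi x (theta_star x y) + dot (gphix x (theta_star x y)) (x' - x)
    + gamma^-1 * dot (y - theta_star x y) (th' - theta_star x y)
    - (rhof1 c + rhog1 c) / 2 * enorm (x' - x) ^+ 2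
    - (rhof2 c + rhog2 c) / 2 * enorm (th' - theta_star x y) ^+ 2 <= phi x' th'.
Proof.
move=> Xx Xx' Yth' /=; set th := theta_star x y; have [Yth Hth] := theta_starP y
  Xx; rewrite -/th in Yth Hth.
set u := x' - x; set v := th' - th.
suff : phi x th + dot (gphix x th) u + gamma^-1 * dot (y - th) v
   - phi x' th' - (rhof1 c + rhog1 c) / 2 * enorm u ^+ 2
    - (rhof2 c + rhog2 c) / 2 * enorm v ^+ 2 <= 0 by lra.
(* The three remainders are those of the expansion of phi in x, of the change of its x-gradient
   along the segment in theta, and of the proximal term. *)
apply: (@ler_vanishing _ _ _ ((Lfx c + Lg1 c) * enorm u ^+ 2 / 2 +
  (Lfx c + Lg2 c) * enorm v * enorm u + (2 * gamma)^-1 * enorm v ^+ 2)) => t t0 t1.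
have t0' := ltW t0.
have := phi_weak_convex Xx Xx' Yth Yth' t0' t1; rewrite -/u -/v.
have Xt := convex_set_seg cX Xx Xx' t0' t1.
have Yt := convex_set_seg cY Yth Yth' t0' t1; rewrite -/u -/v in Xt Yt.
have := phi_smooth_x Xx Xt Yt; rewrite (addrC x) addrK ler_norml => /andP[+ _].
rewrite (addrC _ x).
have := Hth _ Yt.
have -> : th + t *: v - y = (th - y) + t *: v by rewrite addrAC.
rewrite [enorm (th - y + _) ^+ 2]enorm_sqrD !dotZr !enormZ !exprMn (real_normK
  (num_real t)).
have := gphix_lip_y Xx Yt Yth; rewrite (addrC th (t *: v)) addrK enormZ (ger0_norm t0').
have := dot_geN (gphix x (t *: v + th) - gphix x th) u.
rewrite [dot (gphix _ _ - _) _]dotBl -[y - th]opprB dotNl.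
have := enorm_ge0 u; move: (enorm (gphix _ _ - _)) => w u0 h1 h2 h3 h4 h5.
have h6 := ler_wpM2r u0 h2.
have h7 : dot (gphix x th) u - (Lfx c + Lg2 c) * (t * enorm v) * enorm u <=
  dot (gphix x (t *: v + th)) u by lra.
have h8 := ler_wpM2l t0' h7.
rewrite -(ler_pM2l t0) [gamma^-1](_ : _ = (2 * gamma)^-1 * 2); last first.
  by field; rewrite gt_eqF.
have [r1 r2 _] := f_wconvex hD; have [r3 r4 _] := g_wconvex hD.
have : 0 <= t ^+ 2 * ((rhof1 c + rhog1 c) / 2 * enorm u ^+ 2 +
     (rhof2 c + rhog2 c) / 2 * enorm v ^+ 2).
  by rewrite mulr_ge0 ?sqr_ge0// addr_ge0// mulr_ge0 ?sqr_ge0// divr_ge0 ?addr_ge0.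
move: (dot _ u) (dot _ u) (dot _ v) (enorm u) (enorm v) (phi _ _) (phi _ _)
  (phi _ _) (phi _ _) ((2 * gamma)^-1) (enorm _) h3 h4 h5 h8 {h1 h2 h6 h7 u0 w}.
clear => *; lra.
Qed.

(** With k the modulus of weak convexity in theta, this is the coefficient of |d|^2 needed to
    complete the square in |v - d|^2 / (2 gamma) - k |v|^2 / 2; it is finite because gamma k < 1. *)
Definition env_curv : R :=
  (2 * gamma ^+ 2 * (gamma^-1 - (rhof2 c + rhog2 c)))^-1.

Lemma curv_gap : 0 < gamma^-1 - (rhof2 c + rhog2 c).
Proof. by rewrite subr_gt0 -(ltr_pM2l gamma0) divff// gt_eqF. Qed.

Lemma env_curv_ge0 : 0 <= env_curv.
Proof.
rewrite invr_ge0; apply: mulr_ge0; last exact/ltW/curv_gap.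
by apply: mulr_ge0 => //; exact: sqr_ge0.
Qed.

(** Evaluate the lower bound on phi at the minimizer for (x', y'). The loss from weak convexity in
    theta is absorbed by the proximal term, up to [env_curv] times |y' - y|^2. For y' = y only the
    loss in x remains: v_gamma is weakly convex in x with modulus rho_f1 + rho_g1, which is why
    [rhov1] exceeds this sum. *)
Lemma env_lower x x' y y' : X x -> X x' ->
  env x y + dot (gphix x (theta_star x y)) (x' - x) + dot (gamma^-1 *: (y -
    theta_star x y)) (y' - y)
    - (rhof1 c + rhog1 c) / 2 * enorm (x' - x) ^+ 2
    - env_curv * enorm (y' - y) ^+ 2 <= env x' y'.
Proof.
move=> Xx Xx' /=; set th := theta_star x y; rewrite [env x' y']envelopeE//; set
  th' := theta_star x' y'.
have Yth' : Y th' by exact: theta_starY.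
have := phi_subgrad_theta_star y Xx Xx' Yth'; rewrite -/th envelopeE// -/th.
have -> : th' - y' = (th - y) + ((th' - th) - (y' - y)).
  by apply/rowP => i; rewrite !mxE; ring.
rewrite [enorm (th - y + _) ^+ 2]enorm_sqrD [enorm (_ - _ - (y' - y)) ^+ 2]enorm_sqrB.
rewrite [dot (th - y) (_ - _ - _)]dotBr dotZl -[y - th]opprB !dotNl.
have := dot_le (th' - th) (y' - y).
have := enorm_ge0 (th' - th); have := enorm_ge0 (y' - y).
move: (th' - th) (y' - y) => v d; set k := rhof2 c + rhog2 c.
move: (enorm v) (enorm d) => a b b0 a0 h1 h2.
have : 0 <= (2 * gamma)^-1 * (a ^+ 2 - 2 * (a * b) + b ^+ 2) - k / 2 * a ^+ 2 +
  env_curv * b ^+ 2.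
  have p := curv_gap; rewrite -/k in p.
  have -> : (2 * gamma)^-1 * (a ^+ 2 - 2 * (a * b) + b ^+ 2) - k / 2 * a ^+ 2 +
    env_curv * b ^+ 2 =
    (gamma^-1 - k) / 2 * (a - b / (gamma * (gamma^-1 - k))) ^+ 2 + (2 * gamma)^-1
      * b ^+ 2.
    rewrite /env_curv -/k; have q : gamma^-1 - k != 0 by rewrite gt_eqF.
    have q' : 1 - gamma * k != 0.
      apply: contra_neq q => q; apply: (mulfI (x := gamma)); first by rewrite gt_eqF.
      by rewrite mulr0 mulrBr divff ?gt_eqF.
    by field; rewrite mulNr (mulrC k) q' gt_eqF.
  apply: addr_ge0; apply: mulr_ge0; rewrite ?sqr_ge0//; first by lra.
  exact: ltW g2gt0.
have := ler_wpM2l (ltW g2gt0) h1.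
have E : gamma^-1 = (2 * gamma)^-1 * 2 by field; rewrite gt_eqF.
rewrite E in h2 *; move: h2.
move: (dot v d) (dot _ _) (dot _ _) (dot _ _) (phi _ _) (phi _ _) env_curv
  ((2 * gamma)^-1) (enorm _) (enorm _).
clear => *; lra.
Qed.

(** The infimum at (x', y') is tested with the minimizer for (x, y). *)
Lemma env_upper x x' y y' : X x -> X x' ->
  env x' y' <= env x y + dot (gphix x (theta_star x y)) (x' - x)
    + dot (gamma^-1 *: (y - theta_star x y)) (y' - y)
    + (Lfx c + Lg1 c) / 2 * enorm (x' - x) ^+ 2
    + (2 * gamma)^-1 * enorm (y' - y) ^+ 2.
Proof.
move=> Xx Xx' /=; set th := theta_star x y; have Yth : Y th by exact: theta_starY.
apply: le_trans (envelope_le y' Xx' Yth) _; rewrite envelopeE// -/th.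
have := phi_smooth_x Xx Xx' Yth; rewrite ler_norml => /andP[_].
have -> : th - y' = (th - y) - (y' - y) by apply/rowP => i; rewrite !mxE; ring.
rewrite [enorm (th - y - _) ^+ 2]enorm_sqrB dotZl -[y - th]opprB dotNl.
rewrite [gamma^-1](_ : _ = (2 * gamma)^-1 * 2); last by field; rewrite gt_eqF.
lra.
Qed.

(** In y alone the envelope is convex, because f(x, .) and g(x, .) are; so the y-step loses nothing
    to the curvature of v_gamma. *)
Lemma env_convex_y x y y' : X x ->
  env x y + dot (gamma^-1 *: (y - theta_star x y)) (y' - y) <= env x y'.
Proof.
move=> Xx; rewrite [env x y']envelopeE//; set th' := theta_star x y'.
have Yth' : Y th' by exact: theta_starY.
have [Yth /(_ _ Yth')] := theta_star_subgrad y Xx.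
have := f_subgrad Xx Yth Yth'; rewrite envelopeE// /vphi.
set th := theta_star x y; rewrite dotNl dotDl !dotZl.
have -> : th' - y' = (th - y) + ((th' - th) - (y' - y)).
  by apply/rowP => i; rewrite !mxE; ring.
rewrite [enorm (th - y + _) ^+ 2]enorm_sqrD.
rewrite [dot _ (_ - (y' - y))]dotBr -[y - th]opprB dotNl.
have := mulr_ge0 (ltW g2gt0) (sqr_ge0 (enorm (th' - th - (y' - y)))).
rewrite [gamma^-1](_ : _ = (2 * gamma)^-1 * 2); last by field; rewrite gt_eqF.
lra.
Qed.

Definition env_grad (x : 'rV[R]_n) (y : 'rV[R]_m) : 'rV[R]_(n + m) :=
  row_mx (gphix x (theta_star x y)) (gamma^-1 *: (y - theta_star x y)).

(** The quadratic bounds [env_lower] and [env_upper] have the same linear part, so their common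
    slope is the gradient. *)
Lemma env_is_grad x y : X x ->
  is_grad_within (prodset X [set: 'rV[R]_m]) (joint env) (row_mx x y)
    (env_grad x y).
Proof.
move=> Xx e e0.
pose C := (Lfx c + Lg1 c) / 2 + (2 * gamma)^-1 + (rhof1 c + rhog1 c) / 2 + env_curv + 1.
have a1 : 0 <= Lfx c by case: (gradx_f_lip hD).
have [y0 Yy0] := Y_ne.
have a2 : 0 <= Lg1 c by case: (gradx_g_lipx hD Yy0).
have [a3 a4 _] := f_wconvex hD; have [a5 a6 _] := g_wconvex hD.
have a7 := env_curv_ge0; have a8 := g2gt0.
have C0 : 0 < C by rewrite /C; lra.
near=> z => -[]; rewrite -(hsubmxK z) /joint !row_mxKl !row_mxKr.
set x' := lsubmx z; set y' := rsubmx z => Xx' _.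
rewrite row_mxB dot_row_mx.
have := env_lower y y' Xx Xx'; have := env_upper y y' Xx Xx'.
have E := enorm_row_mx (x' - x) (y' - y).
have hz : enorm (row_mx (x' - x) (y' - y)) < e / C.
  rewrite -row_mxB (_ : row_mx x' y' = z) ?hsubmxK//.
  by near: z; apply: near_enorm; rewrite divr_gt0.
rewrite ltr_pdivlMr// in hz.
have := enorm_ge0 (row_mx (x' - x) (y' - y)).
move: (enorm (row_mx _ _)) hz E => s hz E s0 h1 h2.
have h3 : C * s ^+ 2 <= e * s by nra.
apply: le_trans h3; rewrite E.
have := sqr_ge0 (enorm (x' - x)); have := sqr_ge0 (enorm (y' - y)).
move: (enorm (x' - x) ^+ 2) (enorm (y' - y) ^+ 2) h1 h2 => p q h1 h2 q0 p0.
have P k : 0 <= k -> 0 <= k * p /\ 0 <= k * q by move=> k0; rewrite !mulr_ge0.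
have [? ?] := P _ a1; have [? ?] := P _ a2; have [? ?] := P _ a3.
have [? ?] := P _ a5; have [? ?] := P _ a7; have [? ?] := P _ (ltW a8).
by rewrite /C ler_norml; apply/andP; split; lra.
Unshelve. all: by end_near. Qed.

End Envelope.

(** * Summable sequences *)

Section SmallTails.
Context {R : realType}.
Implicit Types a b : nat -> R.

(** For nonnegative sequences this is summability, in Cauchy form: bounds on blocks K <= k < J
    starting late are what the length estimates consume. *)
Definition small_tails a : Prop := forall mu : R, 0 < mu ->
  exists K0, forall K J, (K0 <= K)%N -> \sum_(K <= k < J) a k <= mu.

Lemma sumr_nat_ge0 a K J : (forall k, 0 <= a k) -> 0 <= \sum_(K <= k < J) a k.
Proof. by move=> a0; apply: sumr_ge0 => k _. Qed.

Lemma sumr_nat_widen a K K' J J' : (forall k, 0 <= a k) ->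
  (K' <= K)%N -> (J <= J')%N ->
  \sum_(K <= k < J) a k <= \sum_(K' <= k < J') a k.
Proof.
move=> a0 KK JJ; have [KJ|JK] := leqP K J; last first.
  by rewrite big_geq ?sumr_nat_ge0// ltnW.
rewrite (big_cat_nat KK (leq_trans KJ JJ))/= (big_cat_nat KJ JJ)/=.
by rewrite addrCA lerDl addr_ge0// sumr_nat_ge0.
Qed.

Lemma bounded_small_tails a (M : R) : (forall k, 0 <= a k) ->
  (forall N, \sum_(0 <= k < N) a k <= M) -> small_tails a.
Proof.
move=> a0 aM mu mu0.
pose S N := \sum_(0 <= k < N) a k.
have nS : nondecreasing_seq S.
  by move=> i j ij; apply: sumr_nat_widen.
have cS : cvgn S.
  by apply: nondecreasing_is_cvgn => //; exists M => _ [N _ <-]; exact: aM.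
have [K0 _ HK] : \forall K \near \oo, limn S - mu < S K.
  by move/cvgrPdist_lt : cS => /(_ _ mu0); apply: filterS => K; rewrite ltr_norml; lra.
exists K0 => K J KK; have [KJ|JK] := leqP K J; last first.
  by rewrite big_geq ?ltW// ltnW.
have := HK K KK; have := nondecreasing_cvgn_le nS cS J.
rewrite /S (big_cat_nat (leq0n K) KJ)/=; lra.
Qed.

Lemma small_tails_bounded a : (forall k, 0 <= a k) -> small_tails a ->
  exists M : R, forall N, \sum_(0 <= k < N) a k <= M.
Proof.
move=> a0 /(_ 1 ltr01)[K0 H]; exists (\sum_(0 <= k < K0) a k + 1) => N.
apply: le_trans (sumr_nat_widen a0 (leqnn 0) (leq_maxl N K0)) _.
by rewrite (big_cat_nat (leq0n K0) (leq_maxr N K0))/= lerD2l H.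
Qed.

Lemma small_tails_le a b (C : R) : (forall k, 0 <= a k) -> (forall k, 0 <= b k)
  -> 0 <= C ->
  (exists K0, forall k, (K0 <= k)%N -> a k <= C * b k) ->
  small_tails b -> small_tails a.
Proof.
move=> a0 b0 C0 [K0 H] bt mu mu0.
have C1 : 0 < C + 1 by lra.
have [K1 H1] := bt (mu / (C + 1)) (divr_gt0 mu0 C1).
exists (maxn K0 K1) => K J; rewrite geq_max => /andP[K0K K1K].
apply: (@le_trans _ _ (\sum_(K <= k < J) (C * b k))).
  by apply: ler_sum_nat => k /andP[Kk _]; apply: H; exact: leq_trans Kk.
rewrite -mulr_sumr; have := H1 K J K1K; rewrite ler_pdivlMr//.
have := sumr_nat_ge0 K J b0; nra.
Qed.

Lemma small_tails_cvg0 a : (forall k, 0 <= a k) -> small_tails a ->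
  a @ \oo --> (0 : R).
Proof.
move=> a0 at_; apply/cvgrPdist_le => e e0; have [K0 H] := at_ e e0.
exists K0 => // k /= K0k; rewrite sub0r normrN ger0_norm//.
by have := H k k.+1 K0k; rewrite big_nat1.
Qed.

(** Sum the recursion. In [step] the last term is counted twice on the left: this spare copy pays
    for the halved term at the next index and closes the induction. *)
Lemma small_tails_contraction a b : (forall k, 0 <= a k) -> (forall k, 0 <= b k) ->
  (exists K0, forall k, (K0 <= k)%N -> a k.+1 <= b k.+1 + 2^-1 * a k) ->
  small_tails b -> small_tails a.
Proof.
move=> a0 b0 [K H] /(small_tails_bounded b0)[M HM].
have step i : \sum_(K <= k < K + i.+1) a k + a (K + i)%N <=
    2 * a K + 2 * \sum_(K.+1 <= k < K + i.+1) b k.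
  elim: i => [|i IH].
    rewrite addn1 big_nat1 addn0 big_geq//; lra.
  have e1 : (K.+1 <= K + i.+1)%N by rewrite addnS ltnS leq_addr.
  rewrite [(K + i.+2)%N]addnS (big_nat_recr _ _ _ e1)/=.
  rewrite (big_nat_recr _ _ _ (leq_addr i.+1 K))/=.
  have := H (K + i)%N (leq_addr _ _); rewrite -addnS; lra.
apply: (@bounded_small_tails _ (\sum_(0 <= k < K) a k + 2 * a K + 2 * M)) => // N.
apply: (le_trans (sumr_nat_widen a0 (leqnn 0) (_ : N <= K + N.+1)%N)).
  by rewrite addnS ltnW// ltnS leq_addl.
rewrite (big_cat_nat (leq0n K) (leq_addr _ _))/=.
have := step N; have := a0 (K + N)%N; have := HM (K + N.+1)%N.
have := sumr_nat_widen b0 (leq0n K.+1) (leqnn (K + N.+1)); lra.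
Qed.

Lemma small_tails_shift a K : small_tails a -> small_tails (fun k => a (k + K)%N).
Proof.
move=> at_ mu mu0; have [K0 H] := at_ mu mu0; exists K0 => K1 J1 K01.
have := H (K1 + K)%N (J1 + K)%N (leq_trans K01 (leq_addr _ _)).
by rewrite big_addn addnK.
Qed.

Lemma eseries_small_tails a m : (forall k, 0 <= a k) ->
  (\sum_(m <= k <oo) (a k)%:E < +oo)%E -> small_tails a.
Proof.
move=> a0 fin.
have f : (\sum_(m <= k <oo) (a k)%:E)%E \is a fin_num.
  by rewrite ge0_fin_numE// nneseries_ge0// => k _ _; rewrite lee_fin.
apply: (@bounded_small_tails _ (\sum_(0 <= k < m) a k + fine (\sum_(m <= k <oo)
  (a k)%:E)%E)) => // N.
apply: (le_trans (sumr_nat_widen a0 (leqnn 0) (leq_maxr m N))).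
rewrite (big_cat_nat (leq0n m) (leq_maxl m N))/= lerD2l -lee_fin fineK// -sumEFin.
by apply: nneseries_lim_ge => k _ _; rewrite lee_fin.
Qed.

End SmallTails.

(** * Power weights and dyadic blocks *)

Section PowerWeights.
Context {R : realType}.
Variable eta : R.
Hypothesis eta0 : 0 < eta.

(** The reciprocal of the threshold t_k. *)
Definition pweight (k : nat) : R := k.+1%:R `^ (1 + eta).

Lemma pweight_gt0 k : 0 < pweight k.
Proof. by rewrite powR_gt0// ltr0n. Qed.

Lemma pweight_le k l : (k <= l)%N -> pweight k <= pweight l.
Proof.
move=> kl; apply: ge0_ler_powR; rewrite ?nnegrE ?ler0n ?ler_nat//.
by rewrite addr_ge0// ltW.
Qed.

Lemma pweight_ge k : k.+1%:R <= pweight k.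
Proof.
rewrite -[leLHS]powRr1 ?ler0n//; apply: ler_powR; first by rewrite ler1n.
by rewrite lerDl ltW.
Qed.

Lemma geometric_sum_le (r : R) N : 0 <= r -> r < 1 ->
  \sum_(0 <= i < N) r ^+ i <= (1 - r)^-1.
Proof.
move=> r0 r1; have q : 0 < 1 - r by rewrite subr_gt0.
have E : (1 - r) * \sum_(0 <= i < N) r ^+ i = 1 - r ^+ N.
  elim: N => [|N IH]; first by rewrite big_geq// mulr0 expr0 subrr.
  by rewrite big_nat_recr//= mulrDr IH exprS; ring.
by rewrite -(ler_pM2l q) E divff ?gt_eqF// gerBl exprn_ge0.
Qed.

(* On the dyadic block [2^i, 2^(i+1)), Young's inequality with parameter
   2^i q^i, where q = 2^(eta/2), bounds the sum of a by a multiple of q^-i. *)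
Lemma small_tails_sqr_tails (a : nat -> R) (C : R) (K : nat) :
  (forall k, 0 <= a k) -> 0 <= C ->
  (forall k J, (K <= k)%N -> \sum_(k <= j < J) a j ^+ 2 <= C / pweight k) ->
  small_tails a.
Proof.
move=> a0 C0 H.
pose q : R := 2 `^ (eta / 2).
have q1 : 1 < q.
  have e2 : 0 < eta / 2 by rewrite divr_gt0.
  have := gt0_ltr_powR e2 (_ : 1 \is Num.nneg) (_ : 2 \is Num.nneg).
  by rewrite powR1 !nnegrE ler01 ler0n ltr1n; apply.
have q0 : 0 < q by apply: lt_trans q1.
pose r := q^-1.
have r0 : 0 < r by rewrite invr_gt0.
have r1 : r < 1 by rewrite invf_lt1.
(* The left side is (2^i)^(1+eta), since q^2 = 2^eta. *)
have W2 i : 2 ^+ i * q ^+ i * q ^+ i <= pweight (2 ^ i).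
  have -> : 2 ^+ i * q ^+ i * q ^+ i = (2 ^+ i : R) `^ (1 + eta).
    rewrite /q -!powR_mulrn// ?powR_ge0//.
    rewrite -!powRrM -!powRD; [|by rewrite pnatr_eq0 implybT..].
    by congr (_ `^ _); field.
  apply: ge0_ler_powR; rewrite ?nnegrE ?exprn_ge0 ?ler0n//.
    by rewrite addr_ge0// ltW.
  by rewrite -natrX ler_nat.
(* Each term satisfies a_j <= l a_j^2 + 1/l. The block has 2^i terms, so the second parts add up to
   q^-i, and by [W2] the first parts are at most C q^-i. *)
have block i : (K <= 2 ^ i)%N ->
    \sum_(2 ^ i <= j < 2 ^ i.+1) a j <= (C + 1) * r ^+ i.
  move=> Ki; pose l : R := 2 ^+ i * q ^+ i.
  have l0 : 0 < l by rewrite mulr_gt0// exprn_gt0.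
  apply: (@le_trans _ _ (\sum_(2 ^ i <= j < 2 ^ i.+1) (l * a j ^+ 2 + l^-1))).
    apply: ler_sum => j _; have h := sqr_ge0 (l * a j - 1).
    rewrite -(ler_pM2l l0) mulrDr divff ?gt_eqF//.
    have := mulr_ge0 (ltW l0) (a0 j); nra.
  rewrite big_split/= -mulr_sumr sumr_const_nat expnS mul2n -addnn addnK.
  rewrite mulrDl mul1r; apply: lerD.
    apply: (@le_trans _ _ (l * (C / pweight (2 ^ i)))).
      by apply: ler_wpM2l; [exact: ltW|exact: H].
    rewrite mulrCA ler_wpM2l// ler_pdivrMr ?pweight_gt0//.
    rewrite exprVn ler_pdivlMl ?exprn_gt0// mulrC; exact: W2.
  rewrite -[leLHS]mulr_natl natrX /l invfM mulrA divff.
    by rewrite mul1r exprVn.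
  by rewrite expf_neq0// pnatr_eq0.
have [i0 Ki0] : exists i0, (K <= 2 ^ i0)%N by exists K; exact: ltnW (ltn_expl _ _).
have bsum I : \sum_(2 ^ i0 <= j < 2 ^ (i0 + I)) a j <=
    (C + 1) * \sum_(0 <= i < I) r ^+ i.
  elim: I => [|I IH]; first by rewrite addn0 !big_geq// mulr0.
  have e1 : (2 ^ i0 <= 2 ^ (i0 + I))%N by rewrite leq_exp2l// leq_addr.
  have e2 : (2 ^ (i0 + I) <= 2 ^ (i0 + I.+1))%N by rewrite leq_exp2l// leq_add2l.
  rewrite (big_cat_nat e1 e2)/= big_nat_recr//= mulrDr; apply: lerD => //.
  rewrite addnS; apply: le_trans (block _ _) _.
    by apply: leq_trans Ki0 _; rewrite leq_exp2l// leq_addr.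
  rewrite ler_wpM2l ?addr_ge0// addnC exprD.
  have [r0' r1'] := (ltW r0, ltW r1).
  by apply: ler_piMr; [exact: exprn_ge0|exact: exprn_ile1].
apply: (@bounded_small_tails _ _ (\sum_(0 <= j < 2 ^ i0) a j + (C + 1) * (1 -
  r)^-1)) => // N.
have e1 : (2 ^ i0 <= 2 ^ (i0 + N))%N by rewrite leq_exp2l// leq_addr.
apply: (le_trans (sumr_nat_widen a0 (leqnn 0) (_ : N <= 2 ^ (i0 + N)))%N).
  by apply: leq_trans (ltnW (ltn_expl N (ltnSn 1))) _; rewrite leq_exp2l// leq_addl.
rewrite (big_cat_nat (leq0n _) e1)/= lerD2l; apply: le_trans (bsum N) _.
by rewrite ler_wpM2l ?addr_ge0// geometric_sum_le// ltW.
Qed.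

End PowerWeights.

(** * Finite length from the KL inequality *)

Section Desingularizing.
Context {R : realType}.
Variables (zeta : \bar R) (psi : R -> R).
Hypothesis zeta0 : (0 < zeta)%E.
Hypothesis psiP : Phi zeta psi.

(** A concave function lies below its tangent: by convexity of -psi the difference quotient from s
    towards t is at least psi t - psi s, and it tends to the directional derivative. The endpoint t
    = 0 is included. *)
Lemma Phi_tangent (s t : R) : 0 < s -> (s%:E < zeta)%E -> 0 <= t ->
  (t%:E < zeta)%E -> psi t <= psi s + derive1 psi s * (t - s).
Proof.
move=> s0 sz t0 tz; have [cpsi _ _ [dpsi _] _] := psiP.
have ds : derivable psi s 1 by apply: dpsi.
have dif : differentiable psi s by apply/derivable1_diffP.
have dv : derivable psi s (t - s) by exact: diff_derivable.
have E : 'D_(t - s) psi s = derive1 psi s * (t - s).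
  by rewrite deriveE// diff1E// mulrC.
rewrite -E -lerBlDl.
have lim : (fun h : R => h^-1 *: (psi (h *: (t - s) + s) - psi s)) @ 0^'+ -->
  'D_(t - s) psi s.
  by apply: cvg_dnbhs_at_right; exact: dv.
apply: (cvgr_to_ge lim); near=> h.
have h0 : 0 < h by near: h; exact: nbhs_right_gt.
have h1 : h <= 1 by near: h; exact: nbhs_right_le.
rewrite -[_ *: _]/(_ * _) ler_pdivlMl//.
have := cpsi (Itv01 (ltW h0) h1) t s; rewrite !inE => /(_ _ _)/= H.
have := H (conj t0 tz) (conj (ltW s0) sz); rewrite convRE/= /conv/= /unstable.onem.
rewrite -[h *: t]/(h * t) -[(1 - h) *: s]/((1 - h) * s).
rewrite (_ : h * t + (1 - h) * s = h *: (t - s) + s); first by lra.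
by rewrite -[_ *: _]/(_ * _); ring.
Unshelve. all: by end_near. Qed.

(** The tangent at s, evaluated at 0. This bounds psi' at the threshold, hence the cost of the
    errors. *)
Lemma Phi_derive_le (s : R) : 0 < s -> (s%:E < zeta)%E ->
  derive1 psi s * s <= psi s.
Proof.
move=> s0 sz; have := Phi_tangent s0 sz (lexx 0) zeta0.
by have [_ _ [-> _] _ _] := psiP; lra.
Qed.

Lemma Phi_small (mu : R) : 0 < mu -> exists2 r : R, 0 < r & forall t, 0 <= t ->
  t < r -> (t%:E < zeta)%E /\ psi t <= mu.
Proof.
move=> mu0; have [_ cpsi [psi0 _] _ _] := psiP.
have [r1 r10 Hr1] : exists2 r1 : R, 0 < r1 & (r1%:E <= zeta)%E.
  move: zeta0; case: (zeta) => [z|_|//]; last by exists 1; rewrite ?leey.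
  by rewrite lte_fin => z0; exists z.
move/subspace_continuousP : cpsi => /(_ 0) cpsi.
have I0 : [set t : R | 0 <= t /\ (t%:E < zeta)%E] 0 by split.
have := cpsi I0; rewrite [X in _ --> X]psi0 => /cvgrPdist_le/(_ mu mu0).
rewrite /prop_near1 /within/= => /nbhs_ballP[r2 /= r20 Hr2].
exists (Num.min r1 r2); first by rewrite lt_min r10.
move=> t t0; rewrite lt_min => /andP[t1 t2].
have tz : (t%:E < zeta)%E by apply: lt_le_trans Hr1; rewrite lte_fin.
split=> //; have := Hr2 t; rewrite /ball/= sub0r normrN ger0_norm// => /(_ t2
  (conj t0 tz)).
by rewrite sub0r normrN; apply: le_trans; exact: ler_norm.
Qed.

End Desingularizing.

Section FiniteLength.
Context {R : realType}.
Variables (zeta : \bar R) (psi : R -> R) (a C eta : R) (del Del err : nat -> R).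
Hypothesis zeta0 : (0 < zeta)%E.
Hypothesis psiP : Phi zeta psi.
Hypothesis a0 : 0 < a.
Hypothesis C0 : 0 <= C.
Hypothesis eta0 : 0 < eta.
Hypothesis Del0 : forall k, 0 <= Del k.
Hypothesis err0 : forall k, 0 <= err k.
Hypothesis descent : forall k, del k.+1 + a * Del k ^+ 2 <= del k + err k ^+ 2.
Hypothesis del_cvg : del @ \oo --> (0 : R).
Hypothesis err_tails : small_tails err.
Hypothesis werr_tails : small_tails (fun k => pweight eta k * err k ^+ 2).

Let W := pweight eta.
Let thr k := (W k)^-1.

Let W0 k : 0 < W k. Proof. exact: pweight_gt0. Qed.

Let thr0 k : 0 < thr k. Proof. by rewrite invr_gt0. Qed.

Let thr_le k l : (k <= l)%N -> thr l <= thr k.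
Proof. by move=> kl; rewrite lef_pV2 ?posrE ?W0// pweight_le. Qed.

Let err_thr : exists K0, forall k J, (K0 <= k)%N ->
  \sum_(k <= i < J) err i ^+ 2 <= thr k.
Proof.
have [K0 H] := werr_tails ltr01; exists K0 => k J Kk.
rewrite -(ler_pM2l (W0 k)) divff ?gt_eqF//; apply: le_trans (H k J Kk).
rewrite mulr_sumr; apply: ler_sum_nat => i /andP[ki _].
by rewrite ler_wpM2r ?sqr_ge0// pweight_le.
Qed.

Let descent_sum k J : (k <= J)%N ->
  del J + a * \sum_(k <= i < J) Del i ^+ 2 <= del k + \sum_(k <= i < J) err i ^+ 2.
Proof.
elim: J => [|J IH]; first by rewrite leqn0 => /eqP->; rewrite !big_geq// mulr0.
rewrite leq_eqVlt => /orP[/eqP->|]; first by rewrite !big_geq// mulr0.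
rewrite ltnS => kJ; rewrite !big_nat_recr//=; have := IH kJ; have := descent J; lra.
Qed.

(** Sum the descent up to an index beyond J where [del] exceeds -e, then let e tend to 0; [del]
    itself may be negative. *)
Let tail_bound : exists K0, forall k J, (K0 <= k)%N ->
  a * \sum_(k <= i < J) Del i ^+ 2 <= del k + thr k.
Proof.
have [K0 H] := err_thr; exists K0 => k J Kk.
apply/ler_addgt0Pr => e e0.
have [N _ HN] : \forall j \near \oo, - e < del j.
  by move/cvgrPdist_lt : del_cvg => /(_ _ e0); apply: filterS => j; rewrite sub0r
    normrN ltr_norml => /andP[].
pose j := maxn (maxn J k) N.
have := descent_sum (leq_trans (leq_maxr J k) (leq_maxl _ N)).
have := H k j Kk; have := HN j (leq_maxr _ _).
have : \sum_(k <= i < J) Del i ^+ 2 <= \sum_(k <= i < j) Del i ^+ 2.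
  apply: sumr_nat_widen => // [i|]; first exact: sqr_ge0.
  by apply: leq_trans (leq_maxl _ N); exact: leq_maxl.
by move=> /(ler_wpM2l (ltW a0)); rewrite -/j; lra.
Qed.

(* Lengths of the steps at which the KL inequality is not used: there del is
   dominated by the threshold, and the tails of Del ^+ 2 by tail_bound. *)
Let low k : R := if del k <= 2 * thr k then Del k else 0.

Let low_ge0 k : 0 <= low k.
Proof. by rewrite /low; case: ifP. Qed.

(** A bound 3 t_k / a on the squared tails, by induction on J - k. If [del k] is below twice the
    threshold, [tail_bound] gives it directly; otherwise the term at k is zero and the bound at k +
    1 is smaller, as the thresholds decrease. *)
Let low_tails : small_tails low.
Proof.
have [K0 H] := tail_bound.
apply: (@small_tails_sqr_tails _ eta eta0 low (3 / a) K0) => //.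
  by apply: divr_ge0 => //; exact: ltW.
have cw k : 0 <= 3 / a / W k.
  by apply: divr_ge0; [apply: divr_ge0 => //|]; exact: ltW.
rewrite -/W => k J Kk; have [kJ|Jk] := leqP k J; last first.
  by rewrite big_geq// ltnW.
move: Kk; rewrite -(subKn kJ); move: (J - k)%N (leq_subr k J) => d.
elim: d => [|d IH] dJ Kk.
  by rewrite subn0 big_geq.
have e : (J - d.+1).+1 = (J - d)%N by rewrite subnSK.
have lt : (J - d.+1 < J)%N by rewrite ltn_subrL/=; apply: leq_trans dJ.
have [lo|hi] := leP (del (J - d.+1)%N) (2 * thr (J - d.+1)%N).
  apply: (@le_trans _ _ (\sum_(J - d.+1 <= i < J) Del i ^+ 2)).
    apply: ler_sum => i _; rewrite /low; case: ifP => // _.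
    by rewrite expr0n/= sqr_ge0.
  have := H _ J Kk; rewrite -ler_pdivlMl// => h; apply: le_trans h _.
  rewrite (_ : 3 / a / _ = a^-1 * (3 * thr (J - d.+1)%N)); last first.
    by rewrite mulrA (mulrC a^-1).
  by rewrite ler_pM2l ?invr_gt0//; lra.
have lo0 : low (J - d.+1)%N = 0 by rewrite /low leNgt hi.
rewrite big_ltn// e lo0 expr0n/= add0r.
apply: le_trans (IH (ltnW dJ) _) _.
  by apply: leq_trans Kk _; rewrite leq_sub2l.
apply: ler_wpM2l; first by apply: divr_ge0 => //; exact: ltW.
by apply: thr_le; rewrite leq_sub2l.
Qed.

(** Always positive and eventually below zeta, so psi' is available at every late index, whatever
    the sign of [del]. *)
Let b k := Num.max (del k) (thr k).

Let b_gt0 k : 0 < b k.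
Proof. by rewrite lt_max thr0 orbT. Qed.

Let thr_cvg : thr @ \oo --> (0 : R).
Proof.
apply: (squeeze_cvgr _ (cvg_cst 0) cvg_harmonic); near=> k.
by rewrite ltW ?thr0//= lef_pV2 ?posrE ?W0 ?ltr0n// pweight_ge.
Unshelve. all: by end_near. Qed.

Let b_small (r : R) : 0 < r -> exists K0, forall k, (K0 <= k)%N -> b k < r.
Proof.
move=> r0; have [N _ HN] : \forall k \near \oo, b k < r.
  near=> k; rewrite gt_max; apply/andP; split; near: k.
    by move/cvgrPdist_lt : del_cvg => /(_ _ r0); apply: filterS => j; rewrite
      sub0r normrN ltr_norml => /andP[].
  by move/cvgrPdist_lt : thr_cvg => /(_ _ r0); apply: filterS => j; rewrite sub0r
    normrN ltr_norml => /andP[].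
by exists N.
Unshelve. all: by end_near. Qed.

Let b_incr k : b k.+1 <= b k + err k ^+ 2.
Proof.
rewrite ge_max; apply/andP; split.
  have : del k <= b k by rewrite le_max lexx.
  have := descent k; have := mulr_ge0 (ltW a0) (sqr_ge0 (Del k)); lra.
have : thr k <= b k by rewrite le_max lexx orbT.
have := thr_le (leqnSn k); have := sqr_ge0 (err k); lra.
Qed.

(** If [del] stays above the threshold, this is the descent. If it falls below, b drops by at least
    [del k] - t_k, more than half of [del k], while [tail_bound] gives a |Del k|^2 <= 3/2 [del k];
    hence the factor 1/4. *)
Let b_decr : exists K0, forall k, (K0 <= k)%N -> 2 * thr k < del k ->
  b k = del k /\ a / 4 * Del k ^+ 2 <= b k - b k.+1 + err k ^+ 2.
Proof.
have [K0 H] := tail_bound; exists K0 => k Kk hi.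
have bk : b k = del k by apply/max_idPl; have := thr0 k; lra.
split=> //; rewrite bk /b.
have A := mulr_ge0 (ltW a0) (sqr_ge0 (Del k)).
have [lt|ge] := ltP (del k.+1) (thr k.+1); last by have := descent k; lra.
have := H k k.+1 Kk; rewrite big_nat1; have := thr_le (leqnSn k).
have := sqr_ge0 (err k); lra.
Qed.

(** The KL inequality is required at indices up to J - 1 only, while the sum includes the step
    leaving index J - 1. This offset makes it possible to prove by induction that the iterates stay
    where the KL inequality holds. *)
Lemma KL_finite_length (mu : R) : 0 < mu -> exists K0, forall K J, (K0 <= K)%N ->
  (forall k, (K <= k)%N -> (k.+1 < J)%N -> 0 < del k.+1 ->
    ((del k.+1)%:E < zeta)%E ->
    1 <= derive1 psi (del k.+1) * (C * (Del k + err k))) ->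
  \sum_(K <= k < J) Del k <= mu.
Proof.
move=> mu0.
have [r1 r10 Hr1] := Phi_small zeta0 psiP ltr01.
(* The final estimate collects 2 nu from the first step, nu from the errors, 2 nu from [low], and 4
   (C / a) times 2 nu from psi and the weighted errors. *)
pose nu := mu / (8 * (C / a) + 5).
have den : 0 < 8 * (C / a) + 5 by have := divr_ge0 C0 (ltW a0); lra.
have nu0 : 0 < nu by rewrite divr_gt0.
have [r2 r20 Hr2] := Phi_small zeta0 psiP nu0.
have [K1 HK1] := b_small r10; have [K2 HK2] := b_small r20.
have [K3 HK3] := b_decr; have [K4 HK4] := err_tails nu0.
have [K5 HK5] := werr_tails nu0; have [K6 HK6] := low_tails nu0.
have [K7 HK7] := tail_bound.
(* This makes the first step at most nu: a |Del K|^2 <= del K + thr K <= 2 b K. *)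
have [K8 HK8] : exists K0, forall k, (K0 <= k)%N -> b k < a * nu ^+ 2 / 2.
  by apply: b_small; rewrite divr_gt0// mulr_gt0// exprn_gt0.
exists (maxn K1 (maxn K2 (maxn K3 (maxn K4 (maxn K5 (maxn K6 (maxn K7 K8))))))) => K J.
rewrite !geq_max => /andP[k1 /andP[k2 /andP[k3 /andP[k4 /andP[k5 /andP[k6
  /andP[k7 k8]]]]]]] HKL.
have bz k : (K <= k)%N -> ((b k)%:E < zeta)%E.
  by move=> Kk; have [] := Hr1 (b k) (ltW (b_gt0 k)) (HK1 _ (leq_trans k1 Kk)).
have psi_ge0 k : (K <= k)%N -> 0 <= psi (b k).
  by move=> Kk; have [_ _ [_ H] _ _] := psiP; apply: H; split; [exact: ltW|exact: bz].
have dpsi_gt0 k : (K <= k)%N -> 0 < derive1 psi (b k).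
  by move=> Kk; have [_ _ _ _ H] := psiP; apply: H; split; [exact: b_gt0|exact: bz].
(* psi'(b) t_k <= psi'(b) b <= psi(b) <= 1, so a squared error costs at most its weight. *)
have dpsi_le k : (K <= k)%N -> derive1 psi (b k) * err k ^+ 2 <= W k * err k ^+ 2.
  move=> Kk; apply: ler_wpM2r; first exact: sqr_ge0.
  have h1 := Phi_derive_le zeta0 psiP (b_gt0 k) (bz _ Kk).
  have [_ h2] := Hr1 (b k) (ltW (b_gt0 k)) (HK1 _ (leq_trans k1 Kk)).
  have h3 : derive1 psi (b k) * thr k <= 1.
    apply: le_trans h2; apply: le_trans h1; apply: ler_wpM2l.
      exact: ltW (dpsi_gt0 _ Kk).
    by rewrite le_max lexx orbT.
  by move: h3; rewrite ler_pdivrMr// mul1r.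
(* The decrease of psi, with the cost of the error added so that it is nonnegative. *)
pose q k := psi (b k) - psi (b k.+1) + W k * err k ^+ 2.
have tang k : (K <= k)%N -> derive1 psi (b k) * (b k - b k.+1 + err k ^+ 2) <= q k.
  move=> Kk; have := Phi_tangent psiP (b_gt0 k) (bz _ Kk) (ltW (b_gt0 k.+1)) (bz
    _ (leqW Kk)).
  by have := dpsi_le _ Kk; rewrite /q; lra.
have q0 k : (K <= k)%N -> 0 <= q k.
  move=> Kk; apply: le_trans (tang _ Kk); apply: mulr_ge0.
    exact: ltW (dpsi_gt0 _ Kk).
  by have := b_incr k; lra.
(* The KL inequality multiplied by the decrease of b gives |Del (k+1)|^2 <= 4 (C / a) s q with s =
   Del k + err k; the geometric mean is then bounded by the arithmetic mean. The term [low] covers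
   the indices without KL. *)
have step k : (K <= k)%N -> (k.+1 < J)%N ->
    2 * Del k.+1 <= Del k + err k + 4 * (C / a) * q k.+1 + 2 * low k.+1.
  move=> Kk kJ; have Kk1 := leqW Kk.
  have s0 : 0 <= Del k + err k by rewrite addr_ge0.
  have Ca : 0 <= C / a by exact: divr_ge0 C0 (ltW a0).
  have [lo|hi] := leP (del k.+1) (2 * thr k.+1).
    rewrite /low lo; have := mulr_ge0 (mulr_ge0 (ler0n R 4) Ca) (q0 _ Kk1); lra.
  have -> : low k.+1 = 0 by rewrite /low leNgt hi.
  have [bd dec] := HK3 _ (leq_trans k3 Kk1) hi.
  have d0 : 0 < del k.+1 by have := thr0 k.+1; lra.
  have := HKL k Kk kJ d0; rewrite -bd => /(_ (bz _ Kk1)) KL.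
  have := tang _ Kk1 => t1.
  have p0 := dpsi_gt0 _ Kk1.
  have t2 : derive1 psi (b k.+1) * (a / 4 * Del k.+1 ^+ 2) <= q k.+1.
    by apply: le_trans t1; apply: ler_wpM2l; [exact: ltW|].
  have e0 : 0 <= a / 4 * Del k.+1 ^+ 2 by rewrite mulr_ge0 ?sqr_ge0// divr_ge0// ltW.
  have t3 : a / 4 * Del k.+1 ^+ 2 <= C * (Del k + err k) * q k.+1.
    apply: (@le_trans _ _ (a / 4 * Del k.+1 ^+ 2 * (derive1 psi (b k.+1) * (C *
      (Del k + err k))))).
      by rewrite ler_peMr.
    rewrite mulrA mulrC ler_wpM2l// ?mulr_ge0// mulrC//.
  set s := Del k + err k in s0 t3 *.
  have t4 : Del k.+1 ^+ 2 <= 4 * (C / a) * s * q k.+1.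
    rewrite -(ler_pM2l (_ : 0 < a / 4)) ?divr_gt0//.
    have -> : a / 4 * (4 * (C / a) * s * q k.+1) = C * s * q k.+1.
      by field; rewrite gt_eqF.
    exact: t3.
  have x0 : 0 <= s + 4 * (C / a) * q k.+1 
    by apply: addr_ge0 => //; apply: mulr_ge0; [apply: mulr_ge0|exact: q0].
  rewrite mulr0 addr0 -(ler_pXn2r (n := 2)) ?nnegrE ?mulr_ge0//.
  have := sqr_ge0 (s - 4 * (C / a) * q k.+1); nra.
(* The extra copy of the last step on the left closes the induction, as in
   [small_tails_contraction]. *)
have tele i : (K + i < J)%N ->
    \sum_(K <= k < K + i.+1) Del k + Del (K + i)%N <=
    2 * Del K + \sum_(K <= k < K + i) err k +
    4 * (C / a) * (psi (b K.+1) - psi (b (K + i.+1)%N) +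
      \sum_(K.+1 <= k < K + i.+1) (W k * err k ^+ 2)) +
    2 * \sum_(K.+1 <= k < K + i.+1) low k.
  elim: i => [|i IH].
    rewrite addn1 addn0 big_nat1 !big_geq// => _; lra.
  move=> iJ; have iJ' : (K + i < J)%N by apply: ltn_trans iJ; rewrite addnS.
  have e1 : (K.+1 <= K + i.+1)%N by rewrite addnS ltnS leq_addr.
  have e2 : (K + i.+2)%N = (K + i.+1).+1 by rewrite addnS.
  have e3 : (K + i.+1)%N = (K + i).+1 by rewrite addnS.
  have e4 : (K <= K + i)%N by exact: leq_addr.
  have := IH iJ'; have := step _ e4; rewrite -e3 => /(_ iJ).
  rewrite e2 (big_nat_recr _ _ _ (leq_trans (leqnSn K) e1))/=.
  rewrite 2!(big_nat_recr _ _ _ e1)/=.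
  have -> : \sum_(K <= k < K + i.+1) err k = \sum_(K <= k < K + i) err k + err (K + i)%N.
    by rewrite e3 (big_nat_recr _ _ _ e4).
  rewrite /q -e2.
  have := divr_ge0 C0 (ltW a0).
  move: (C / a) (q (K + i)%N) => Ca _ {tang q0}.
  move: (psi _) (psi _) (psi _) (W _) => ? ? ? ? ; lra.
have [JK|KJ] := leqP J K; first by rewrite big_geq// ltW.
have DK : Del K <= nu.
  rewrite -(ler_pXn2r (n := 2)) ?nnegrE//; last exact: ltW.
  rewrite -(ler_pM2l a0).
  have := HK7 K K.+1 k7; rewrite big_nat1.
  have : del K <= b K by rewrite le_max lexx.
  have : thr K <= b K by rewrite le_max lexx orbT.
  have := HK8 _ k8; lra.
have [i Ei] : exists i, J = (K + i.+1)%N.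
  by exists (J - K.+1)%N; rewrite addnS -addSn subnKC.
have := tele i; rewrite Ei addnS ltnSn => /(_ isT); rewrite -addnS -Ei.
have := HK4 K (K + i)%N k4; have := HK5 K.+1 J (leqW k5); have := HK6 K.+1 J (leqW k6).
have [_] := Hr2 (b K.+1) (ltW (b_gt0 _)) (HK2 _ (leqW k2)).
have := psi_ge0 J (ltnW KJ); have := Del0 (K + i)%N.
have Ca : 0 <= C / a by exact: divr_ge0 C0 (ltW a0).
rewrite -/W; move: (\sum_(K.+1 <= k < J) (W k * _)) (\sum_(K.+1 <= k < J) low k) => s1 s2.
move=> x1 x2 x3 x4 x5 x6 x7.
have y1 : psi (b K.+1) - psi (b J) + s1 <= 2 * nu by lra.
have y2 := ler_wpM2l Ca y1.
have : \sum_(K <= k < J) Del k <= (8 * (C / a) + 5) * nu by lra.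
move=> /le_trans; apply; rewrite /nu.
rewrite mulrA ler_pdivrMr// mulrC ler_pM2l//; lra.
Qed.

End FiniteLength.

(** * Summability of the errors of the inexact lower-level solutions *)

Section ErrorSequences.
Context {R : realType}.
Implicit Types s rho : nat -> R.

(** Since k s_k^(p_s) is bounded, s_k^q <= M / k. With q (1 + eta) = 2, one has s_k^2 = s_k^q
    (s_k^q)^eta, and the second factor compensates k^eta, leaving a multiple of k s_k^(p_s). *)
Lemma weighted_sqr_tails s (p_s : R) :
  (forall k, 0 <= s k) -> small_tails s -> p_s < 2 ->
  small_tails (fun k => k%:R * s k `^ p_s) ->
  exists2 eta : R, 0 < eta & small_tails (fun k => pweight eta k * s k ^+ 2).
Proof.
move=> s0 st ps2 ut.
(* The maximum with 1 keeps q positive when p_s <= 0; as s_k <= 1 eventually, raising the exponent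
   only decreases the power. *)
pose q := Num.max p_s 1.
have q1 : 1 <= q by rewrite le_max lexx orbT.
have q0 : 0 < q by lra.
have q2 : q < 2 by rewrite gt_max ps2 ltr1n.
have pq : p_s <= q by rewrite le_max lexx.
pose eta := (2 - q) / q.
have eta0 : 0 < eta by rewrite divr_gt0// subr_gt0.
exists eta => //.
have u0 k : 0 <= k%:R * s k `^ p_s by rewrite mulr_ge0 ?powR_ge0.
have [M0 HM0] := small_tails_bounded u0 ut.
pose M := Num.max M0 1.
have M1 : 0 < M by rewrite lt_max ltr01 orbT.
have [K0 HK0] := st 1 ltr01.
have W0 k : 0 <= pweight eta k by exact: ltW (pweight_gt0 _ _).
apply: (small_tails_le (C := 2 `^ (1 + eta) * M `^ eta) _ u0 _ _ ut).
- by move=> k; rewrite mulr_ge0 ?sqr_ge0.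
- by rewrite mulr_ge0 ?powR_ge0.
exists (maxn K0 1) => k; rewrite geq_max => /andP[K0k k1].
have sk1 : s k <= 1 by have := HK0 k k.+1 K0k; rewrite big_nat1.
have kgt : 0 < k%:R :> R by rewrite ltr0n.
have sq : s k `^ q <= s k `^ p_s.
  have [->|sk0] := eqVneq (s k) 0; first by rewrite powR0 ?gt_eqF// powR_ge0.
  by apply: ger_powR => //; rewrite sk1 lt_neqAle eq_sym sk0 s0.
have ukM : k%:R * s k `^ p_s <= M.
  rewrite le_max; apply/orP; left; apply: le_trans (HM0 k.+1).
  by rewrite big_nat_recr//= lerDr sumr_nat_ge0.
have ske : s k `^ q <= M / k%:R.
  by rewrite ler_pdivlMr// mulrC; apply: le_trans ukM; rewrite ler_wpM2l.
have s2 : s k ^+ 2 = s k `^ q * (s k `^ q) `^ eta.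
  rewrite -powRrM -powRD; last first.
    by apply/implyP => /eqP h; have := mulr_gt0 q0 eta0; lra.
  rewrite -powR_mulrn//; congr (_ `^ _).
  by rewrite /eta; field; rewrite gt_eqF.
have h1 : (s k `^ q) `^ eta <= (M / k%:R) `^ eta.
  apply: ge0_ler_powR => //; rewrite ?nnegrE ?powR_ge0//; first exact: ltW.
  by apply: divr_ge0; apply: ltW.
have h2 : pweight eta k <= 2 `^ (1 + eta) * (k%:R * k%:R `^ eta).
  have -> : k%:R * k%:R `^ eta = k%:R `^ (1 + eta) :> R.
    by rewrite powRD ?powRr1 ?ler0n//; apply/implyP => _; rewrite gt_eqF.
  rewrite -powRM ?ler0n//; apply: ge0_ler_powR; rewrite ?nnegrE ?mulr_ge0 ?ler0n//.
    by rewrite addr_ge0// ltW.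
  by rewrite -natrM ler_nat mul2n -addnn -addn1 leq_add2l.
have h3 : k%:R `^ eta * (M / k%:R) `^ eta = M `^ eta.
  rewrite -powRM ?divr_ge0 ?ler0n ?(ltW M1)//; congr (_ `^ _).
  by rewrite mulrCA divff ?mulr1// gt_eqF.
rewrite s2; apply: (@le_trans _ _ ((2 `^ (1 + eta) * (k%:R * k%:R `^ eta)) *
    (s k `^ p_s * (M / k%:R) `^ eta))).
  apply: ler_pM => //; first by rewrite mulr_ge0 ?powR_ge0.
  by apply: ler_pM; rewrite ?powR_ge0.
rewrite -h3 le_eqVlt; apply/orP; left; apply/eqP; ring.
Qed.

Lemma pweight_doubling (eta : R) k : 0 < eta ->
  pweight eta k.+1 <= 2 `^ (1 + eta) * pweight eta k.
Proof.
move=> eta0; rewrite /pweight -powRM ?ler0n//; apply: ge0_ler_powR.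
- by rewrite addr_ge0// ltW.
- by rewrite nnegrE ler0n.
- by rewrite nnegrE mulr_ge0 ?ler0n.
- by rewrite -natrM ler_nat mul2n -addnn addSn ltnS addnS ltnS leq_addr.
Qed.

Lemma tauk_small (P : params R) (e : R) : params_ok P -> 0 < e ->
  exists K0, forall k, (K0 <= k)%N -> 0 <= tauk P k /\ tauk P k <= e.
Proof.
move=> hP e0; have t0 := tau0_gt0 hP; have p0 := p_tau_gt0 hP.
pose x := (tau0 P / e) `^ (p_tau P)^-1.
have [N HN] : exists N, x <= N%:R.
  by exists (Num.truncn x).+1; exact: ltW (truncnS_gt x).
exists N => k Nk.
have kp : 0 < k.+1%:R `^ p_tau P by rewrite powR_gt0 ?ltr0n.
split; first by rewrite divr_ge0 ?ltW.
rewrite /tauk ler_pdivrMr// -ler_pdivrMl// mulrC.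
have -> : tau0 P / e = x `^ p_tau P.
  rewrite -powRrM mulVf ?gt_eqF// powRr1// ltW// divr_gt0//.
apply: ge0_ler_powR; rewrite ?nnegrE ?powR_ge0 ?ler0n ?(ltW p0)//.
by apply: le_trans HN _; rewrite ler_nat leqW.
Qed.

(** Since tau tends to 0, it eventually beats the factor 2^(1+eta) by which the weight can grow in
    one step. Both the plain and the weighted recursion then contract by 1/2. *)
Lemma error_tails s rho (tau : nat -> R) (eta : R) :
  0 < eta -> (forall k, 0 <= s k) -> (forall k, 0 <= rho k) ->
  (forall e, 0 < e -> exists K0, forall k, (K0 <= k)%N -> 0 <= tau k /\ tau k <= e) ->
  (exists K0, forall k, (K0 <= k)%N -> rho k.+1 <= Num.max (s k.+1) (tau k.+1 * rho k)) ->
  small_tails s -> small_tails (fun k => pweight eta k * s k ^+ 2) ->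
  small_tails rho /\ small_tails (fun k => pweight eta k * rho k ^+ 2).
Proof.
move=> eta0 s0 r0 tau_small [K0 H] st wt; split.
  apply: (small_tails_contraction r0 s0 _ st).
  have [|K1 H1] := tau_small 2^-1; first by rewrite invr_gt0.
  exists (maxn K0 K1) => k; rewrite geq_max => /andP[K0k K1k].
  have [t0 t1] := H1 _ (leqW K1k); apply: le_trans (H _ K0k) _.
  have : tau k.+1 * rho k <= 2^-1 * rho k by rewrite ler_wpM2r.
  have := r0 k; have := s0 k.+1; rewrite ge_max; lra.
have W0 k : 0 < pweight eta k by exact: pweight_gt0.
have B0 : 0 < 2 `^ (1 + eta) :> R by rewrite powR_gt0.
apply: (small_tails_contraction _ _ _ wt).
- by move=> k; rewrite mulr_ge0 ?sqr_ge0// ltW.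
- by move=> k; rewrite mulr_ge0 ?sqr_ge0// ltW.
pose e : R := Num.min 1 (2 * 2 `^ (1 + eta))^-1.
have e0 : 0 < e by rewrite lt_min ltr01 invr_gt0 mulr_gt0.
have [K1 H1] := tau_small e e0.
exists (maxn K0 K1) => k; rewrite geq_max => /andP[K0k K1k].
have [t0 t1] := H1 _ (leqW K1k); have Hk := H _ K0k.
have [te te1] : tau k.+1 * 2 `^ (1 + eta) <= 2^-1 /\ tau k.+1 <= 1.
  move: t1; rewrite le_min => /andP[? h]; split=> //.
  move: h; rewrite invfM -ler_pdivrMr ?invr_gt0// invrK//.
(* One factor tau suffices here: tau^2 <= tau because tau <= 1. *)
have rr : rho k.+1 ^+ 2 <= s k.+1 ^+ 2 + tau k.+1 * rho k ^+ 2.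
  have tr : 0 <= tau k.+1 * rho k by rewrite mulr_ge0.
  apply: (@le_trans _ _ (Num.max (s k.+1) (tau k.+1 * rho k) ^+ 2)).
    rewrite ler_pXn2r//; first by rewrite nnegrE r0.
    by rewrite nnegrE le_max s0.
  have a1 : (tau k.+1 * rho k) ^+ 2 <= tau k.+1 * rho k ^+ 2.
    rewrite exprMn ler_wpM2r ?sqr_ge0// expr2 ler_piMr//.
  have := sqr_ge0 (s k.+1); have := mulr_ge0 t0 (sqr_ge0 (rho k)).
  by case: (leP (s k.+1) (tau k.+1 * rho k)) => _; lra.
have := ler_wpM2l (ltW (W0 k.+1)) rr; rewrite mulrDr => /le_trans; apply.
rewrite lerD2l.
have x0 : 0 <= tau k.+1 * rho k ^+ 2 by rewrite mulr_ge0 ?sqr_ge0.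
apply: le_trans (ler_wpM2r x0 (pweight_doubling k eta0)) _.
have := ler_wpM2r (mulr_ge0 (ltW (W0 k)) (sqr_ge0 (rho k))) te; lra.
Qed.

End ErrorSequences.

(** * The merit function *)

Section Merit.
Context {R : realType} {n m : nat}.
Variables (D : problem R n m) (c : moduli R) (gamma c_alpha p : R).
Hypothesis hD : standing D c.
Hypothesis Y_ne : dY D !=set0.
Hypothesis gamma0 : 0 < gamma.
Hypothesis gamma_rho : gamma * (rhof2 c + rhog2 c) < 1.
Hypothesis c_alpha0 : 0 < c_alpha.
Hypothesis p0 : 0 < p.

Local Notation X := (dX D).
Local Notation Y := (dY D).
Local Notation F := (dF D).
Local Notation f := (df D).
Local Notation g := (dg D).
Local Notation phi := (vphi D).
Local Notation env := (envelope D gamma).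
Local Notation th := (theta_star D gamma).
Local Notation rv := (rhov1 c c_alpha).

Definition penalty (x : 'rV[R]_n) (y : 'rV[R]_m) : R :=
  p^-1 * F x y + phi x y - env x y.

(* The u for which the supremum defining H(u, y) is attained at x. *)
Definition dual_var (x : 'rV[R]_n) (y : 'rV[R]_m) : 'rV[R]_n :=
  gphix D x (th x y) + rv *: x.

Lemma Finf_le x y : X x -> Y y -> Finf D <= F x y.
Proof.
move=> Xx Yy; apply: ge_inf; first exact: F_lbound hD.
by exists (row_mx x y); [exact/prodset_row|rewrite joint_row].
Qed.

Lemma penalty_ge x y : X x -> Y y -> p^-1 * Finf D <= penalty x y.
Proof.
move=> Xx Yy; rewrite /penalty -addrA; apply: ler_wpDr.
  by rewrite subr_ge0; exact: (envelope_le_phi hD).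
by rewrite ler_pM2l ?invr_gt0//; exact: Finf_le.
Qed.

(** By [env_lower] with y' = y, adding [rhov1] / 2 |x|^2 to the envelope puts it above its
    linearization at x, whose slope is [dual_var]. So x maximizes the expression defining H. *)
Lemma Huy_dual_var x y : X x ->
  Huy D c gamma c_alpha (dual_var x y) y =
  (dot (dual_var x y) x - vt D c gamma c_alpha x y)%:E.
Proof.
move=> Xx; apply/eqP; rewrite eq_le; apply/andP; split; last first.
  by apply: ereal_sup_ubound; exists x.
apply: ge_ereal_sup => _ [x' Xx' <-]; rewrite lee_fin /vt.
have := env_lower hD Y_ne gamma0 gamma_rho y y Xx Xx'.
rewrite subrr dot0r enorm0 expr0n/= mulr0 subr0 addr0.
have h3 := mulr_ge0 (divr_ge0 (ltW c_alpha0) (ler0n R 8)) (sqr_ge0 (enorm (x' - x))).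
move: h3; rewrite enorm_sqrB (dotC x' x) dotBr /dual_var !dotDl !dotZl
  -(enorm_sqr x) /rhov1.
move: (dot _ x) (dot _ x') (dot _ x') (env x' y) (env x y) (enorm x') (enorm x).
clear => *; lra.
Qed.

Definition merit_point (x : 'rV[R]_n) (y : 'rV[R]_m) : 'rV[R]_(n + m + n) :=
  row_mx (row_mx x y) (dual_var x y).

Lemma merit_pointE x y : X x -> Y y ->
  merit D c gamma c_alpha p (merit_point x y) =
  (penalty x y - p^-1 * Finf D)%:E.
Proof.
move=> Xx Yy; rewrite /merit /merit_point !row_mxKl !row_mxKr.
rewrite asboolT; last exact/prodset_row.
rewrite Huy_dual_var// -EFinD; congr (_%:E).
by rewrite /Gp /vt /penalty; ring.
Qed.

(** Move in y at fixed x by the subgradient, then in x at fixed y' by smoothness; [Lg2] pays for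
    taking the x-gradient at y instead of y'. It serves both for the merit function and for partial
    g. *)
Lemma g_lower x x' y y' xi : X x -> X x' -> convex_subgrad Y (g x) y xi -> Y y' ->
  g x y + dot (gradx g x y) (x' - x) + dot xi (y' - y)
  - (Lg1 c / 2 * enorm (x' - x) ^+ 2 + Lg2 c * enorm (y' - y) * enorm (x' - x))
  <= g x' y'.
Proof.
move=> Xx Xx' [Yy Hxi] Yy'; have := Hxi _ Yy'.
have := g_smooth_x hD Xx Xx' Yy'; rewrite ler_norml => /andP[+ _].
have := dot_geN (gradx g x y' - gradx g x y) (x' - x).
have := (gradx_g_lipy hD Xx).2 _ _ Yy' Yy.
rewrite [dot (gradx g x y' - _) _]dotBl => h1 h2 h3 h4.
have h5 := ler_wpM2r (enorm_ge0 (x' - x)) h1.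
move: (dot _ _) (dot _ _) (dot _ _) (enorm _) (enorm _) (g _ _) (g _ _) (g _ _)
  h2 h3 h4 h5.
clear => *; lra.
Qed.

Let quad (A B C' E G H P Q a b r : R) :
  0 <= A -> 0 <= B -> 0 <= C' -> 0 <= E -> 0 <= G -> 0 <= H -> 0 < P -> 0 < Q ->
  0 <= a -> 0 <= b -> 0 <= r ->
  P * ((A + B) * (a ^+ 2 + b ^+ 2) / 2) + (C' + E) * (a ^+ 2 + b ^+ 2) / 2
  + (G / 2 * a ^+ 2 + H * b * a) + Q * b ^+ 2 + r * a <=
  (P * (A + B) / 2 + (C' + E) / 2 + G / 2 + H + Q + 1) *
    (a ^+ 2 + b ^+ 2 + r ^+ 2).
Proof.
move=> A0 B0 C0 E0 G0 H0 P0 Q0 a0 b0 r0.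
have a2 := sqr_ge0 a; have b2 := sqr_ge0 b; have r2 := sqr_ge0 r.
have h1 : H * b * a <= H * (a ^+ 2 + b ^+ 2).
  by rewrite -mulrA; apply: ler_wpM2l => //; have := sqr_ge0 (a - b); nra.
have h2 : r * a <= a ^+ 2 + r ^+ 2 by have := sqr_ge0 (a - r); nra.
pose K := P * (A + B) / 2 + (C' + E) / 2.
have K0 : 0 <= K by have := mulr_ge0 (ltW P0) (addr_ge0 A0 B0); rewrite /K; lra.
have := mulr_ge0 K0 r2; have := mulr_ge0 G0 b2; have := mulr_ge0 G0 r2.
have := mulr_ge0 (ltW Q0) a2; have := mulr_ge0 (ltW Q0) r2; have := mulr_ge0 H0 r2.
rewrite /K; lra.
Qed.

(** The u-block vanishes because x attains the supremum at [dual_var x y]: the dependence on u'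
    reduces to -<u', x' - x>, whose deviation from the value at u is a product of two increments,
    hence of second order. *)
Lemma merit_regular x y nu xi : X x -> 
  (forall x', X x' -> dot nu (x' - x) <= 0) -> convex_subgrad Y (g x) y xi ->
  regular_subdiff (merit D c gamma c_alpha p) (merit_point x y)
    (row_mx (row_mx
       (p^-1 *: gradx F x y + gphix D x y - gphix D x (th x y) + nu)
       (p^-1 *: grady F x y + grady f x y + xi - gamma^-1 *: (y - th x y))) 0).
Proof.
move=> Xx Hnu Hxi; have Yy := Hxi.1.
split; first by rewrite merit_pointE.
move=> e e0.
have [L1 _] := gradx_F_lip hD; have [L2 _] := grady_F_lip hD.
have [L3 _] := gradx_f_lip hD; have [L4 _] := grady_f_lip hD.
have [L5 _] := gradx_g_lipx hD Yy; have [L6 _] := gradx_g_lipy hD Xx.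
have [r1 _ _] := f_wconvex hD; have [r2 _ _] := g_wconvex hD.
have pi : 0 < p^-1 by rewrite invr_gt0.
have gi : 0 < (2 * gamma)^-1 by rewrite invr_gt0 mulr_gt0.
pose C := p^-1 * (LFx c + LFy c) / 2 + (Lfx c + Lfy c) / 2 + Lg1 c / 2 + Lg2 c
  + (2 * gamma)^-1 + 1.
have C0 : 0 < C.
  have := mulr_ge0 (ltW pi) (addr_ge0 L1 L2); rewrite /C; lra.
near=> zu; rewrite merit_pointE//.
rewrite /merit; case: asboolP => [|_]; last by rewrite leey.
rewrite -(hsubmxK zu) -(hsubmxK (lsubmx zu)) !row_mxKl !row_mxKr.
set x' := lsubmx (lsubmx zu); set y' := rsubmx (lsubmx zu); set u' := rsubmx zu.
move=> /prodset_row[Xx' Yy'].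
rewrite /merit_point !row_mxB !dot_row_mx dot0l addr0.
(* The supremum H(u', y') is bounded below by its value at the old point x, not at x'. *)
apply: (@le_trans _ _ ((Gp D c c_alpha p x' y' - dot u' x')%:E +
   (dot u' x - vt D c gamma c_alpha x y')%:E)%E); last first.
  by rewrite leeD2l//; apply: ereal_sup_ubound; exists x.
rewrite -!EFinD lee_fin.
set u := dual_var x y.
have hz : enorm (row_mx (row_mx (x' - x) (y' - y)) (u' - u)) < e / C.
  rewrite -!row_mxB (_ : row_mx (row_mx x' y') u' = zu) ?hsubmxK//.
  by near: zu; apply: near_enorm; rewrite divr_gt0.
rewrite ltr_pdivlMr// in hz.
have E : enorm (row_mx (row_mx (x' - x) (y' - y)) (u' - u)) ^+ 2 =
    enorm (x' - x) ^+ 2 + enorm (y' - y) ^+ 2 + enorm (u' - u) ^+ 2.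
  by rewrite !enorm_row_mx.
have hF := smooth_xy (convex_X hD) (convex_Y hD) (F_C1 hD).1 (gradx_F_lip hD)
  (grady_F_lip hD) Xx Yy Xx' Yy'.
have hf := smooth_xy (convex_X hD) (convex_Y hD) (f_C1 hD).1 (gradx_f_lip hD)
  (grady_f_lip hD) Xx Yy Xx' Yy'.
have hg := g_lower Xx Xx' Hxi Yy'.
have he := env_upper hD Y_ne gamma0 y y' Xx Xx.
rewrite subrr dot0r enorm0 expr0n/= mulr0 !addr0 in he.
have hx := enorm_sqrD x (x' - x).
have hu := dot_geN (u - u') (x' - x).
have hnu := Hnu _ Xx'.
rewrite addrC subrK in hx.
rewrite enorm_distC in hu.
have hs := enorm_ge0 (row_mx (row_mx (x' - x) (y' - y)) (u' - u)).
have a1 := enorm_ge0 (x' - x); have a2 := enorm_ge0 (y' - y); have a3 :=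
  enorm_ge0 (u' - u).
rewrite /Gp /vt /penalty /vphi hx.
have Eu : dot u (x' - x) = dot (gphix D x (th x y)) (x' - x) + rv * dot x (x' - x).
  by rewrite /u /dual_var dotDl dotZl.
have Eu' : dot u' x' = dot u' x + dot u' (x' - x) by rewrite dotBr; ring.
rewrite [dot (u - u') _]dotBl Eu in hu; rewrite Eu'.
have E1 : dot (p^-1 *: gradx F x y + gphix D x y - gphix D x (th x y) + nu) (x' - x) =
  p^-1 * dot (gradx F x y) (x' - x) + (dot (gradx f x y) (x' - x) + dot (gradx g
    x y) (x' - x)) -
  dot (gphix D x (th x y)) (x' - x) + dot nu (x' - x).
  by rewrite dotDl dotBl dotDl dotZl dotDl.
have E2 : dot (p^-1 *: grady F x y + grady f x y + xi - gamma^-1 *: (y - th x y))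
  (y' - y) =
  p^-1 * dot (grady F x y) (y' - y) + dot (grady f x y) (y' - y) + dot xi (y' - y) -
  dot (gamma^-1 *: (y - th x y)) (y' - y).
  by rewrite dotBl 2!dotDl dotZl.
rewrite E1 E2 /rhov1 -/rv.
rewrite ler_norml in hF; case/andP: hF => hF _.
rewrite ler_norml in hf; case/andP: hf => hf _.
have hF' := ler_wpM2l (ltW pi) hF.
have fin : C * (enorm (x' - x) ^+ 2 + enorm (y' - y) ^+ 2 + enorm (u' - u) ^+ 2) <=
  e * enorm (row_mx (row_mx (x' - x) (y' - y)) (u' - u)) by rewrite -E; nra.
have rv0 : 0 <= rv by rewrite /rhov1; have := ltW c_alpha0; lra.
have h1 := mulr_ge0 (divr_ge0 rv0 (ler0n R 2)) (sqr_ge0 (enorm (x' - x))).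
have := quad L1 L2 L3 L4 L5 L6 pi gi a1 a2 a3; rewrite -/C => h2.
have h3 := le_trans h2 fin.
clear Eu Eu' E1 E2 E hz fin h2 hx hs L1 L2 L3 L4 L5 L6 r1 r2 gi hF rv0.
move: hF' hf hg he hu hnu h1 h3; rewrite /vphi.
move: (dot _ _) (dot _ _) (dot _ _) (dot _ _) (dot _ _) (dot _ _) (dot _ _) (dot
  _ _) (dot _ _) (dot _ _).
move: (F x' y') (F x y) (f x' y') (f x y) (g x' y') (g x y) (env x y') (env x y) (Finf D).
move: (enorm (x' - x)) (enorm (y' - y)) (enorm (u' - u)) (enorm (row_mx _ _))
  (enorm x) rv.
move: p^-1 (2 * gamma)^-1 (LFx c) (LFy c) (Lfx c) (Lfy c) (Lg1 c) (Lg2 c).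
clear => *; lra.
Unshelve. all: by end_near. Qed.

End Merit.

(** * One iteration *)

Lemma enorm_sum6 (R : realType) d (s t : R) (v1 v2 v3 v4 v5 v6 : 'rV[R]_d) :
  0 < s -> 0 < t ->
  enorm (s *: v1 + v2 - v3 - v4 - v5 - t *: v6) <=
  s * enorm v1 + enorm v2 + enorm v3 + enorm v4 + enorm v5 + t * enorm v6.
Proof.
move=> s0 t0; rewrite -{2}(gtr0_norm s0) -{2}(gtr0_norm t0) -!enormZ.
do 4 (apply: le_trans (enormB _ _) _; rewrite lerD2r).
exact: enormD.
Qed.

Lemma enorm_sum5 (R : realType) d (s t r : R) (v1 v2 v3 v4 v5 : 'rV[R]_d) :
  0 < s -> 0 < t -> 0 < r ->
  enorm (s *: v1 + v2 - v3 - t *: v4 - r *: v5) <=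
  s * enorm v1 + enorm v2 + enorm v3 + t * enorm v4 + r * enorm v5.
Proof.
move=> s0 t0 r0; rewrite -{2}(gtr0_norm s0) -{2}(gtr0_norm t0) -{2}(gtr0_norm r0)
  -!enormZ.
do 3 (apply: le_trans (enormB _ _) _; rewrite lerD2r).
exact: enormD.
Qed.

Section Iteration.
Context {R : realType} {n m : nat}.
Variables (D : problem R n m) (c : moduli R) (gamma c_alpha c_beta p : R).
Hypothesis hD : standing D c.
Hypothesis Y_ne : dY D !=set0.
Hypothesis gamma0 : 0 < gamma.
Hypothesis gamma_rho : gamma * (rhof2 c + rhog2 c) < 1.
Hypothesis c_alpha0 : 0 < c_alpha.
Hypothesis c_beta0 : 0 < c_beta.
Hypothesis p0 : 0 < p.

Local Notation X := (dX D).
Local Notation Y := (dY D).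
Local Notation F := (dF D).
Local Notation f := (df D).
Local Notation g := (dg D).
Local Notation phi := (vphi D).
Local Notation env := (envelope D gamma).
Local Notation th := (theta_star D gamma).
Local Notation gphix := (gphix D).
Local Notation value := (penalty D gamma p).

Variables (x x1 : 'rV[R]_n) (y y1 tht thh : 'rV[R]_m) (alpha beta : R).
Hypothesis Xx : X x.
Hypothesis Yy : Y y.
Hypothesis Ythh : Y thh.
Hypothesis alpha0 : 0 < alpha.
Hypothesis beta0 : 0 < beta.
Hypothesis alpha_le :
  alpha <= 2 / (LFx c / p + Lfx c + Lg1 c + rhof1 c + rhog1 c + c_alpha).
Hypothesis beta_le : beta <= 2 / (LFy c / p + Lfy c + c_beta).

Let dy := p^-1 *: grady F x y + grady f x y - gamma^-1 *: (y - tht).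
Let dx := p^-1 *: gradx F x y1 + gphix x y1 - gphix x thh.

Hypothesis y1P : convex_subgrad Y (g x) y1 (beta^-1 *: (y - beta *: dy - y1)).
Hypothesis x1P : X x1 /\ forall q, X q -> dot (x - alpha *: dx - x1) (q - x1) <= 0.

Let Yy1 : Y y1 := y1P.1.
Let Xx1 : X x1 := x1P.1.

Let pi : 0 < p^-1. Proof. by rewrite invr_gt0. Qed.

Let gi : 0 < gamma^-1. Proof. by rewrite invr_gt0. Qed.

Let step_inv (t L k : R) : 0 < t -> 0 <= L -> 0 < k -> t <= 2 / (L + k) ->
  (L + k) / 2 <= t^-1.
Proof.
move=> t0 L0 k0 h; rewrite -[leLHS]invrK lef_pV2 ?posrE ?invr_gt0 ?divr_gt0 ?ltr_wpDl//.
by rewrite invf_div.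
Qed.

Let absorb (k e s : R) : 0 < k -> e * s - k / 2 * s ^+ 2 <= - (k / 4 * s ^+ 2) +
  e ^+ 2 / k.
Proof.
move=> k0; have h : 0 <= k * (s / 2 - e / k) ^+ 2 by rewrite mulr_ge0 ?sqr_ge0// ltW.
have E : k * (s / 2 - e / k) ^+ 2 = k / 4 * s ^+ 2 - e * s + e ^+ 2 / k.
  by field; rewrite gt_eqF.
lra.
Qed.

(** [nu] is the normal vector left by the projection step, and [xi'] below is the subgradient of
    g(x, .) left by the prox step. *)
Let nu := alpha^-1 *: (x - x1) - dx.
Let xi' := beta^-1 *: (y - y1) - dy.

Let xi'P : convex_subgrad Y (g x) y1 xi'.
Proof.
rewrite /xi'; have -> : beta^-1 *: (y - y1) - dy = beta^-1 *: (y - beta *: dy - y1).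
  by rewrite addrAC [RHS]scalerBr scalerA mulVf ?scale1r// gt_eqF.
exact: y1P.
Qed.

Let nuP q : X q -> dot nu (q - x1) <= 0.
Proof.
move=> Xq; have -> : nu = alpha^-1 *: (x - alpha *: dx - x1).
  by rewrite [x - _ - x1]addrAC [RHS]scalerBr scalerA mulVf ?scale1r// gt_eqF.
rewrite dotZl; apply: mulr_ge0_le0; first by rewrite invr_ge0 ltW.
exact: x1P.2.
Qed.

(** Test the optimality of y1 at y. Since 1/beta is at least half of L + c_beta, where L is the
    Lipschitz constant of the smooth part, a term c_beta / 2 |y1 - y|^2 remains; Young's inequality
    spends half of it on the error in [tht]. *)
Lemma y_descent :
  value x y1 + c_beta / 4 * enorm (y1 - y) ^+ 2 <=
  value x y + (gamma^-1 * enorm (tht - th x y)) ^+ 2 / c_beta.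
Proof.
have L1 : 0 <= LFy c by case: (grady_F_lip hD).
have L2 : 0 <= Lfy c by case: (grady_f_lip hD).
have bi : (LFy c / p + Lfy c + c_beta) / 2 <= beta^-1.
  by apply: step_inv => //; rewrite addr_ge0// divr_ge0// ltW.
have hg := xi'P.2 _ Yy.
have hF := smooth_y (convex_X hD) (convex_Y hD) (F_C1 hD).1 (grady_F_lip hD) Xx Yy Yy1.
have hf := smooth_y (convex_X hD) (convex_Y hD) (f_C1 hD).1 (grady_f_lip hD) Xx Yy Yy1.
have he := env_convex_y hD Y_ne gamma0 y y1 Xx.
rewrite ler_norml in hF; case/andP: hF => _ hF.
rewrite ler_norml in hf; case/andP: hf => _ hf.
have hF' := ler_wpM2l (ltW pi) hF.
have herr := dot_geN (tht - th x y) (y1 - y).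
have herr' := ler_wpM2l (ltW gi) herr.
have := absorb (gamma^-1 * enorm (tht - th x y)) (enorm (y1 - y)) c_beta0.
have hb := ler_wpM2r (sqr_ge0 (enorm (y1 - y))) bi.
have E : dot xi' (y - y1) = beta^-1 * enorm (y1 - y) ^+ 2 + 
   (p^-1 * dot (grady F x y) (y1 - y) + dot (grady f x y) (y1 - y)
    - gamma^-1 * dot (y - th x y) (y1 - y) + gamma^-1 * dot (tht - th x y) (y1 - y)).
  have -> : xi' = - (beta^-1 *: (y1 - y)) - (p^-1 *: grady F x y + grady f x y
      - gamma^-1 *: (y - th x y) + gamma^-1 *: (tht - th x y)).
    rewrite /xi' /dy -[y - y1]opprB scalerN; congr (_ - _).
    rewrite -[in RHS]addrA; congr (_ + _).
    by rewrite -[tht - _]opprB scalerN -opprD -scalerDr addrA subrK.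
  rewrite -[y - y1]opprB enorm_sqr.
  move: (y1 - y) (y - th x y) (tht - th x y) (grady F x y) (grady f x y) => v a b A B.
  by rewrite dotNr !(dotDl, dotNl) !dotZl; ring.
rewrite E in hg; rewrite dotZl in he.
move: hg hF' hf he herr' hb {hF herr E bi}; rewrite /penalty /vphi.
move: (dot _ _) (dot _ _) (dot _ _) (dot _ _) (g _ _) (g _ _) (F _ _) (F _ _)
 (f _ _) (f _ _) (env _ _) (env _ _) (enorm (y1 - y)) (enorm _) gamma^-1 beta^-1 p^-1.
by move=> *; lra.
Qed.

(** As in the y-step, but here -v_gamma enters through [env_lower], whose loss explains rho_f1 +
    rho_g1 in the step-size bound. *)
Lemma x_descent :
  value x1 y1 + c_alpha / 4 * enorm (x1 - x) ^+ 2 <=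
  value x y1 + ((Lfx c + Lg2 c) * enorm (thh - th x y1)) ^+ 2 / c_alpha.
Proof.
have L1 : 0 <= LFx c by case: (gradx_F_lip hD).
have L2 : 0 <= Lfx c by case: (gradx_f_lip hD).
have L3 : 0 <= Lg1 c by case: (gradx_g_lipx hD Yy).
have [r1 _ _] := f_wconvex hD; have [r2 _ _] := g_wconvex hD.
have ai : (LFx c / p + Lfx c + Lg1 c + rhof1 c + rhog1 c + c_alpha) / 2 <= alpha^-1.
  by apply: step_inv => //; rewrite !addr_ge0// divr_ge0// ltW.
have hn := nuP Xx.
have hF := smooth_x (convex_X hD) (convex_Y hD) (F_C1 hD).1 (gradx_F_lip hD) Xx Xx1 Yy1.
have hp := phi_smooth_x hD Xx Xx1 Yy1.
have he := env_lower hD Y_ne gamma0 gamma_rho y1 y1 Xx Xx1.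
rewrite subrr dot0r enorm0 expr0n/= mulr0 subr0 addr0 in he.
rewrite ler_norml in hF; case/andP: hF => _ hF.
rewrite ler_norml in hp; case/andP: hp => _ hp.
have hF' := ler_wpM2l (ltW pi) hF.
have Yth : Y (th x y1) by exact: (theta_starY hD).
have herr := dot_le (gphix x thh - gphix x (th x y1)) (x1 - x).
have hl := gphix_lip_y hD Xx Ythh Yth.
have herr' := ler_wpM2r (enorm_ge0 (x1 - x)) hl.
have := absorb ((Lfx c + Lg2 c) * enorm (thh - th x y1)) (enorm (x1 - x)) c_alpha0.
have ha := ler_wpM2r (sqr_ge0 (enorm (x1 - x))) ai.
have E : dot nu (x - x1) = alpha^-1 * enorm (x1 - x) ^+ 2 +
  (p^-1 * dot (gradx F x y1) (x1 - x) + dot (gphix x y1) (x1 - x)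
   - (dot (gphix x thh - gphix x (th x y1)) (x1 - x) + dot (gphix x (th x y1)) (x1 - x))).
  rewrite -dotDl subrK /nu /dx -[x - x1]opprB enorm_sqr scalerN.
  move: (x1 - x) (gradx F x y1) (gphix x y1) (gphix x thh) => v A B C.
  by rewrite dotNr !(dotDl, dotNl) !dotZl; ring.
rewrite E in hn.
move: hn hF' hp he herr herr' ha {hF hl E ai Yth}; rewrite /penalty.
move: (dot _ _) (dot _ _) (dot _ _) (dot _ _) (phi _ _) (phi _ _) (F _ _) (F _ _)
 (env _ _) (env _ _) (enorm (x1 - x)) (enorm (_ - _)) (enorm (_ - _)) alpha^-1 p^-1.
by move=> *; lra.
Qed.

(** [nu] is already normal at x1, but [xi'] belongs to g(x, .) and is carried over to g(x1, .). With
    these choices each block of the merit subgradient becomes a sum of differences between old and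
    new points, each bounded by a Lipschitz constant. *)
Lemma subgrad_bound (ai bi : R) : alpha^-1 <= ai -> beta^-1 <= bi ->
  exists nu xi,
  [/\ forall q, X q -> dot nu (q - x1) <= 0,
      convex_subgrad Y (g x1) y1 xi,
      enorm (p^-1 *: gradx F x1 y1 + gphix x1 y1 - gphix x1 (th x1 y1) + nu) <=
        (p^-1 * LFx c + 2 * (Lfx c + Lg1 c)
          + (Lfx c + Lg2 c) * (gamma * (Lfy c + Lgy c)) + ai) * enorm (x1 - x)
        + (Lfx c + Lg2 c) * enorm (thh - th x y1) &
      enorm (p^-1 *: grady F x1 y1 + grady f x1 y1 + xi
             - gamma^-1 *: (y1 - th x1 y1)) <=
        (p^-1 * LFy c + Lfy c + Lgy c + (Lfy c + Lgy c)) * enorm (x1 - x)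
        + (p^-1 * LFy c + Lfy c + bi + 2 * gamma^-1) * enorm (y1 - y)
        + gamma^-1 * enorm (tht - th x y)].
Proof.
move=> hai hbi.
have [xi xiP hxi] := subgrad_transfer hD Xx Xx1 xi'P.
exists nu, xi; split=> //.
- have -> : p^-1 *: gradx F x1 y1 + gphix x1 y1 - gphix x1 (th x1 y1) + nu =
     p^-1 *: (gradx F x1 y1 - gradx F x y1) + (gphix x1 y1 - gphix x y1)
     - (gphix x1 (th x1 y1) - gphix x (th x1 y1))
     - (gphix x (th x1 y1) - gphix x (th x y1))
     - (gphix x (th x y1) - gphix x thh) - alpha^-1 *: (x1 - x).
    rewrite /nu /dx -[x - x1]opprB scalerN.
    move: (x1 - x) (gradx F x1 y1) (gradx F x y1) (gphix x1 y1) (gphix x y1)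
      (gphix x1 (th x1 y1)) (gphix x (th x1 y1)) (gphix x (th x y1)) (gphix x thh).
    by move=> *; apply/rowP => i; rewrite !mxE; ring.
  have Yt1 : Y (th x1 y1) by exact: (theta_starY hD).
  have Yt : Y (th x y1) by exact: (theta_starY hD).
  have h1 := gradx_lip (gradx_F_lip hD) Xx1 Yy1 Xx Yy1.
  rewrite subrr enorm_row_mx0 in h1.
  have h2 := gphix_lip_x hD Xx1 Xx Yy1.
  have h3 := gphix_lip_x hD Xx1 Xx Yt1.
  have h4 := gphix_lip_y hD Xx Yt1 Yt.
  have h5 := gphix_lip_y hD Xx Yt Ythh.
  have h6 := theta_star_lip hD Y_ne gamma0 y1 y1 Xx1 Xx.
  rewrite subrr enorm0 addr0 in h6.
  have L1 : 0 <= Lfx c by case: (gradx_f_lip hD).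
  have L2 : 0 <= Lg2 c by case: (gradx_g_lipy hD Xx).
  have h7 := ler_wpM2l (addr_ge0 L1 L2) h6.
  have h8 := ler_wpM2l (ltW pi) h1.
  have h9 := ler_wpM2r (enorm_ge0 (x1 - x)) hai.
  have ali : 0 < alpha^-1 by rewrite invr_gt0.
  have h10 := le_trans h4 h7; rewrite (enorm_distC _ thh) in h5.
  apply: le_trans (enorm_sum6 _ _ _ _ _ _ pi ali) _.
  apply: le_trans (lerD (lerD (lerD (lerD (lerD h8 h2) h3) h10) h5) h9) _.
  by rewrite le_eqVlt; apply/orP; left; apply/eqP; ring.
have Lg0 := Lgy_ge0 hD.
have [Lf0 _] := grady_f_lip hD; have [LF0 _] := grady_F_lip hD.
have -> : p^-1 *: grady F x1 y1 + grady f x1 y1 + xi - gamma^-1 *: (y1 - th x1 y1) =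
   p^-1 *: (grady F x1 y1 - grady F x y) + (grady f x1 y1 - grady f x y)
   - (xi' - xi) - beta^-1 *: (y1 - y)
   - gamma^-1 *: ((y1 - y) - (th x1 y1 - th x y) + (tht - th x y)).
  rewrite /xi' /dy -[y - y1]opprB scalerN.
  move: (th x1 y1) (th x y) (grady F x1 y1) (grady F x y) (grady f x1 y1) (grady f x y).
  by move=> *; apply/rowP => i; rewrite !mxE; ring.
have h1 := grady_lip (grady_F_lip hD) Xx1 Yy1 Xx Yy.
have h2 := grady_lip (grady_f_lip hD) Xx1 Yy1 Xx Yy.
have h0 := enorm_row_mx_le (x1 - x) (y1 - y).
have h3 := le_trans h1 (ler_wpM2l LF0 h0).
have h4 := le_trans h2 (ler_wpM2l Lf0 h0).
have h5 := ler_wpM2l (ltW pi) h3.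
have h6 := ler_wpM2r (enorm_ge0 (y1 - y)) hbi.
have h7 := theta_star_lip hD Y_ne gamma0 y1 y Xx1 Xx.
have bei : 0 < beta^-1 by rewrite invr_gt0.
have h8 : enorm ((y1 - y) - (th x1 y1 - th x y) + (tht - th x y)) <=
    enorm (y1 - y) + (gamma * (Lfy c + Lgy c) * enorm (x1 - x) + enorm (y1 - y))
    + enorm (tht - th x y).
  apply: le_trans (enormD _ _) _; rewrite lerD2r; apply: le_trans (enormB _ _) _.
  by rewrite lerD2l.
have h9 := ler_wpM2l (ltW gi) h8.
rewrite (enorm_distC x x1) in hxi.
apply: le_trans (enorm_sum5 _ _ _ _ _ pi bei gi) _.
apply: le_trans (lerD (lerD (lerD (lerD h5 h4) hxi) h6) h9) _.
rewrite le_eqVlt; apply/orP; left; apply/eqP; field.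
by rewrite (gt_eqF p0) (gt_eqF gamma0).
Qed.

End Iteration.

(** * Convergence *)

Section SequenceTools.
Context {R : realType}.

(** Subtracting the partial sums of e makes v nonincreasing and bounded below. *)
Lemma quasi_monotone_cvg (v e : nat -> R) (lo : R) :
  (forall k, 0 <= e k) -> small_tails e -> (forall k, lo <= v k) ->
  (forall k, v k.+1 <= v k + e k) -> exists l : R, v @ \oo --> l.
Proof.
move=> e0 et vlo vdec.
have [M HM] := small_tails_bounded e0 et.
pose S k := \sum_(0 <= i < k) e i.
have nS : nondecreasing_seq S by move=> i j ij; apply: sumr_nat_widen.
have cS : cvgn S.
  by apply: nondecreasing_is_cvgn => //; exists M => _ [N _ <-]; exact: HM.
pose u k := v k - S k.
have nu : nonincreasing_seq u.
  apply/nonincreasing_seqP => k; rewrite /u /S big_nat_recr//=.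
  by have := vdec k; lra.
have cu : cvgn u.
  apply: nonincreasing_is_cvgn => //; exists (lo - M) => _ [k _ <-].
  by have := vlo k; have := HM k; rewrite /u /S; lra.
exists (limn u + limn S).
have -> : v = (fun k => u k + S k) by apply/funext => k; rewrite /u subrK.
exact: cvgD.
Qed.

Lemma bounded_cluster d (z : nat -> 'rV[R]_d) : bounded_set (range z) ->
  exists zbar, forall (r : R) N, 0 < r ->
    exists2 k, (N <= k)%N & enorm (z k - zbar) < r.
Proof.
move=> bz; have [M [Mr HM]] := bz.
pose A := [set u : 'rV[R]_d | enorm (u - 0) <= d%:R * (M + 1)].
have cA : compact (setT `&` A) by apply: compact_inter_ball; exact: closedT.
have zA k : A (z k).
  rewrite /A/= subr0; apply: le_trans (enorm_le_norm _) _.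
  by rewrite ler_wpM2l//; apply: HM; [rewrite ltrDl|exists k].
have PF : ProperFilter (z @ \oo) by exact: fmap_proper_filter.
have [|zbar [_ cl]] := cA (z @ \oo) PF.
  by exists 0%N => // k _; split.
exists zbar => r N r0.
have FA : (z @ \oo) [set z k | k in [set k | (N <= k)%N]].
  by exists N => // k /= Nk; exists k.
have [_ [[k /= Nk <-] zk]] := cl _ _ FA (near_enorm zbar r0).
by exists k.
Qed.

(** The strict bound [k < sigma k] gives convergence along sigma and guarantees that each selected
    index has a predecessor. *)
Lemma cluster_subsequence d (z : nat -> 'rV[R]_d) zbar :
  (forall (r : R) N, 0 < r -> exists2 k, (N <= k)%N & enorm (z k - zbar) < r) ->
  exists2 sigma : nat -> nat, forall k, (k < sigma k)%N &
    (fun k => z (sigma k)) @ \oo --> zbar.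
Proof.
move=> H; have ex k : exists j, (k < j)%N /\ enorm (z j - zbar) < k.+1%:R^-1.
  by have [|j kj zj] := H k.+1%:R^-1 k.+1; [rewrite invr_gt0 ltr0n|exists j].
have [sigma Hs] := choice ex; exists sigma; first by move=> k; case: (Hs k).
apply/cvg_enormP; apply: (squeeze_cvgr _ (cvg_cst 0) cvg_harmonic); near=> k.
by rewrite enorm_ge0 ltW//; case: (Hs k).
Unshelve. all: by end_near. Qed.

Lemma cvg_subseq (T : topologicalType) (u : nat -> T) (l : T) (sigma : nat -> nat) :
  (forall k, (k <= sigma k)%N) -> u @ \oo --> l ->
  (fun k => u (sigma k)) @ \oo --> l.
Proof.
move=> hs; apply: (cvg_comp sigma u) => A [N _ HN].
by exists N => // k /= Nk; apply: HN => /=; exact: leq_trans (hs k).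
Qed.

Lemma cvg_closed_seq d (S : set 'rV[R]_d) (u : nat -> 'rV[R]_d) (l : 'rV[R]_d) :
  closed S -> (forall k, S (u k)) -> u @ \oo --> l -> S l.
Proof.
by move=> cS Su; apply: (closed_cvg S cS); near=> k; exact: Su.
Unshelve. all: by end_near. Qed.

Lemma enorm_sum_steps d (z : nat -> 'rV[R]_d) K J : (K <= J)%N ->
  enorm (z J - z K) <= \sum_(K <= k < J) enorm (z k.+1 - z k).
Proof.
elim: J => [|J IH]; first by rewrite leqn0 => /eqP->; rewrite subrr enorm0 big_geq.
rewrite leq_eqVlt => /orP[/eqP->|]; first by rewrite subrr enorm0 big_geq.
rewrite ltnS => KJ; rewrite big_nat_recr//= addrC.
apply: le_trans (enorm_triangle (z J) _ _) _.
by rewrite lerD2l IH.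
Qed.

End SequenceTools.

(** * Continuity of the lower-level solution and of the merit point *)

Section Continuity.
Context {R : realType} {n m : nat}.
Variables (D : problem R n m) (c : moduli R) (gamma : R).
Hypothesis hD : standing D c.
Hypothesis Y_ne : dY D !=set0.
Hypothesis gamma0 : 0 < gamma.

Local Notation X := (dX D).
Local Notation Y := (dY D).
Local Notation th := (theta_star D gamma).

Variables (xs : nat -> 'rV[R]_n) (ys : nat -> 'rV[R]_m) (x : 'rV[R]_n) (y : 'rV[R]_m).
Hypothesis Xxs : forall k, X (xs k).
Hypothesis Yys : forall k, Y (ys k).
Hypothesis Xx : X x.
Hypothesis Yy : Y y.
Hypothesis xs_cvg : xs @ \oo --> x.
Hypothesis ys_cvg : ys @ \oo --> y.

Lemma joint_cvg (h : 'rV[R]_n -> 'rV[R]_m -> R) :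
  {within prodset X Y, continuous (joint h)} ->
  (fun k => h (xs k) (ys k)) @ \oo --> h x y.
Proof.
move=> hc; have := within_continuous_cvg hc _ _ (cvg_row_mx xs_cvg ys_cvg).
rewrite joint_row; under eq_fun do rewrite joint_row.
by apply; [move=> k; apply/prodset_row|apply/prodset_row].
Qed.

Lemma joint_lip_cvg d (L : R) (h : 'rV[R]_n -> 'rV[R]_m -> 'rV[R]_d) :
  Defs.lipschitz_on L (prodset X Y) (joint h) ->
  (fun k => h (xs k) (ys k)) @ \oo --> h x y.
Proof.
move=> hc; have := lipschitz_on_cvg hc _ _ (cvg_row_mx xs_cvg ys_cvg).
rewrite joint_row; under eq_fun do rewrite joint_row.
by apply; [move=> k; apply/prodset_row|apply/prodset_row].
Qed.

Lemma gphix_cvg : (fun k => gphix D (xs k) (ys k)) @ \oo --> gphix D x y.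
Proof.
have /cvg_enormP h1 := xs_cvg; have /cvg_enormP h2 := ys_cvg.
apply/cvg_enormP.
have h : (fun k => (Lfx c + Lg1 c) * enorm (xs k - x) +
    (Lfx c + Lg2 c) * enorm (ys k - y)) @ \oo --> (Lfx c + Lg1 c) * 0 + (Lfx c +
      Lg2 c) * 0.
  by apply: cvgD; apply: cvgMr.
rewrite !mulr0 addr0 in h.
apply: (squeeze_cvgr _ (cvg_cst 0) h); near=> k; rewrite enorm_ge0/=.
apply: le_trans (enorm_triangle (gphix D x (ys k)) _ _) _.
by apply: lerD; [exact: (gphix_lip_x hD)|exact: (gphix_lip_y hD)].
Unshelve. all: by end_near. Qed.

Lemma theta_star_cvg : (fun k => th (xs k) (ys k)) @ \oo --> th x y.
Proof.
have /cvg_enormP h1 := xs_cvg; have /cvg_enormP h2 := ys_cvg.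
apply/cvg_enormP.
have h : (fun k => gamma * (Lfy c + Lgy c) * enorm (xs k - x) +
    enorm (ys k - y)) @ \oo --> gamma * (Lfy c + Lgy c) * 0 + 0.
  by apply: cvgD => //; apply: cvgMr.
rewrite mulr0 addr0 in h.
apply: (squeeze_cvgr _ (cvg_cst 0) h); near=> k.
by rewrite enorm_ge0 (theta_star_lip hD).
Unshelve. all: by end_near. Qed.

End Continuity.

Section Continuity2.
Context {R : realType} {n m : nat}.
Variables (D : problem R n m) (c : moduli R) (gamma c_alpha p : R).
Hypothesis hD : standing D c.
Hypothesis Y_ne : dY D !=set0.
Hypothesis gamma0 : 0 < gamma.
Hypothesis c_alpha0 : 0 < c_alpha.

Local Notation X := (dX D).
Local Notation Y := (dY D).
Local Notation th := (theta_star D gamma).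

Definition dual_lip : R :=
  (Lfx c + Lg1 c) + (Lfx c + Lg2 c) * (gamma * (Lfy c + Lgy c) + 1)
  + rhov1 c c_alpha.

Lemma dual_lip_ge0 x y : X x -> Y y -> 0 <= dual_lip.
Proof.
move=> Xx Yy; have [a1 _] := gradx_f_lip hD; have [a2 _] := gradx_g_lipx hD Yy.
have [a3 _] := gradx_g_lipy hD Xx; have [a4 _] := grady_f_lip hD.
have a5 := Lgy_ge0 hD; have [r1 _ _] := f_wconvex hD; have [r2 _ _] := g_wconvex hD.
have a6 := mulr_ge0 (addr_ge0 a1 a3) (addr_ge0 (mulr_ge0 (ltW gamma0) (addr_ge0
  a4 a5)) ler01).
by rewrite /dual_lip /rhov1; have := ltW c_alpha0; lra.
Qed.

(** [dual_var] is Lipschitz because the lower-level solution is, so a neighborhood in the KL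
    property can be replaced by a ball for z = (x, y) alone. *)
Lemma merit_point_lip x y x' y' : X x -> Y y -> X x' -> Y y' ->
  enorm (merit_point D c gamma c_alpha x y - merit_point D c gamma c_alpha x' y')
  <= (1 + dual_lip) * enorm (row_mx x y - row_mx x' y').
Proof.
move=> Xx Yy Xx' Yy'; rewrite /merit_point row_mxB.
apply: le_trans (enorm_row_mx_le _ _) _; rewrite mulrDl mul1r lerD2l.
have Yt : Y (th x y) by exact: (theta_starY hD).
have Yt' : Y (th x' y') by exact: (theta_starY hD).
have a := enorm_row_mxl (x - x') (y - y'); have b := enorm_row_mxr (x - x') (y - y').
rewrite row_mxB.
have h1 := gphix_lip_x hD Xx Xx' Yt; have h2 := gphix_lip_y hD Xx' Yt Yt'.
have h3 := theta_star_lip hD Y_ne gamma0 y y' Xx Xx'.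
have [a1 _] := gradx_f_lip hD; have [a2 _] := gradx_g_lipx hD Yy.
have [a3 _] := gradx_g_lipy hD Xx; have [a4 _] := grady_f_lip hD.
have a5 := Lgy_ge0 hD; have [r1 _ _] := f_wconvex hD; have [r2 _ _] := g_wconvex hD.
have r0 : 0 <= rhov1 c c_alpha by rewrite /rhov1 !addr_ge0// divr_ge0// ltW.
have E (A B C a' b' : 'rV[R]_n) (r : R) :
    (A + r *: a') - (C + r *: b') = (A - B) + (B - C) + r *: (a' - b').
  by rewrite subrKA scalerBr opprD addrACA.
rewrite /dual_var (E _ (gphix D x' (th x y))).
apply: le_trans (enormD _ _) _; rewrite enormZ (ger0_norm r0) /dual_lip [leRHS]mulrDl.
apply: lerD; last by rewrite ler_wpM2l.
apply: le_trans (enormD _ _) _; rewrite [leRHS]mulrDl; apply: lerD.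
  by apply: le_trans h1 _; rewrite ler_wpM2l// addr_ge0.
apply: le_trans h2 _; rewrite -mulrA; apply: ler_wpM2l; first by rewrite addr_ge0.
apply: le_trans h3 _; rewrite [leRHS]mulrDl mul1r; apply: lerD => //.
by apply: ler_wpM2l => //; rewrite mulr_ge0 ?addr_ge0// ltW.
Qed.

Lemma merit_point_cvg xs ys x y : (forall k, X (xs k)) -> (forall k, Y (ys k)) ->
  X x -> Y y -> xs @ \oo --> x -> ys @ \oo --> y ->
  (fun k => merit_point D c gamma c_alpha (xs k) (ys k)) @ \oo -->
    merit_point D c gamma c_alpha x y.
Proof.
move=> Xxs Yys Xx Yy cx cy; apply/cvg_enormP.
have /cvg_enormP h := cvg_row_mx cx cy.
have h' : (fun k => (1 + dual_lip) * enorm (row_mx (xs k) (ys k) - row_mx x y)) @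
  \oo --> (0 : R).
  by rewrite -(mulr0 (1 + dual_lip)); apply: cvgMr.
apply: (squeeze_cvgr _ (cvg_cst 0) h'); near=> k.
by rewrite enorm_ge0 merit_point_lip.
Unshelve. all: by end_near. Qed.

Lemma gap_cvg xs ys ts x y t : (forall k, X (xs k)) -> (forall k, Y (ys k)) ->
  (forall k, Y (ts k)) -> X x -> Y y -> Y t ->
  xs @ \oo --> x -> ys @ \oo --> y -> ts @ \oo --> t ->
  (fun k => vphi D (xs k) (ys k) - vphi D (xs k) (ts k)
     - (2 * gamma)^-1 * enorm (ts k - ys k) ^+ 2) @ \oo -->
  vphi D x y - vphi D x t - (2 * gamma)^-1 * enorm (t - y) ^+ 2.
Proof.
move=> Xxs Yys Yts Xx Yy Yt cx cy ct.
have c1 := joint_cvg Xxs Yys Xx Yy cx cy (phi_cont hD).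
have c2 := joint_cvg Xxs Yts Xx Yt cx ct (phi_cont hD).
apply: cvgB; first exact: cvgB.
by apply: cvgMr; apply: cvg_sqr_enorm; exact: cvgB.
Qed.

Lemma penalty_cvg xs ys x y : (forall k, X (xs k)) -> (forall k, Y (ys k)) ->
  X x -> Y y -> xs @ \oo --> x -> ys @ \oo --> y ->
  (fun k => penalty D gamma p (xs k) (ys k)) @ \oo --> penalty D gamma p x y.
Proof.
move=> Xxs Yys Xx Yy cx cy.
have ct := theta_star_cvg hD Y_ne gamma0 Xxs Xx cx cy.
have Yt : Y (th x y) by exact: (theta_starY hD).
have Yts k : Y (th (xs k) (ys k)) by exact: (theta_starY hD).
have c1 := joint_cvg Xxs Yys Xx Yy cx cy (F_cont hD).
have c2 := gap_cvg Xxs Yys Yts Xx Yy Yt cx cy ct.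
have E a b : X a -> penalty D gamma p a b = p^-1 * dF D a b +
   (vphi D a b - vphi D a (th a b) - (2 * gamma)^-1 * enorm (th a b - b) ^+ 2).
  by move=> Xa; rewrite /penalty (envelopeE hD)//; ring.
rewrite E//; under eq_fun do rewrite E//.
by apply: cvgD => //; exact: cvgMr.
Qed.

End Continuity2.

(** * Convergence and stationarity of the limit *)

Section Limit.
Context {R : realType} {n m : nat}.
Variables (D : problem R n m) (c : moduli R) (gamma c_alpha p a C eta : R).
Hypothesis hD : standing D c.
Hypothesis gamma0 : 0 < gamma.
Hypothesis gamma_rho : gamma * (rhof2 c + rhog2 c) < 1.
Hypothesis c_alpha0 : 0 < c_alpha.
Hypothesis p0 : 0 < p.

Local Notation X := (dX D).
Local Notation Y := (dY D).
Local Notation gphix := (gphix D).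
Local Notation th := (theta_star D gamma).
Local Notation value := (penalty D gamma p).
Local Notation merit := (merit D c gamma c_alpha p).
Local Notation mpoint := (merit_point D c gamma c_alpha).

(* The x- and y-blocks of a regular subgradient of the merit function at
   merit_point x y; its u-block is 0. *)
Definition merit_dx x y nu : 'rV[R]_n :=
  p^-1 *: gradx (dF D) x y + gphix x y - gphix x (th x y) + nu.

Definition merit_dy x y xi : 'rV[R]_m :=
  p^-1 *: grady (dF D) x y + grady (df D) x y + xi - gamma^-1 *: (y - th x y).

Variables (xs : nat -> 'rV[R]_n) (ys : nat -> 'rV[R]_m) (err : nat -> R).
Variables (nus : nat -> 'rV[R]_n) (xis : nat -> 'rV[R]_m).

Let zs k := row_mx (xs k) (ys k).
Let Del k := enorm (zs k.+1 - zs k).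

Hypothesis Xxs : forall k, X (xs k).
Hypothesis Yys : forall k, Y (ys k).
Hypothesis a0 : 0 < a.
Hypothesis C0 : 0 <= C.
Hypothesis eta0 : 0 < eta.
Hypothesis err0 : forall k, 0 <= err k.
Hypothesis err_tails : small_tails err.
Hypothesis werr_tails : small_tails (fun k => pweight eta k * err k ^+ 2).
Hypothesis descent : forall k,
  value (xs k.+1) (ys k.+1) + a * Del k ^+ 2 <= value (xs k) (ys k) + err k ^+ 2.
Hypothesis nusP : forall k q, X q -> dot (nus k) (q - xs k.+1) <= 0.
Hypothesis xisP : forall k, convex_subgrad Y (dg D (xs k.+1)) (ys k.+1) (xis k).
Hypothesis dx_le : forall k,
  enorm (merit_dx (xs k.+1) (ys k.+1) (nus k)) <= C * (Del k + err k).
Hypothesis dy_le : forall k,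
  enorm (merit_dy (xs k.+1) (ys k.+1) (xis k)) <= C * (Del k + err k).

Let Y_ne : Y !=set0. Proof. by exists (ys 0%N); exact: Yys. Qed.

Let Del0 k : 0 <= Del k. Proof. exact: enorm_ge0. Qed.

Let err2_tails : small_tails (fun k => err k ^+ 2).
Proof.
apply: (small_tails_le (C := 1) _ _ ler01 _ werr_tails).
- by move=> k; exact: sqr_ge0.
- by move=> k; rewrite mulr_ge0 ?sqr_ge0// ltW// pweight_gt0.
exists 0%N => k _; rewrite mul1r; apply: ler_peMl; first exact: sqr_ge0.
by apply: le_trans (pweight_ge eta0 k); rewrite ler1n.
Qed.

Let value_cvg_lim : exists l : R, (fun k => value (xs k) (ys k)) @ \oo --> l.
Proof.
apply: (@quasi_monotone_cvg _ _ (fun k => err k ^+ 2) (p^-1 * Finf D)) => //.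
- by move=> k; exact: sqr_ge0.
- by move=> k; exact: (penalty_ge hD).
- move=> k; have := descent k; have := mulr_ge0 (ltW a0) (sqr_ge0 (Del k)); lra.
Qed.

Lemma steps_cvg0 : Del @ \oo --> (0 : R).
Proof.
have [l hl] := value_cvg_lim.
have hl1 : (fun k => value (xs k.+1) (ys k.+1)) @ \oo --> l.
  exact: (@cvg_subseq _ (fun k => value (xs k) (ys k)) l S (fun k => leqnSn k) hl).
have h1 : (fun k => a^-1 * (value (xs k) (ys k) - value (xs k.+1) (ys k.+1) + err k ^+ 2))
    @ \oo --> a^-1 * (l - l + 0).
  apply: cvgMr; apply: cvgD; last exact: (small_tails_cvg0 (fun k => sqr_ge0 _)
    err2_tails).
  exact: cvgB hl hl1.
rewrite subrr addr0 mulr0 in h1.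
have h2 : (fun k => Del k ^+ 2) @ \oo --> (0 : R).
  apply: (squeeze_cvgr _ (cvg_cst 0) h1); near=> k; rewrite sqr_ge0/=.
  by rewrite ler_pdivlMl//; have := descent k; lra.
have -> : Del = @Num.sqrt R \o (fun k => Del k ^+ 2).
  by apply/funext => k; rewrite /= sqrtr_sqr ger0_norm.
by rewrite -[X in _ --> X]sqrtr0; exact: (cvg_comp _ _ h2 (@sqrt_continuous R 0)).
Unshelve. all: by end_near. Qed.

Let bound_cvg0 : (fun k => C * (Del k + err k)) @ \oo --> (0 : R).
Proof.
have h : (fun k => C * (Del k + err k)) @ \oo --> C * (0 + 0).
  by apply: cvgMr; apply: cvgD; [exact: steps_cvg0|exact: small_tails_cvg0].
by rewrite addr0 mulr0 in h.
Qed.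

Let grad_vec k : 'rV[R]_(n + m + n) :=
  row_mx (row_mx (merit_dx (xs k.+1) (ys k.+1) (nus k))
                 (merit_dy (xs k.+1) (ys k.+1) (xis k))) 0.

Let grad_vec_regular k :
  regular_subdiff merit (mpoint (xs k.+1) (ys k.+1)) (grad_vec k).
Proof.
rewrite /grad_vec /merit_dx /merit_dy; apply: (merit_regular hD) => //.
exact: nusP.
Qed.

Let grad_vec_le k : enorm (grad_vec k) <= 2 * (C * (Del k + err k)).
Proof.
rewrite /grad_vec enorm_row_mx0; apply: le_trans (enorm_row_mx_le _ _) _.
by rewrite mulr_natl mulr2n; exact: lerD.
Qed.

Hypothesis bounded : bounded_set (range zs).
Hypothesis KL : KL_function merit.

(* The iterates cannot leave a small ball around a cluster point: as long as
   they stay in it, the KL inequality bounds the total length of the steps. *)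
Lemma iterates_cvg : exists xbar ybar,
  [/\ X xbar, Y ybar, xs @ \oo --> xbar & ys @ \oo --> ybar].
Proof.
have [zbar cl] := bounded_cluster bounded.
have [sigma hs cz] := cluster_subsequence cl.
set xbar := lsubmx zbar; set ybar := rsubmx zbar.
have cx : (fun k => xs (sigma k)) @ \oo --> xbar.
  by have := cvg_lsubmx cz; under eq_fun do rewrite row_mxKl.
have cy : (fun k => ys (sigma k)) @ \oo --> ybar.
  by have := cvg_rsubmx cz; under eq_fun do rewrite row_mxKr.
have Xb : X xbar by exact: (cvg_closed_seq (closed_X hD) _ cx).
have Yb : Y ybar by exact: (cvg_closed_seq (closed_Y hD) _ cy).
have Ez : zbar = row_mx xbar ybar by rewrite hsubmxK.
have [l hl] := value_cvg_lim.
have h1 := @penalty_cvg _ _ _ D c gamma p hD Y_ne gamma0 _ _ _ _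
  (fun k => Xxs (sigma k)) (fun k => Yys (sigma k)) Xb Yb cx cy.
(* The whole sequence of values converges to the value at the cluster point, so [del] below tends to
   0 and measures the merit function relative to that point. *)
have El : l = value xbar ybar.
  have h2 := @cvg_subseq _ (fun k => value (xs k) (ys k)) l sigma (fun k => ltnW
    (hs k)) hl.
  exact: (cvg_unique _ h2 h1).
(* The KL property is available only where the subdifferential is nonempty; 0 is a limit of the
   subgradients along the subsequence. Their index is [(sigma k).-1] because [grad_vec k] lives at
   the iterate k + 1. *)
have sub0 : subdiff merit (mpoint xbar ybar) 0.
  split; first by rewrite (merit_pointE p hD).
  exists (fun k => mpoint (xs (sigma k)) (ys (sigma k))), (fun k => grad_vec
    (sigma k).-1).
  have sg k : (sigma k).-1.+1 = sigma k by rewrite prednK// (leq_ltn_trans _ (hs k)).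
  split.
  - exact: (merit_point_cvg hD Y_ne gamma0 c_alpha0).
  - rewrite (merit_pointE p hD)//; under eq_fun do rewrite (merit_pointE p hD)//.
    apply: cvg_EFin; first by near=> k.
    apply: cvgB; last exact: cvg_cst.
    exact: h1.
  - by move=> k; have := grad_vec_regular (sigma k).-1; rewrite sg.
  - apply/cvg_enormP.
    have h : (fun k => 2 * (C * (Del (sigma k).-1 + err (sigma k).-1))) @ \oo -->
      2 * (0 : R).
      apply: cvgMr; apply: (@cvg_subseq _ (fun k => C * (Del k + err k)) 0 (fun k
        => (sigma k).-1) _ bound_cvg0) => k.
      by have := hs k; case: (sigma k).
    rewrite mulr0 in h.
    apply: (squeeze_cvgr _ (cvg_cst 0) h); near=> k.
    by rewrite enorm_ge0 subr0 grad_vec_le.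
have [_ _ _ /(_ _ (ex_intro _ _ sub0))] := KL.
move=> [zeta [zeta0 [psi [psiP [U [nU HU]]]]]].
have [r r0 Hr] := near_enormP nU.
have K1 : 0 < 1 + dual_lip c gamma c_alpha.
  by have := dual_lip_ge0 hD gamma0 c_alpha0 Xb Yb; lra.
pose r' := r / (1 + dual_lip c gamma c_alpha).
have r'0 : 0 < r' by rewrite divr_gt0.
pose del k := value (xs k) (ys k) - value xbar ybar.
have del_cvg : del @ \oo --> (0 : R).
  rewrite -(subrr (value xbar ybar)); apply: cvgB; last exact: cvg_cst.
  by rewrite -El.
have desc k : del k.+1 + a * Del k ^+ 2 <= del k + err k ^+ 2.
  by rewrite /del addrAC [leRHS]addrAC lerD2r.
have KLk k : enorm (zs k.+1 - zbar) < r' -> 0 < del k.+1 ->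
    ((del k.+1)%:E < zeta)%E ->
    1 <= derive1 psi (del k.+1) * (2 * C * (Del k + err k)).
  move=> zr d0 dz.
  have Um : U (mpoint (xs k.+1) (ys k.+1)).
    apply: Hr; apply: le_lt_trans (merit_point_lip hD Y_ne gamma0 c_alpha0 _ _ Xb
      Yb) _ => //.
    by rewrite -Ez mulrC -ltr_pdivlMr.
  have := HU _ Um; rewrite !(merit_pointE p hD)// lte_fin -EFinB.
  have -> : value (xs k.+1) (ys k.+1) - p^-1 * Finf D -
     (value xbar ybar - p^-1 * Finf D) = del k.+1 by rewrite /del; ring.
  have d1 : value xbar ybar - p^-1 * Finf D < value (xs k.+1) (ys k.+1) - p^-1 * Finf D.
    by rewrite ltrD2r -subr_gt0.
  move=> /(_ d1); rewrite /=.
  have -> : ((value (xs k.+1) (ys k.+1) - p^-1 * Finf D)%:E <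
     (value xbar ybar - p^-1 * Finf D)%:E + zeta)%E.
    rewrite -lteBlDl// -EFinB (_ : _ - _ = del k.+1)//.
    by rewrite /del; ring.
  move=> /(_ isT) H.
  have dp : 0 < derive1 psi (del k.+1) by have [_ _ _ _] := psiP; apply.
  rewrite -lee_fin; apply: le_trans H _; rewrite EFinM.
  apply: lee_wpmul2l; first by rewrite lee_fin ltW.
  apply: (@le_trans _ _ (enorm (grad_vec k))%:E).
    apply: ereal_inf_lbound; exists (grad_vec k) => //.
    exact/regular_subdiff_subdiff/grad_vec_regular.
  by rewrite lee_fin; apply: le_trans (grad_vec_le k) _; rewrite mulrA.
have C20 : 0 <= 2 * C by rewrite mulr_ge0.
have FL := KL_finite_length zeta0 psiP a0 C20 eta0 Del0 err0 desc del_cvg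
  err_tails werr_tails.
have r4 : 0 < r' / 4 by rewrite divr_gt0.
have [K0 HK0] := FL _ r4.
have [K K0K zK] := cl (r' / 4) K0 r4.
(* By strong induction, the earlier iterates lie in the ball, so the KL inequality bounds the path
   from K to J by r'/4; the starting point is within r'/4 of the cluster point. *)
have trap J : (K <= J)%N -> enorm (zs J - zbar) < r'.
  have [N] := ubnP J; elim: N J => // N IH J; rewrite ltnS => JN KJ.
  have sumle : \sum_(K <= k < J) Del k <= r' / 4.
    apply: HK0 => // k Kk kJ; apply: KLk; apply: IH; first exact: leq_trans kJ JN.
    exact: leqW.
  have := enorm_triangle (zs K) (zs J) zbar; have := enorm_sum_steps zs KJ.
  rewrite -/Del; move: sumle zK r'0.
  move: (enorm (zs J - zbar)) (enorm (zs J - zs K)) (enorm (zs K - zbar)) => q1 q2 q3.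
  rewrite /Del; lra.
(* The iterates from K on are now trapped, so the length estimate restarts, for any e, from an index
   within e/3 of the cluster point. *)
have cvz : zs @ \oo --> zbar.
  apply/cvg_enormP/cvgrPdist_le => e e0.
  have e3 : 0 < e / 3 by rewrite divr_gt0.
  have [K2 HK2] := FL _ e3.
  have [j j2 zj] := cl (e / 3) (maxn K K2) e3.
  have [Kj K2j] : (K <= j)%N /\ (K2 <= j)%N.
    by split; apply: leq_trans j2; rewrite ?leq_maxl ?leq_maxr.
  exists j => // J /= jJ; rewrite sub0r normrN ger0_norm ?enorm_ge0//.
  have sumle : \sum_(j <= k < J) Del k <= e / 3.
    apply: HK2 => // k jk _; apply: KLk; apply: trap; apply: leqW.
    exact: leq_trans jk.
  have := enorm_triangle (zs j) (zs J) zbar; have := enorm_sum_steps zs jJ.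
  rewrite /Del in sumle *; lra.
exists xbar, ybar; split => //.
  by have := cvg_lsubmx cvz; under eq_fun do rewrite row_mxKl.
by have := cvg_rsubmx cvz; under eq_fun do rewrite row_mxKr.
Unshelve. all: by end_near. Qed.

(** The blocks of the merit subgradient tend to 0 and all their smooth terms converge, which forces
    [nus] and [xis] to converge. Their limits inherit the normality and the subgradient
    inequality. *)
Lemma limit_stationary xbar ybar : X xbar -> Y ybar ->
  xs @ \oo --> xbar -> ys @ \oo --> ybar ->
  exists nu xi, [/\ forall q, X q -> dot nu (q - xbar) <= 0,
    convex_subgrad Y (dg D xbar) ybar xi,
    merit_dx xbar ybar nu = 0 & merit_dy xbar ybar xi = 0].
Proof.
move=> Xb Yb cx0 cy0.
have cx : (fun k => xs k.+1) @ \oo --> xbar by exact: (@cvg_subseq _ xs xbar S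
  (fun k => leqnSn k) cx0).
have cy : (fun k => ys k.+1) @ \oo --> ybar by exact: (@cvg_subseq _ ys ybar S
  (fun k => leqnSn k) cy0).
have Xs k : X (xs k.+1) by [].
have Ys k : Y (ys k.+1) by [].
have ct := theta_star_cvg hD Y_ne gamma0 Xs Xb cx cy.
have Ybt : Y (th xbar ybar) by exact: (theta_starY hD).
have Yts k : Y (th (xs k.+1) (ys k.+1)) by exact: (theta_starY hD).
have cFx := joint_lip_cvg Xs Ys Xb Yb cx cy (gradx_F_lip hD).
have cFy := joint_lip_cvg Xs Ys Xb Yb cx cy (grady_F_lip hD).
have cfy := joint_lip_cvg Xs Ys Xb Yb cx cy (grady_f_lip hD).
have cg1 := gphix_cvg hD Xs Ys Xb Yb cx cy.
have cg2 := gphix_cvg hD Xs Yts Xb Ybt cx ct.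
have cpFx : (fun k => p^-1 *: gradx (dF D) (xs k.+1) (ys k.+1)) @ \oo -->
    p^-1 *: gradx (dF D) xbar ybar by apply: cvgZr; exact: cFx.
have cpFy : (fun k => p^-1 *: grady (dF D) (xs k.+1) (ys k.+1)) @ \oo -->
    p^-1 *: grady (dF D) xbar ybar by apply: cvgZr; exact: cFy.
have cyt : (fun k => ys k.+1 - th (xs k.+1) (ys k.+1)) @ \oo --> ybar - th xbar ybar.
  exact: cvgB cy ct.
have cgt : (fun k => gamma^-1 *: (ys k.+1 - th (xs k.+1) (ys k.+1))) @ \oo -->
    gamma^-1 *: (ybar - th xbar ybar) by apply: cvgZr; exact: cyt.
have vanish d (w : nat -> 'rV[R]_d) : (forall k, enorm (w k) <= C * (Del k + err k)) ->
    w @ \oo --> (0 : 'rV[R]_d).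
  move=> hw; apply/cvg_enormP; apply: (squeeze_cvgr _ (cvg_cst 0) bound_cvg0).
  by near=> k; rewrite subr0 enorm_ge0 hw.
have cwx := vanish _ _ dx_le; have cwy := vanish _ _ dy_le.
have cnu : nus @ \oo --> 0 - (p^-1 *: gradx (dF D) xbar ybar + gphix xbar ybar
    - gphix xbar (th xbar ybar)).
  have -> : nus = (fun k => merit_dx (xs k.+1) (ys k.+1) (nus k) -
      (p^-1 *: gradx (dF D) (xs k.+1) (ys k.+1) + gphix (xs k.+1) (ys k.+1)
      - gphix (xs k.+1) (th (xs k.+1) (ys k.+1)))).
    by apply/funext => k; rewrite /merit_dx addrAC subrr add0r.
  exact: cvgB cwx (cvgB (cvgD cpFx cg1) cg2).
have cxi : xis @ \oo --> 0 - (p^-1 *: grady (dF D) xbar ybar + grady (df D) xbar ybar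
    - gamma^-1 *: (ybar - th xbar ybar)).
  have -> : xis = (fun k => merit_dy (xs k.+1) (ys k.+1) (xis k) -
      (p^-1 *: grady (dF D) (xs k.+1) (ys k.+1) + grady (df D) (xs k.+1) (ys k.+1)
      - gamma^-1 *: (ys k.+1 - th (xs k.+1) (ys k.+1)))).
    apply/funext => k; rewrite /merit_dy (addrAC _ (xis k)).
    by rewrite [RHS]addrAC subrr add0r.
  exact: cvgB cwy (cvgB (cvgD cpFy cfy) cgt).
set nu := 0 - _ in cnu; set xi := 0 - _ in cxi.
exists nu, xi; split.
- move=> q Xq.
  have L : (fun k => dot (nus k) (q - xs k.+1)) @ \oo --> dot nu (q - xbar).
    have cqx : (fun k => q - xs k.+1) @ \oo --> q - xbar by exact: cvgB (cvg_cst q) cx.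
    exact: cvg_dot cnu cqx.
  by apply: (cvgr_to_le L); near=> k; exact: nusP.
- split=> // t Yt.
  have cg := joint_cvg Xs Ys Xb Yb cx cy (g_cont hD).
  have cgt' := joint_cvg Xs (fun=> Yt) Xb Yt cx (cvg_cst t) (g_cont hD).
  (* The function g(x_(k+1), .) varies with k as well; its values at t and at y_(k+1) converge by
     joint continuity. *)
  have L : (fun k => dg D (xs k.+1) t - (dg D (xs k.+1) (ys k.+1) + dot (xis k)
    (t - ys k.+1)))
      @ \oo --> dg D xbar t - (dg D xbar ybar + dot xi (t - ybar)).
    have cty : (fun k => t - ys k.+1) @ \oo --> t - ybar by exact: cvgB (cvg_cst t) cy.
    have cd := cvg_dot cxi cty.
    by apply: cvgB; [exact: cgt'|apply: cvgD; [exact: cg|exact: cd]].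
  rewrite -subr_ge0; apply: (cvgr_to_ge L); near=> k.
  by rewrite subr_ge0; have [_] := xisP k; apply.
- by rewrite /merit_dx /nu addrCA subrr addr0.
- by rewrite /merit_dy addrAC /xi addrCA subrr addr0.
Unshelve. all: by end_near. Qed.

End Limit.

(** * From stationarity to the KKT conditions *)

Section KKT.
Context {R : realType} {n m : nat}.
Variables (D : problem R n m) (c : moduli R) (gamma p : R).
Hypothesis hD : standing D c.
Hypothesis Y_ne : dY D !=set0.
Hypothesis gamma0 : 0 < gamma.
Hypothesis gamma_rho : gamma * (rhof2 c + rhog2 c) < 1.
Hypothesis p0 : 0 < p.

Local Notation X := (dX D).
Local Notation Y := (dY D).
Local Notation th := (theta_star D gamma).

(** Pairing the x-gradient with a y-subgradient gives a regular subgradient of g + delta_(X x Y):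
    the error in [g_lower] is quadratic. *)
Lemma subgrad_subdiff_g x y xi : X x -> convex_subgrad Y (dg D x) y xi ->
  subdiff_g D x y (row_mx (gradx (dg D) x y) xi).
Proof.
move=> Xx Hxi; have Yy := Hxi.1; apply: regular_subdiff_subdiff.
have Sz : dXY D (row_mx x y) by exact/prodset_row.
split; first by rewrite /restr asboolT.
move=> e e0.
have [L1 _] := gradx_g_lipx hD Yy; have [L2 _] := gradx_g_lipy hD Xx.
pose C := Lg1 c + Lg2 c + 1.
have C0 : 0 < C by rewrite /C; lra.
near=> z; rewrite /restr (asboolT Sz); case: asboolP => [|_]; last by rewrite leey.
rewrite -(hsubmxK z) => /prodset_row[Xx' Yy'].
rewrite !joint_row -EFinD lee_fin row_mxB dot_row_mx.
set x' := lsubmx z in Xx' *; set y' := rsubmx z in Yy' *.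
have hz : enorm (row_mx (x' - x) (y' - y)) < e / C.
  rewrite -row_mxB (_ : row_mx x' y' = z) ?hsubmxK//.
  by near: z; apply: near_enorm; rewrite divr_gt0.
rewrite ltr_pdivlMr// in hz.
apply: le_trans (g_lower hD Xx Xx' Hxi Yy'); rewrite !addrA lerD2l.
rewrite lerN2.
have E := enorm_row_mx (x' - x) (y' - y).
have := enorm_ge0 (row_mx (x' - x) (y' - y)).
have := enorm_ge0 (x' - x); have := enorm_ge0 (y' - y).
move: (enorm (row_mx _ _)) (enorm (x' - x)) (enorm (y' - y)) hz E => s u v hz E v0 u0 s0.
have h1 : C * s ^+ 2 <= e * s by nra.
apply: le_trans h1; rewrite E /C.
have := mulr_ge0 L1 (sqr_ge0 u); have := mulr_ge0 L1 (sqr_ge0 v).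
have h2 : Lg2 c * v * u <= Lg2 c * (u ^+ 2 + v ^+ 2).
  by rewrite -mulrA; apply: ler_wpM2l => //; have := sqr_ge0 (u - v); nra.
have := sqr_ge0 u; have := sqr_ge0 v; lra.
Unshelve. all: by end_near. Qed.

(** Multiplying the stationarity of the merit function by p gives the KKT inclusion with lambda = p.
    The tolerance is the gap itself, so complementarity reads p * 0 = 0. *)
Lemma stationary_KKT x y nu xi : X x -> Y y ->
  (forall q, X q -> dot nu (q - x) <= 0) -> convex_subgrad Y (dg D x) y xi ->
  merit_dx D gamma p x y nu = 0 -> merit_dy D gamma p x y xi = 0 ->
  KKT_point D gamma (vphi D x y - envelope D gamma x y) x y.
Proof.
move=> Xx Yy Hnu Hxi Hx Hy; split=> //.
exists p; first exact: ltW.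
split; last by rewrite subrr mulr0.
exists (row_mx (gradx (dg D) x y) xi), (env_grad D gamma x y), (p *: row_mx nu 0).
split.
- exact: subgrad_subdiff_g.
- exact: (env_is_grad hD).
- split; first exact/prodset_row.
  move=> z; rewrite -(hsubmxK z) => /prodset_row[Xz _].
  rewrite row_mxB dotZl dot_row_mx dot0l addr0.
  by apply: mulr_ge0_le0; [exact: ltW|exact: Hnu].
- rewrite !grad_joint /env_grad opp_row_mx !add_row_mx !scale_row_mx !add_row_mx
  scaler0 addr0.
  have E d (G A B N : 'rV[R]_d) :
      G + p *: (A - B) + p *: N = p *: (p^-1 *: G + A - B + N).
    by apply/rowP => i; rewrite !mxE; field; rewrite gt_eqF.
  have E' d (G A B N : 'rV[R]_d) :
      G + p *: (A + N - B) = p *: (p^-1 *: G + A + N - B).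
    by apply/rowP => i; rewrite !mxE; field; rewrite gt_eqF.
  rewrite -/(gphix D x y) E E' -/(merit_dx D gamma p x y nu) -/(merit_dy D gamma
    p x y xi).
  by rewrite Hx Hy !scaler0 row_mx0.
Qed.

Lemma prox_limit_feasible (xs : nat -> 'rV[R]_n) (ys : nat -> 'rV[R]_m) x y :
  (forall k, X (xs k)) -> (forall k, Y (ys k)) -> X x -> Y y ->
  xs @ \oo --> x -> ys @ \oo --> y ->
  (fun k => enorm (ys k - prox_g D 1 (xs k) (ys k - grady (df D) (xs k) (ys k))))
    @ \oo --> (0 : R) ->
  vphi D x y <= envelope D gamma x y.
Proof.
move=> Xxs Yys Xx Yy cx cy cr.
pose ps k := prox_g D 1 (xs k) (ys k - grady (df D) (xs k) (ys k)).
have sub k : convex_subgrad Y (dg D (xs k)) (ps k)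
    (1^-1 *: (ys k - grady (df D) (xs k) (ys k) - ps k)).
  apply: (prox_restr_spec _ (closed_Y hD) (convex_Y hD) (g_convex hD (Xxs k)) _ Yy ltr01).
  exact: within_continuous_joint (g_cont hD) (Xxs k).
have Yps k : Y (ps k) := (sub k).1.
have cp : ps @ \oo --> y.
  have c0 : (fun k => ys k - ps k) @ \oo --> (0 : 'rV[R]_m).
    by apply/cvg_enormP; under eq_fun do rewrite subr0.
  have -> : ps = (fun k => ys k - (ys k - ps k)).
    by apply/funext => k; rewrite opprB addrC subrK.
  by rewrite -[X in _ --> X]subr0; exact: cvgB cy c0.
have cf := joint_lip_cvg Xxs Yys Xx Yy cx cy (grady_f_lip hD).
have cg := joint_cvg Xxs Yps Xx Yy cx cp (g_cont hD).
have cv : (fun k => ys k - grady (df D) (xs k) (ys k) - ps k) @ \oo -->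
    y - grady (df D) x y - y by exact: cvgB (cvgB cy cf) cp.
rewrite (envelopeE hD)//; set t := th x y.
have Yt : Y t by exact: (theta_starY hD).
apply: (@le_trans _ _ (vphi D x t)); last first.
  by rewrite lerDl mulr_ge0 ?sqr_ge0// invr_ge0 mulr_ge0// ltW.
have cgt : (fun k => dg D (xs k) t) @ \oo --> dg D x t.
  exact: (@joint_cvg _ _ _ D xs (fun=> t) x t Xxs (fun=> Yt) Xx Yt cx (cvg_cst t)
    _ (g_cont hD)).
have ct : (fun k => t - ps k) @ \oo --> t - y by exact: cvgB (cvg_cst t) cp.
have cd := cvg_dot cv ct.
have L : (fun k => dg D (xs k) t - (dg D (xs k) (ps k) +
    dot (ys k - grady (df D) (xs k) (ys k) - ps k) (t - ps k))) @ \oo -->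
    dg D x t - (dg D x y + dot (y - grady (df D) x y - y) (t - y)).
  by apply: cvgB; [exact: cgt|apply: cvgD; [exact: cg|exact: cd]].
have : 0 <= dg D x t - (dg D x y + dot (y - grady (df D) x y - y) (t - y)).
  apply: (cvgr_to_ge L); near=> k; rewrite subr_ge0.
  by have [_ /(_ t Yt)] := sub k; rewrite invr1 scale1r.
have := f_subgrad hD Xx Yy Yt.
by rewrite addrAC subrr add0r dotNl /vphi; lra.
Unshelve. all: by end_near. Qed.

End KKT.

(** * Iterates of AGILS *)

Section Trace.
Context {R : realType} {n m : nat}.
Variables (D : problem R n m) (c : moduli R) (P : params R) (T : trace R n m).
Hypothesis hD : standing D c.
Hypothesis hP : params_ok P.
Hypothesis hT : AGILS D P T.

Local Notation X := (dX D).
Local Notation Y := (dY D).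
Local Notation g := (dg D).
Local Notation gam := (gamma P).
Local Notation th := (theta_star D gam).

Let gamma0 : 0 < gam := gamma_gt0 hP.

Let Y_ne : Y !=set0. Proof. by exists (yk T 0%N); exact: y_init hT. Qed.

Lemma prox_g_subgrad t a b : 0 < t -> X a ->
  convex_subgrad Y (g a) (prox_g D t a b) (t^-1 *: (b - prox_g D t a b)).
Proof.
move=> t0 Xa; have [y0 Yy0] := Y_ne.
apply: (prox_restr_spec _ (closed_Y hD) (convex_Y hD) (g_convex hD Xa) _ Yy0 t0).
exact: within_continuous_joint (g_cont hD) Xa.
Qed.

Lemma xk_mem k : X (xk T k).
Proof.
elim: k => [|k IH]; first exact: x_init hT.
by rewrite (x_step hT); have [] := proj_spec (xk T k - alphak P k *: dxk D T k)
  (closed_X hD) (convex_X hD) IH.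
Qed.

Lemma yk_mem k : Y (yk T k).
Proof.
case: k => [|k]; first exact: y_init hT.
rewrite (y_step hT).
by have [] := prox_g_subgrad (ytk T k - betak P k *: dyk D P T k) (betak_gt0 hP
  k) (xk_mem k).
Qed.

Lemma thk_mem k : Y (thk T k).
Proof.
case: k => [|k]; first by rewrite (th_init hT); exact: tht_init hT.
by have [] := th_step hT k.
Qed.

Lemma thhk_mem k : Y (thhk T k).
Proof. by have [] := thh_step hT k. Qed.

Lemma pk_gt0 k : 0 < pk T k.
Proof.
elim: k => [|k IH]; first by rewrite (p_init hT); exact: p0_gt0 hP.
have rho0 := varrho_p_gt0 hP.
have pr : 0 < pk T k + varrho_p P by rewrite addr_gt0.
have := update_step hT k; rewrite /update.
case: ifP => _; first by case=> ->.
case: ifP => _; first by case=> ->.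
by move=> [yc [thc [_ _ _ _ /=]]]; case: ifP => _ [_ _ ->].
Qed.

(** The 1 accounts for the distance from t to its prox-gradient step, the rest for the distance from
    that step to the exact solution. *)
Definition error_const : R :=
  1 + gam * ((eta P)^-1 + Lfy c + gam^-1).

Lemma prox_step_error t a b : X a -> Y t ->
  enorm (prox_step D P t a b - th a b) <=
    gam * ((eta P)^-1 + Lfy c + gam^-1) * resid D P t a b.
Proof.
move=> Xa Yt; have e0 := eta_gt0 hP.
by apply: (theta_star_error hD Y_ne gamma0 Xa Yt e0); exact: prox_g_subgrad.
Qed.

Lemma resid_error t a b : X a -> Y t ->
  enorm (t - th a b) <= error_const * resid D P t a b.
Proof.
move=> Xa Yt; apply: le_trans (enorm_triangle (prox_step D P t a b) _ _) _.
by rewrite /error_const [leRHS]mulrDl mul1r lerD2l prox_step_error.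
Qed.

Lemma prox_const_ge0 : 0 <= gam * ((eta P)^-1 + Lfy c + gam^-1).
Proof.
have [L0 _] := grady_f_lip hD; have e0 := eta_gt0 hP.
by rewrite mulr_ge0 ?(ltW gamma0)// !addr_ge0 ?invr_ge0 ?(ltW gamma0)// ltW.
Qed.

Lemma error_const_ge1 : 1 <= error_const.
Proof. by rewrite lerDl prox_const_ge0. Qed.

(** A common bound on the residuals of theta^(k+1/2) and, for k > 0, of theta^k. *)
Definition tolerance k : R :=
  Num.max (sk P k) (tauk P k * resid D P (thk T k.-1) (xk T k.-1) (yk T k.-1)).

Lemma tolerance_ge0 k : 0 <= tolerance k.
Proof. by rewrite le_max (sk_ge0 hP). Qed.

Lemma resid_tolerance k : resid D P (thk T k.+1) (xk T k.+1) (yk T k.+1) <=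
  tolerance k.+1.
Proof. by have [] := th_step hT k. Qed.

Lemma tauk_ge0 k : 0 <= tauk P k.
Proof. by rewrite divr_ge0 ?powR_ge0// ltW// (tau0_gt0 hP). Qed.

(** The case k = 0 is excluded because the residual of the initial theta^0 is not controlled by a
    tolerance. *)
Lemma tolerance_rec k : (0 < k)%N ->
  tolerance k.+1 <= Num.max (sk P k.+1) (tauk P k.+1 * tolerance k).
Proof.
case: k => // k _; rewrite {1}/tolerance /= ge_max le_max lexx/= le_max.
apply/orP; right; apply: ler_wpM2l; first exact: tauk_ge0.
exact: resid_tolerance.
Qed.

Lemma thhk_error k : enorm (thhk T k - th (xk T k) (yk T k.+1)) <= error_const *
  tolerance k.
Proof.
apply: le_trans (resid_error _ (xk_mem k) (thhk_mem k)) _.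
apply: ler_wpM2l; first exact: le_trans ler01 error_const_ge1.
by have [] := thh_step hT k.
Qed.

Lemma thk_error k : enorm (thk T k.+1 - th (xk T k.+1) (yk T k.+1)) <=
  error_const * tolerance k.+1.
Proof.
apply: le_trans (resid_error _ (xk_mem _) (thk_mem _)) _.
apply: ler_wpM2l; first exact: le_trans ler01 error_const_ge1.
exact: resid_tolerance.
Qed.

(* Once the penalty parameter is constant, Case 2 and a rejected correction
   are excluded. *)
Lemma update_cases k : pk T k.+1 = pk T k -> ytk T k.+1 = yk T k.+1 ->
  enorm (thtk T k.+1 - th (xk T k.+1) (yk T k.+1)) <= error_const * tolerance k.+1 /\
  (c_p P * Num.min (pk T k)^-1 (tk D P T k) <= Deltak T k \/
   enorm (yk T k.+1 - prox_g D 1 (xk T k.+1)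
     (yk T k.+1 - grady (df D) (xk T k.+1) (yk T k.+1)))
     <= c_yt P / pk T k * Deltak T k).
Proof.
move=> pE yE.
have no : pk T k <> pk T k + varrho_p P.
  by apply/eqP; rewrite lt_eqF// ltrDl (varrho_p_gt0 hP).
have := update_step hT k; rewrite /update.
case: ifP => [h1 [_ _ ->]|_]; first by split; [exact: thk_error|left].
case: ifP => [_ [pE' _ _]|_]; first by case: no; rewrite -pE'.
move=> [yc [thc [Yyc hyc Ythc hthc /=]]]; case: ifP => _ [ytE thE pE'].
  (* An accepted candidate must coincide with y^(k+1). So its residual test applies to the iterate
     itself, and the new theta~ is a prox-gradient step covered by [prox_step_error]. *)
  have Ey : yc = yk T k.+1 by rewrite -yE ytE.
  rewrite Ey in hyc hthc thE *; split; last by right.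
  rewrite thE; apply: le_trans (prox_step_error _ (xk_mem _) Ythc) _.
  apply: ler_pM => //; first exact: prox_const_ge0.
    exact: enorm_ge0.
  by rewrite /error_const lerDr ler01.
by case: no; rewrite -pE'.
Qed.

Lemma y_step_subgrad k : convex_subgrad Y (g (xk T k)) (yk T k.+1)
  ((betak P k)^-1 *: (ytk T k - betak P k *: dyk D P T k - yk T k.+1)).
Proof.
rewrite (y_step hT); apply: prox_g_subgrad; [exact: betak_gt0 hP k|exact: xk_mem].
Qed.

Lemma x_step_proj k : X (xk T k.+1) /\ forall q, X q ->
  dot (xk T k - alphak P k *: dxk D T k - xk T k.+1) (q - xk T k.+1) <= 0.
Proof. by rewrite (x_step hT); exact: (proj_spec _ (closed_X hD) (convex_X hD)
  (xk_mem k)). Qed.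

Lemma dxkE k : dxk D T k = (pk T k)^-1 *: gradx (dF D) (xk T k) (yk T k.+1)
  + gphix D (xk T k) (yk T k.+1) - gphix D (xk T k) (thhk T k).
Proof.
rewrite /dxk (gradx_phi hD) ?xk_mem ?yk_mem//.
  by rewrite /gphix [in RHS]opprD [in RHS]addrA.
- exact: xk_mem.
- exact: yk_mem.
Qed.

End Trace.

(** * Iterations after the penalty parameter has settled *)

Section Tail.
Context {R : realType} {n m : nat}.
Variables (D : problem R n m) (c : moduli R) (P : params R) (T : trace R n m).
Variables (c_alpha c_beta alpha_low beta_low p : R).
Hypothesis hD : standing D c.
Hypothesis hP : params_ok P.
Hypothesis hT : AGILS D P T.
Hypothesis gamma_rho : gamma P * (rhof2 c + rhog2 c) < 1.
Hypothesis c_alpha0 : 0 < c_alpha.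
Hypothesis c_beta0 : 0 < c_beta.
Hypothesis alpha_low0 : 0 < alpha_low.
Hypothesis beta_low0 : 0 < beta_low.
Hypothesis halpha : forall k, alpha_low <= alphak P k <= 2 / (Lpsix c T k + c_alpha).
Hypothesis hbeta : forall k, beta_low <= betak P k <= 2 / (Lpsiy c T k + c_beta).

Local Notation X := (dX D).
Local Notation Y := (dY D).
Local Notation gam := (gamma P).
Local Notation th := (theta_star D gam).
Local Notation K := (error_const c P).
Local Notation tol := (tolerance D P T).
Local Notation z := (fun k => row_mx (xk T k) (yk T k)).

Let gamma0 : 0 < gam := gamma_gt0 hP.

Let Y_ne : Y !=set0. Proof. by exists (yk T 0%N); exact: y_init hT. Qed.

Definition settled k : Prop :=
  [/\ pk T k = p, ytk T k = yk T k &
      enorm (thtk T k - th (xk T k) (yk T k)) <= K * tol k].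

(** With Q the sum of the two coefficients from the descent estimates, 1 + Q turns Q t^2 into a
    bound by a square ((1 + Q) t)^2, and being at least 1 it also serves in the first-order bound on
    subgradients. *)
Definition err_scale : R :=
  1 + ((gam^-1 * K) ^+ 2 / c_beta + ((Lfx c + Lg2 c) * K) ^+ 2 / c_alpha).

Lemma err_scale_ge1 : 1 <= err_scale.
Proof. by rewrite lerDl addr_ge0// divr_ge0 ?sqr_ge0// ltW. Qed.

Let step_y k : settled k -> convex_subgrad Y (dg D (xk T k)) (yk T k.+1)
  ((betak P k)^-1 *: (yk T k - betak P k *: (p^-1 *: grady (dF D) (xk T k) (yk T k)
     + grady (df D) (xk T k) (yk T k) - gam^-1 *: (yk T k - thtk T k)) - yk T k.+1)).
Proof. by case=> pE yE _; have := y_step_subgrad hD hP hT k; rewrite /dyk pE yE. Qed.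

Let step_x k : settled k -> X (xk T k.+1) /\ forall q, X q ->
  dot (xk T k - alphak P k *: (p^-1 *: gradx (dF D) (xk T k) (yk T k.+1)
    + gphix D (xk T k) (yk T k.+1) - gphix D (xk T k) (thhk T k)) - xk T k.+1)
    (q - xk T k.+1) <= 0.
Proof. by case=> pE _ _; rewrite -pE -(dxkE hD hP hT); exact: (x_step_proj hD hT). Qed.

Let sqr_err (a b t k e : R) : 0 <= a -> 0 <= e -> e <= b * t -> 0 < k ->
  (a * e) ^+ 2 / k <= (a * b) ^+ 2 / k * t ^+ 2.
Proof.
move=> a0 e0 h k0; rewrite [leRHS]mulrAC -exprMn ler_pM2r ?invr_gt0// -mulrA.
have h' := ler_wpM2l a0 h.
have ae := mulr_ge0 a0 e0.
by rewrite ler_pXn2r// nnegrE//; exact: le_trans h'.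
Qed.

Let scale_sqr (Q t : R) : 0 <= Q -> Q * t ^+ 2 <= ((1 + Q) * t) ^+ 2.
Proof.
move=> Q0; rewrite [leRHS]exprMn ler_wpM2r ?sqr_ge0//.
by have := sqr_ge0 Q; rewrite sqrrD expr1n mul1r; lra.
Qed.

Let add_descents (v1 v2 v3 u w e1 e2 d e : R) :
  v1 + u <= v2 + e2 -> v2 + w <= v3 + e1 -> d <= u + w -> e1 + e2 <= e ->
  v1 + d <= v3 + e.
Proof. by lra. Qed.

Lemma settled_descent k : settled k ->
  penalty D gam p (xk T k.+1) (yk T k.+1)
    + Num.min c_alpha c_beta / 4 * enorm (z k.+1 - z k) ^+ 2 <=
  penalty D gam p (xk T k) (yk T k) + (err_scale * tol k) ^+ 2.
Proof.
move=> sk; have [pE yE thE] := sk.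
have p0 : 0 < p by rewrite -pE (pk_gt0 hP hT).
have Xk := xk_mem hD hT; have Yk := yk_mem hD hP hT.
have /andP[_ ha] := halpha k; have /andP[_ hb] := hbeta k.
rewrite /Lpsix pE in ha; rewrite /Lpsiy pE in hb.
have hy := y_descent hD Y_ne gamma0 c_beta0 p0 (Xk k) (Yk k) (betak_gt0 hP k) hb
  (step_y sk).
have hx := x_descent hD Y_ne gamma0 gamma_rho c_alpha0 p0 (Xk k) (Yk k) (thhk_mem hT k)
  (alphak_gt0 hP k) ha (step_y sk) (step_x sk).
have K0 : 0 <= K := le_trans ler01 (error_const_ge1 hD hP).
have t0 := tolerance_ge0 D T hP k.
have thhE := thhk_error hD hP hT k.
have [L1 _] := gradx_f_lip hD; have [L2 _] := gradx_g_lipy hD (Xk k).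
have gi : 0 < gam^-1 by rewrite invr_gt0.
have e1 : (gam^-1 * enorm (thtk T k - th (xk T k) (yk T k))) ^+ 2 / c_beta <=
    (gam^-1 * K) ^+ 2 / c_beta * tol k ^+ 2.
  exact: sqr_err (ltW gi) (enorm_ge0 _) thE c_beta0.
have e2 : ((Lfx c + Lg2 c) * enorm (thhk T k - th (xk T k) (yk T k.+1))) ^+ 2 / c_alpha <=
    ((Lfx c + Lg2 c) * K) ^+ 2 / c_alpha * tol k ^+ 2.
  exact: sqr_err (addr_ge0 L1 L2) (enorm_ge0 _) thhE c_alpha0.
have e3 : ((gam^-1 * K) ^+ 2 / c_beta + ((Lfx c + Lg2 c) * K) ^+ 2 / c_alpha) * tol k ^+ 2
    <= (err_scale * tol k) ^+ 2.
  by apply: scale_sqr; rewrite -(lerD2l 1) addr0 err_scale_ge1.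
have e4 : Num.min c_alpha c_beta / 4 * enorm (z k.+1 - z k) ^+ 2 <=
    c_alpha / 4 * enorm (xk T k.+1 - xk T k) ^+ 2 + c_beta / 4 * enorm (yk T k.+1
      - yk T k) ^+ 2.
  rewrite row_mxB enorm_row_mx mulrDr; apply: lerD; apply: ler_wpM2r; rewrite ?sqr_ge0//.
    by rewrite ler_pM2r ?invr_gt0// ge_min lexx.
  by rewrite ler_pM2r ?invr_gt0// ge_min lexx orbT.
rewrite [_ * tol k ^+ 2]mulrDl in e3.
have e5 := le_trans (lerD e1 e2) e3.
exact: add_descents hx hy e4 e5.
Qed.

(** The sum of the five coefficients of [subgrad_bound], with step sizes at their lower bounds and
    lower-level errors replaced by tolerances. *)
Definition grad_scale : R :=
  (p^-1 * LFx c + 2 * (Lfx c + Lg1 c)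
    + (Lfx c + Lg2 c) * (gam * (Lfy c + Lgy c)) + alpha_low^-1)
  + (Lfx c + Lg2 c) * K
  + (p^-1 * LFy c + Lfy c + Lgy c + (Lfy c + Lgy c))
  + (p^-1 * LFy c + Lfy c + beta_low^-1 + 2 * gam^-1)
  + gam^-1 * K.

Let combine {c1 c2 c3 c4 c5 u v s t b : R} :
  0 <= c1 -> 0 <= c2 -> 0 <= c3 -> 0 <= c4 -> 0 <= c5 ->
  0 <= u -> 0 <= v -> u <= s -> v <= s -> 0 <= t -> 1 <= b ->
  c1 * u + c2 * t <= (c1 + c2 + c3 + c4 + c5) * (s + b * t) /\
  c3 * u + c4 * v + c5 * t <= (c1 + c2 + c3 + c4 + c5) * (s + b * t).
Proof.
move=> c10 c20 c30 c40 c50 u0 v0 us vs t0 b1.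
have tb : t <= b * t by rewrite ler_peMl.
have h1 := ler_wpM2l c10 us; have h2 := ler_wpM2l c20 tb.
have h3 := ler_wpM2l c30 us; have h4 := ler_wpM2l c40 vs; have h5 := ler_wpM2l c50 tb.
have s0 : 0 <= s := le_trans u0 us.
have bt0 : 0 <= b * t := le_trans t0 tb.
have ps k : 0 <= k -> 0 <= k * s by move=> ?; rewrite mulr_ge0.
have pt k : 0 <= k -> 0 <= k * (b * t) by move=> ?; rewrite mulr_ge0.
have := ps _ c10; have := ps _ c20; have := ps _ c30; have := ps _ c40; have := ps _ c50.
have := pt _ c10; have := pt _ c20; have := pt _ c30; have := pt _ c40; have := pt _ c50.
move: (b * t) h2 h5 {tb bt0 ps pt} => w h2 h5 ? ? ? ? ? ? ? ? ? ?.
by split; lra.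
Qed.

Let scale_parts k : settled k ->
  [/\ 0 <= p^-1 * LFx c + 2 * (Lfx c + Lg1 c)
        + (Lfx c + Lg2 c) * (gam * (Lfy c + Lgy c)) + alpha_low^-1,
      0 <= (Lfx c + Lg2 c) * K,
      0 <= p^-1 * LFy c + Lfy c + Lgy c + (Lfy c + Lgy c),
      0 <= p^-1 * LFy c + Lfy c + beta_low^-1 + 2 * gam^-1 &
      0 <= gam^-1 * K].
Proof.
move=> [pE _ _]; have Xk := xk_mem hD hT; have Yk := yk_mem hD hP hT.
have p0 : 0 < p by rewrite -pE (pk_gt0 hP hT).
have K0 : 0 <= K := le_trans ler01 (error_const_ge1 hD hP).
have [L1 _] := gradx_f_lip hD; have [L2 _] := gradx_g_lipy hD (Xk k).
have [L3 _] := gradx_g_lipx hD (Yk k); have [L4 _] := grady_f_lip hD.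
have [L5 _] := gradx_F_lip hD; have [L6 _] := grady_F_lip hD; have L7 := Lgy_ge0 hD.
have [pi gi ai bi] : [/\ 0 <= p^-1, 0 <= gam^-1, 0 <= alpha_low^-1 & 0 <= beta_low^-1].
  by rewrite !invr_ge0 !ltW.
have g0 := ltW gamma0.
have two0 : 0 <= 2 :> R by [].
have L12 := addr_ge0 L1 L2; have L47 := addr_ge0 L4 L7.
split.
- exact: addr_ge0 (addr_ge0 (addr_ge0 (mulr_ge0 pi L5) (mulr_ge0 two0 (addr_ge0 L1 L3)))
    (mulr_ge0 L12 (mulr_ge0 g0 L47))) ai.
- exact: mulr_ge0 L12 K0.
- exact: addr_ge0 (addr_ge0 (addr_ge0 (mulr_ge0 pi L6) L4) L7) L47.
- exact: addr_ge0 (addr_ge0 (addr_ge0 (mulr_ge0 pi L6) L4) bi) (mulr_ge0 two0 gi).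
- exact: mulr_ge0 gi K0.
Qed.

Lemma grad_scale_ge0 k : settled k -> 0 <= grad_scale.
Proof.
by move=> /scale_parts[c1 c2 c3 c4 c5]; exact: addr_ge0 (addr_ge0 (addr_ge0
  (addr_ge0 c1 c2) c3) c4) c5.
Qed.

Lemma settled_subgrad k : settled k -> exists nu xi,
  [/\ forall q, X q -> dot nu (q - xk T k.+1) <= 0,
      convex_subgrad Y (dg D (xk T k.+1)) (yk T k.+1) xi,
      enorm (merit_dx D gam p (xk T k.+1) (yk T k.+1) nu) <=
        grad_scale * (enorm (z k.+1 - z k) + err_scale * tol k) &
      enorm (merit_dy D gam p (xk T k.+1) (yk T k.+1) xi) <=
        grad_scale * (enorm (z k.+1 - z k) + err_scale * tol k)].
Proof.
move=> sk; have [pE yE thE] := sk.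
have p0 : 0 < p by rewrite -pE (pk_gt0 hP hT).
have Xk := xk_mem hD hT; have Yk := yk_mem hD hP hT.
have /andP[ha _] := halpha k; have /andP[hb _] := hbeta k.
have ai : (alphak P k)^-1 <= alpha_low^-1 by rewrite lef_pV2 ?posrE// (alphak_gt0 hP).
have bi : (betak P k)^-1 <= beta_low^-1 by rewrite lef_pV2 ?posrE// (betak_gt0 hP).
have [nu [xi [h1 h2 h3 h4]]] := subgrad_bound hD Y_ne gamma0 p0 (Xk k) (Yk k)
  (thhk_mem hT k)
  (alphak_gt0 hP k) (betak_gt0 hP k) (step_y sk) (step_x sk) ai bi.
exists nu, xi.
have t0 := tolerance_ge0 D T hP k.
have thhE := thhk_error hD hP hT k.
have [c1 c2 c3 c4 c5] := scale_parts sk.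
have [L1 _] := gradx_f_lip hD; have [L2 _] := gradx_g_lipy hD (Xk k).
have gi : 0 <= gam^-1 by rewrite invr_ge0 ltW.
have [b1 b2] := combine c1 c2 c3 c4 c5 (enorm_ge0 (xk T k.+1 - xk T k))
  (enorm_ge0 (yk T k.+1 - yk T k)) (enorm_row_mxl _ _) (enorm_row_mxr _ _) t0
    err_scale_ge1.
have e1 := ler_wpM2l gi thE; rewrite mulrA in e1.
have e2 := ler_wpM2l (addr_ge0 L1 L2) thhE; rewrite mulrA in e2.
rewrite row_mxB; split.
- exact: h1.
- exact: h2.
- exact: le_trans h3 (le_trans (lerD (lexx _) e2) b1).
- exact: le_trans h4 (le_trans (lerD (lexx _) e1) b2).
Qed.

End Tail.

(** The extended inverse encodes 1/0 = +oo; in product form the case rho = 0 needs no separate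
    treatment later. *)
Lemma gamma_rho_lt1 (R : realType) (g rho : R) : 0 < g -> 0 <= rho ->
  (g%:E < rho%:E^-1)%E -> g * rho < 1.
Proof.
move=> g0; rewrite le_eqVlt => /orP[/eqP<- _|r0]; first by rewrite mulr0.
by rewrite inver gt_eqF// lte_fin -ltr_pdivlMr// div1r.
Qed.

(** * Feasibility of the limit *)

Section Feasible.
Context {R : realType} {n m : nat}.
Variables (D : problem R n m) (c : moduli R) (P : params R) (T : trace R n m) (p : R).
Hypothesis hD : standing D c.
Hypothesis hP : params_ok P.
Hypothesis hT : AGILS D P T.
Hypothesis p0 : 0 < p.

Local Notation X := (dX D).
Local Notation Y := (dY D).
Local Notation gam := (gamma P).

Let gamma0 : 0 < gam := gamma_gt0 hP.

Let Y_ne : Y !=set0. Proof. by exists (yk T 0%N); exact: y_init hT. Qed.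

(* If the correction is accepted infinitely often with ytk = yk, its tolerance
   bounds the prox residual of yk, so y minimizes phi x over Y and the gap
   vanishes.  Otherwise Case 1 holds eventually and forces tk to 0. *)
Lemma limit_feasible x y : X x -> Y y -> xk T @ \oo --> x -> yk T @ \oo --> y ->
  (fun k => Deltak T k) @ \oo --> (0 : R) ->
  tolerance D P T @ \oo --> (0 : R) ->
  (\forall k \near \oo, pk T k = p) -> (\forall k \near \oo, ytk T k = yk T k) ->
  vphi D x y - envelope D gam x y <= eps P.
Proof.
move=> Xx Yy cx cy cD ct [N1 _ Hp] [N2 _ Hy].
pose N := maxn N1 N2.
have cases k : (N <= k)%N -> enorm (thtk T k.+1 - theta_star D gam (xk T k.+1)
  (yk T k.+1)) <=
    error_const c P * tolerance D P T k.+1 /\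
  (c_p P * Num.min p^-1 (tk D P T k) <= Deltak T k \/
   enorm (yk T k.+1 - prox_g D 1 (xk T k.+1)
     (yk T k.+1 - grady (df D) (xk T k.+1) (yk T k.+1)))
     <= c_yt P / p * Deltak T k).
  rewrite geq_max => /andP[k1 k2].
  have e1 : pk T k = p by exact: Hp.
  have e2 : pk T k.+1 = p by apply: Hp => /=; exact: leqW.
  have e3 : ytk T k.+1 = yk T k.+1 by apply: Hy => /=; exact: leqW.
  by have := update_cases hD hP hT (etrans e2 (esym e1)) e3; rewrite e1.
have Xk := xk_mem hD hT; have Yk := yk_mem hD hP hT.
have [fr|ev] := pselect (forall K, exists2 k, (K <= k)%N &
    enorm (yk T k.+1 - prox_g D 1 (xk T k.+1)
     (yk T k.+1 - grady (df D) (xk T k.+1) (yk T k.+1)))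
     <= c_yt P / p * Deltak T k).
  have [sigma Hs] := choice (fun K => let: ex_intro2 k h1 h2 := fr K in ex_intro
    _ k (conj h1 h2)).
  have hs k : (k <= (sigma k).+1)%N by have [h _] := Hs k; exact: leqW.
  have cxs := @cvg_subseq _ (xk T) x (fun k => (sigma k).+1) hs cx.
  have cys := @cvg_subseq _ (yk T) y (fun k => (sigma k).+1) hs cy.
  have hs' k : (k <= sigma k)%N by case: (Hs k).
  have cDs := @cvg_subseq _ (fun k => Deltak T k) 0 sigma hs' cD.
  have cB : (fun k => c_yt P / p * Deltak T (sigma k)) @ \oo --> c_yt P / p * (0 : R).
    by apply: cvgMr; exact: cDs.
  rewrite mulr0 in cB.
  have := prox_limit_feasible hD Y_ne gamma0 (fun k => Xk (sigma k).+1)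
    (fun k => Yk (sigma k).+1) Xx Yy cxs cys.
  have c0 : (fun k => enorm (yk T (sigma k).+1 - prox_g D 1 (xk T (sigma k).+1)
      (yk T (sigma k).+1 - grady (df D) (xk T (sigma k).+1) (yk T (sigma k).+1))))
      @ \oo --> (0 : R).
    apply: (squeeze_cvgr _ (cvg_cst 0) cB); near=> k.
    by rewrite enorm_ge0; case: (Hs k).
  by move=> /(_ c0) h; have := eps_gt0 hP; lra.
have [K HK] : exists K, forall k, (K <= k)%N -> c_p P * Num.min p^-1 (tk D P T k)
  <= Deltak T k.
  have [K HK] := (existsNP _).2 ev.
  exists (maxn N K) => k; rewrite geq_max => /andP[Nk Kk].
  have [_ [//|h]] := cases k Nk.
  by case: HK; exists k.
have cp0 := c_p_gt0 hP.
have cxs := @cvg_subseq _ (xk T) x S (fun k => leqnSn k) cx.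
have cys := @cvg_subseq _ (yk T) y S (fun k => leqnSn k) cy.
have cts := @cvg_subseq _ (tolerance D P T) 0 S (fun k => leqnSn k) ct.
have cth := theta_star_cvg hD Y_ne gamma0 (fun k => Xk k.+1) Xx cxs cys.
set th := theta_star D gam x y in cth.
have Yth : Y th by exact: (theta_starY hD).
have cthk : (fun k => thk T k.+1) @ \oo --> th.
  have c0 : (fun k => thk T k.+1 - theta_star D gam (xk T k.+1) (yk T k.+1)) @
    \oo --> (0 : 'rV[R]_m).
    apply/cvg_enormP.
    have cB : (fun k => error_const c P * tolerance D P T k.+1) @ \oo -->
      error_const c P * (0 : R).
      by apply: cvgMr; exact: cts.
    rewrite mulr0 in cB.
    apply: (squeeze_cvgr _ (cvg_cst 0) cB); near=> k.
    by rewrite subr0 enorm_ge0 (thk_error hD hP hT).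
  have -> : (fun k => thk T k.+1) = (fun k => (thk T k.+1 - theta_star D gam (xk
    T k.+1) (yk T k.+1))
      + theta_star D gam (xk T k.+1) (yk T k.+1)) by apply/funext => k; rewrite subrK.
  by rewrite -[X in _ --> X]add0r; exact: cvgD c0 cth.
have cg := gap_cvg (gamma := gam) hD (fun k => Xk k.+1) (fun k => Yk k.+1)
  (fun k => thk_mem hT k.+1) Xx Yy Yth cxs cys cthk.
have cDc : (fun k => Deltak T k / c_p P) @ \oo --> (0 : R) / c_p P by exact: cvgMl.
rewrite mul0r in cDc.
have L : (fun k => (vphi D (xk T k.+1) (yk T k.+1) - vphi D (xk T k.+1) (thk T k.+1)
     - (2 * gam)^-1 * enorm (thk T k.+1 - yk T k.+1) ^+ 2) - Deltak T k / c_p P) @ \oo -->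
   (vphi D x y - vphi D x th - (2 * gam)^-1 * enorm (th - y) ^+ 2) - 0.
  exact: cvgB cg cDc.
rewrite subr0 in L.
rewrite (envelopeE hD)// -/th opprD addrA.
apply: (cvgr_to_le L); near=> k.
have Kk : (K <= k)%N by near: k; exists K.
(* The steps are eventually below c_p / p, so the minimum in the Case 1 test must be [tk], which is
   then at most Delta / c_p. *)
have small : Deltak T k < c_p P * p^-1.
  near: k; move/cvgrPdist_lt : cD => /(_ (c_p P * p^-1)).
  rewrite mulr_gt0 ?invr_gt0// => /(_ isT); apply: filterS => j.
  by rewrite sub0r normrN; apply: le_lt_trans; exact: ler_norm.
have := HK k Kk; have [pt|tp] := leP p^-1 (tk D P T k).
  by move=> h; have := lt_le_trans small h; rewrite ltxx.
rewrite mulrC -ler_pdivlMr// => ht.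
have : gap D P (xk T k.+1) (yk T k.+1) (thk T k.+1) - eps P <= tk D P T k.
  by rewrite /tk le_max lexx.
rewrite /gap => h; have := le_trans h ht.
by rewrite lerBlDr -lerBlDl addrC.
Unshelve. all: by end_near. Qed.

End Feasible.

Theorem theorem5p5 (R : realType) (n m : nat)
  (D : problem R n m) (c : moduli R) (P : params R) (T : trace R n m)
  (c_alpha c_beta alpha_low beta_low pbar p_s : R)
  (hD : standing D c)
  (hP : params_ok P)
  (hgamma : ((gamma P)%:E < (rhof2 c + rhog2 c)%:E^-1)%E)
  (hc_alpha : 0 < c_alpha) (hc_beta : 0 < c_beta)
  (halpha_low : 0 < alpha_low) (hbeta_low : 0 < beta_low)
  (halpha : forall k, alpha_low <= alphak P k <= 2 / (Lpsix c T k + c_alpha))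
  (hbeta : forall k, beta_low <= betak P k <= 2 / (Lpsiy c T k + c_beta))
  (hT : AGILS D P T)
  (hs : (\sum_(1 <= k <oo) (sk P k)%:E < +oo)%E)
  (hps : p_s < 2)
  (hsps : (\sum_(1 <= k <oo) (k%:R * sk P k `^ p_s)%:E < +oo)%E)
  (hbounded : bounded_set (range (fun k => row_mx (xk T k) (yk T k))))
  (hp : \forall k \near \oo, pk T k = pbar)
  (hcorr : \forall k \near \oo, ytk T k = yk T k)
  (hKL : KL_function (merit D c (gamma P) c_alpha pbar)) :
  exists (xbar : 'rV[R]_n) (ybar : 'rV[R]_m),
    [/\ xk T @ \oo --> xbar, yk T @ \oo --> ybar &
        exists2 epst : R, epst <= eps P & KKT_point D (gamma P) epst xbar ybar].
Proof.
have gamma0 := gamma_gt0 hP.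
have [_ rf2 _] := f_wconvex hD; have [_ rg2 _] := g_wconvex hD.
have gamma_rho := gamma_rho_lt1 gamma0 (addr_ge0 rf2 rg2) hgamma.
have [N1 _ HN1] := hp; have [N2 _ HN2] := hcorr.
(* One index beyond N: the accuracy of theta~^k comes from the update at iteration k - 1, which must
   also have the final penalty parameter. *)
pose N := maxn N1 N2; pose M := N.+1.
have p0 : 0 < pbar by rewrite -(HN1 N1 (leqnn N1)) (pk_gt0 hP hT).
have st j : settled D c P T pbar (j + M).
  have pE k : (N <= k)%N -> pk T k = pbar.
    by move=> Nk; apply: HN1 => /=; apply: leq_trans Nk; exact: leq_maxl.
  have yE k : (N <= k)%N -> ytk T k = yk T k.
    by move=> Nk; apply: HN2 => /=; apply: leq_trans Nk; exact: leq_maxr.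
  have Nj : (N <= j + N)%N by exact: leq_addl.
  rewrite /M addnS; split; [exact: pE (leqW Nj)|exact: yE (leqW Nj)|].
  have pj : pk T (j + N).+1 = pk T (j + N) by rewrite !pE// leqW.
  by have [] := update_cases hD hP hT pj (yE _ (leqW Nj)).
have Xk := xk_mem hD hT; have Yk := yk_mem hD hP hT.
have s0 := sk_ge0 hP; have t0 := tolerance_ge0 D T hP.
have stl : small_tails (sk P) by exact: eseries_small_tails hs.
have ustl : small_tails (fun k => k%:R * sk P k `^ p_s).
  by apply: eseries_small_tails hsps => k; rewrite mulr_ge0 ?powR_ge0.
have [eta eta0 wst] := weighted_sqr_tails s0 stl hps ustl.
have [tt wtt] := error_tails eta0 s0 t0 (fun e => @tauk_small R P e hP)
  (ex_intro _ 1%N (tolerance_rec hP hT)) stl wst.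
pose B := err_scale c P c_alpha c_beta.
have B0 : 0 <= B by exact: le_trans ler01 (err_scale_ge1 c P hc_alpha hc_beta).
pose err j := B * tolerance D P T (j + M).
have err0 j : 0 <= err j by exact: mulr_ge0 B0 (t0 _).
have W0 := pweight_gt0 eta.
have err_tails : small_tails err.
  apply: (small_tails_le err0 _ B0 _ (small_tails_shift M tt)) => [k|]; first exact: t0.
  by exists 0%N => k _.
have werr_tails : small_tails (fun k => pweight eta k * err k ^+ 2).
  apply: (small_tails_le _ _ (sqr_ge0 B) _ (small_tails_shift M wtt)) => [k|k|].
  - by rewrite mulr_ge0 ?sqr_ge0// ltW.
  - by rewrite mulr_ge0 ?sqr_ge0// ltW.
  exists 0%N => k _; rewrite /err exprMn mulrCA ler_wpM2l ?sqr_ge0// ler_wpM2r ?sqr_ge0//.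
  by apply: pweight_le => //; exact: leq_addr.
have sub j := settled_subgrad hD hP hT hc_alpha hc_beta halpha_low hbeta_low
  halpha hbeta (st j).
have [nus Hnus] := choice sub; have [xis Hxis] := choice Hnus.
have desc j := settled_descent hD hP hT gamma_rho hc_alpha hc_beta halpha hbeta (st j).
have a0 : 0 < Num.min c_alpha c_beta / 4 by rewrite divr_gt0// lt_min hc_alpha.
pose C := grad_scale c P alpha_low beta_low pbar.
have C0 : 0 <= C by exact: (grad_scale_ge0 hD hP hT halpha_low hbeta_low (st 0%N)).
have dxl j := let: And4 _ _ h _ := Hxis j in h.
have dyl j := let: And4 _ _ _ h := Hxis j in h.
have bnd : bounded_set (range (fun j => row_mx (xk T (j + M)) (yk T (j + M)))).
  move: hbounded => [r [rr Hr]]; exists r; split=> // r' rr' _ [j _ <-].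
  by apply: Hr => //; exists (j + M)%N.
have [xbar [ybar [Xb Yb cx cy]]] := @iterates_cvg _ _ _ D c (gamma P) c_alpha pbar
  (Num.min c_alpha c_beta / 4) C eta hD gamma0 gamma_rho hc_alpha p0
  (fun j => xk T (j + M)) (fun j => yk T (j + M)) err nus xis
  (fun j => Xk _) (fun j => Yk _) a0 C0 eta0 err0 err_tails werr_tails desc
  (fun j => let: And4 h _ _ _ := Hxis j in h) (fun j => let: And4 _ h _ _ := Hxis j in h)
  dxl dyl bnd hKL.
have [nu [xi [Hnu Hxi Hdx Hdy]]] := @limit_stationary _ _ _ D c (gamma P) pbar
  (Num.min c_alpha c_beta / 4) C eta hD gamma0 p0
  (fun j => xk T (j + M)) (fun j => yk T (j + M)) err nus xis
  (fun j => Xk _) (fun j => Yk _) a0 eta0 err0 err_tails werr_tails desc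
  (fun j => let: And4 h _ _ _ := Hxis j in h) (fun j => let: And4 _ h _ _ := Hxis j in h)
  dxl dyl xbar ybar Xb Yb cx cy.
have cX : xk T @ \oo --> xbar by rewrite -(cvg_shiftn M).
have cY : yk T @ \oo --> ybar by rewrite -(cvg_shiftn M).
(* Delta_(k+1) is measured from (x^k, y~^k); beyond M, y~^k = y^k and it is the length of the
   step. *)
have cD : (fun k => Deltak T k) @ \oo --> (0 : R).
  rewrite -(cvg_shiftn M).
  have := @steps_cvg0 _ _ _ D c (gamma P) pbar
    (Num.min c_alpha c_beta / 4) eta hD gamma0 p0
    (fun j => xk T (j + M)) (fun j => yk T (j + M)) err
    (fun j => Xk _) (fun j => Yk _) a0 eta0 werr_tails desc.
  apply: cvg_trans; apply: near_eq_cvg; near=> j.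
  by have [_ yE _] := st j; rewrite /Deltak /= yE.
exists xbar, ybar; split=> //.
exists (vphi D xbar ybar - envelope D (gamma P) xbar ybar).
  by apply: (limit_feasible hD hP hT p0 Xb Yb cX cY cD) => //; exact: small_tails_cvg0.
have Y_ne : dY D !=set0 by exists ybar.
exact: (stationary_KKT hD Y_ne gamma0 gamma_rho p0 Xb Yb Hnu Hxi Hdx Hdy).
Unshelve. all: by end_near. Qed.
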